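(* Let $f$ be a smooth real-valued function on a neighbourhood of the origin in $\mathbb{R}^n$ with $f(0)=0$ and $\nabla f(0)=0$. Assume that $f$ is non-degenerate and satisfies the KN-condition. Let $\Sigma$ be a unimodular simplicial subdivision of the fan $\Sigma_0$ associated with the Newton polyhedron $\Gamma_+(f)$, and let $L$ and $N$ be the numbers defined from $\Sigma$ (see context). Then: (Ł$_0$) If $g$ is a smooth function on a neighbourhood of the origin such that $f^{-1}(0)\subset g^{-1}(0)$ in a neighbourhood of the origin, then there exist $c,\varepsilon>0$ such that $|f(\mathbf{x})|\ge c\,|g(\mathbf{x})|^{L}$ if $\|\mathbf{x}\|<\varepsilon$. (Ł$_1$) There exist $c,\varepsilon>0$ such that $\|\nabla f(\mathbf{x})\|\ge c\,|f(\mathbf{x})|^{1-\frac1N}$ if $\|\mathbf{x}\|<\varepsilon$. (Ł$_2$) There exist $c,\varepsilon>0$ such that $|f(\mathbf{x})|\ge c\,\operatorname{dist}(\mathbf{x},f^{-1}(0))^{N}$ if $\|\mathbf{x}\|<\varepsilon$.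
   Context: Smooth means $C^\infty$; $\|\cdot\|$ is the Euclidean norm and $\operatorname{dist}(\mathbf{x},f^{-1}(0))$ is the distance from $\mathbf{x}$ to the set $f^{-1}(0)$. $\mathbb{Z}_+$, $\mathbb{R}_+$ denote the nonnegative integers and reals, $\langle\cdot,\cdot\rangle$ the standard scalar product on $\mathbb{R}^n$. Newton polyhedron: if $\sum_\alpha c_\alpha \mathbf{x}^\alpha$ is the Taylor series of $f$ at $0$, then $\Gamma_+(f)$ is the convex hull of $\bigcup\{\alpha+\mathbb{R}^n_+ : c_\alpha\neq 0\}$; it is assumed non-empty. For $(\mathbf{a},l)\in\mathbb{R}^n\times\mathbb{R}$ put $H(\mathbf{a},l)=\{\mathbf{x}:\langle \mathbf{a},\mathbf{x}\rangle=l\}$ and $H^+(\mathbf{a},l)=\{\mathbf{x}:\langle \mathbf{a},\mathbf{x}\rangle\ge l\}$. The pair $(\mathbf{a},l)$ is valid if $\Gamma_+(f)\subset H^+(\mathbf{a},l)$; then $\gamma=\Gamma_+(f)\cap H(\mathbf{a},l)$ is the face of $\Gamma_+(f)$ defined by $(\mathbf{a},l)$. KN-condition: $f$ satisfies the KN-condition if for every face $\gamma$ of $\Gamma_+(f)$ and every valid pair $(\mathbf{a},l)$ defining $\gamma$, with $\mathbf{a}=(a_1,\dots,a_n)$, the limit $\lim_{t\to 0^+} f(t^{a_1}x_1,\dots,t^{a_n}x_n)/t^l$ exists for all $\mathbf{x}$ in a neighbourhood of the origin. Non-degeneracy: for a compact face $\gamma$ put $f_\gamma(\mathbf{x})=\sum_{\alpha\in\gamma\cap\mathbb{Z}^n_+}c_\alpha\mathbf{x}^\alpha$.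 $f$ is non-degenerate if for every compact face $\gamma$ of $\Gamma_+(f)$ the system $\partial f_\gamma/\partial x_j(\mathbf{x})=0$, $j=1,\dots,n$, has no solutions in $(\mathbb{R}\setminus\{0\})^n$. Fans: for $\mathbf{a}\in(\mathbb{R}^n)^*_+\cong\mathbb{R}^n_+$ put $l(\mathbf{a})=\min\{\langle\mathbf{a},\mathbf{x}\rangle:\mathbf{x}\in\Gamma_+(f)\}$ and $\gamma(\mathbf{a})=\{\mathbf{x}\in\Gamma_+(f):\langle\mathbf{a},\mathbf{x}\rangle=l(\mathbf{a})\}$. Call $\mathbf{a},\mathbf{a}'$ equivalent if $\gamma(\mathbf{a})=\gamma(\mathbf{a}')$. The closures of the equivalence classes are rational polyhedral cones forming a fan $\Sigma_0$ that decomposes $\mathbb{R}^n_+$. A cone $\mathbb{R}_+\mathbf{a}^1+\dots+\mathbb{R}_+\mathbf{a}^s$ with $\mathbf{a}^i\in\mathbb{Z}^n_+$ linearly independent is an $s$-simplex; it is unimodular if there exist $\mathbf{a}^{s+1},\dots,\mathbf{a}^n\in\mathbb{Z}^n_+$ such that the matrix with rows $\mathbf{a}^1,\dots,\mathbf{a}^n$ has determinant $\pm1$. $\Sigma$ is a simplicial subdivision of $\Sigma_0$ all of whose simplices are unimodular (such a subdivision exists). $\Sigma^{(n)}$ is the set of $n$-simplices of $\Sigma$; each $\sigma\in\Sigma^{(n)}$ is written $\sigma=\mathbb{R}_+\mathbf{a}^1(\sigma)+\dots+\mathbb{R}_+\mathbf{a}^n(\sigma)$ with these unimodular generators $\mathbf{a}^i(\sigma)\in\mathbb{Z}^n_+$.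 Numbers $L,N$: $l(\sigma)=\max_{1\le i\le n} l(\mathbf{a}^i(\sigma))$, $N(\sigma)=\sum_{i=1}^n l(\mathbf{a}^i(\sigma))$, $L=\max\{l(\sigma):\sigma\in\Sigma^{(n)}\}$, $N=\max\{N(\sigma):\sigma\in\Sigma^{(n)}\}$. *)

(* Defs.v *)
From HB Require Import structures.
From mathcomp Require Import all_boot all_order all_algebra.
From mathcomp Require Import all_classical all_reals all_analysis.

Set Implicit Arguments.
Unset Strict Implicit.
Unset Printing Implicit Defensive.

Import Order.TTheory GRing.Theory Num.Theory.
Import numFieldNormedType.Exports.

Local Open Scope classical_set_scope.
Local Open Scope ring_scope.

Section definitions.
Context {R : realType}.

(* Junk value 0 when the minimum (maximum) does not exist. *)
Definition minimum (A : set R) : R := xget 0 [set m | A m /\ lbound A m].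
Definition maximum (A : set R) : R := xget 0 [set m | A m /\ ubound A m].

Context {n : nat}.
Implicit Types (f : 'rV[R]_n -> R) (a x y : 'rV[R]_n) (l : R).
Implicit Types (G gam U sig tau : set 'rV[R]_n) (Sig : set (set 'rV[R]_n)).

Definition dotp x y : R := \sum_j x 0 j * y 0 j.

(* The library norm `|x| on row vectors is the sup norm; it induces the same
   topology. *)
Definition enorm x : R := Num.sqrt (dotp x x).

Definition edist_to x A : R := inf [set enorm (x - y) | y in A].

Definition nonneg : set 'rV[R]_n := [set x | forall j, 0 <= x 0 j].

Definition embed m p (A : 'M[nat]_(m, p)) : 'M[R]_(m, p) :=
  map_mx (fun k => k%:R) A.

Definition partial (j : 'I_n) f : 'rV[R]_n -> R :=
  fun x => 'D_(delta_mx 0 j) f x.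

Definition partials (s : seq 'I_n) f : 'rV[R]_n -> R := foldr partial f s.

Definition gradient f x : 'rV[R]_n := \row_j partial j f x.

(* C^oo on U: all iterated partial derivatives exist and are continuous. *)
Definition smooth_on U f :=
  forall (s : seq 'I_n) x, U x ->
    {for x, continuous (partials s f)} /\
    forall j, derivable (partials s f) x (delta_mx 0 j).

Definition multipartial (alpha : 'rV[nat]_n) f : 'rV[R]_n -> R :=
  partials (flatten [seq nseq (alpha 0 j) j | j <- enum 'I_n]) f.

Definition taylor_coef f (alpha : 'rV[nat]_n) : R :=
  multipartial alpha f 0 / \prod_j ((alpha 0 j)`!)%:R.

Definition monomial (alpha : 'rV[nat]_n) x : R := \prod_j x 0 j ^+ alpha 0 j.

Definition convex_hull (A : set 'rV[R]_n) : set 'rV[R]_n :=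
  smallest (@convex_set R 'rV[R]_n) A.

Definition newton f : set 'rV[R]_n :=
  convex_hull (\bigcup_(alpha in [set alpha | taylor_coef f alpha != 0])
    [set embed alpha + y | y in nonneg]).

Definition hyperplane a l : set 'rV[R]_n := [set x | dotp a x = l].
Definition halfspace a l : set 'rV[R]_n := [set x | l <= dotp a x].

Definition valid f a l := newton f `<=` halfspace a l.

(* Faces are nonempty: were the empty set a (compact) face, no function would
   be nondegenerate. *)
Definition defines_face f a l gam :=
  [/\ valid f a l, gam = newton f `&` hyperplane a l & gam !=set0].

Definition face f gam := exists a l, defines_face f a l gam.

Definition KN_limit_exists f a l x :=
  cvg ((fun t : R => f (\row_j (t `^ a 0 j * x 0 j)) / t `^ l) @ 0^'+).

Definition KN_condition f :=
  forall gam a l, face f gam -> defines_face f a l gam ->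
    \forall x \near (0 : 'rV[R]_n), KN_limit_exists f a l x.

(* The sum is finite when gam is compact, the only case in which it is used. *)
Definition face_part f gam x : R :=
  \sum_(alpha \in [set alpha | gam (embed alpha)])
    (taylor_coef f alpha * monomial alpha x).

Definition newton_nondegenerate f :=
  forall gam, face f gam -> compact gam ->
  ~ exists x, (forall j, x 0 j != 0) /\
              (forall j, partial j (face_part f gam) x = 0).

Definition lmin f a : R := minimum [set dotp a x | x in newton f].

Definition gface f a : set 'rV[R]_n :=
  [set x | newton f x /\ dotp a x = lmin f a].

Definition gface_class f a : set 'rV[R]_n :=
  [set a' | nonneg a' /\ gface f a' = gface f a].

Definition Sigma0 f : set (set 'rV[R]_n) :=
  [set closure (gface_class f a) | a in nonneg].

(* The cone generated by the rows of A. *)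
Definition cone s (A : 'M[nat]_(s, n)) : set 'rV[R]_n :=
  [set c *m embed A | c in [set c : 'rV[R]_s | forall i, 0 <= c 0 i]].

Definition unimodular s (A : 'M[nat]_(s, n)) :=
  exists (le_sn : (s <= n)%N) (B : 'M[nat]_n),
    (forall i : 'I_s, row (widen_ord le_sn i) B = row i A) /\
    `|\det (map_mx Posz B)| = 1.

Definition simplex s (A : 'M[nat]_(s, n)) := row_free (embed A).

Definition unimodular_simplex s sig (A : 'M[nat]_(s, n)) :=
  [/\ simplex A, unimodular A & sig = cone A].

Definition cone_face tau sig :=
  exists u : 'rV[R]_n, sig `<=` halfspace u 0 /\ tau = sig `&` hyperplane u 0.

(* That the members of a fan are rational polyhedral cones is not repeated
   here: below, Sig consists of simplices. *)
Definition fan Sig :=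
  [/\ finite_set Sig,
      (forall sig tau, Sig sig -> cone_face tau sig -> Sig tau) &
      (forall sig tau, Sig sig -> Sig tau ->
         cone_face (sig `&` tau) sig /\ cone_face (sig `&` tau) tau)].

Definition unimodular_subdivision f Sig :=
  [/\ fan Sig,
      (forall sig, Sig sig ->
         exists s (A : 'M[nat]_(s, n)), unimodular_simplex sig A),
      \bigcup_(sig in Sig) sig = \bigcup_(tau in Sigma0 f) tau &
      (forall sig, Sig sig -> exists2 tau, Sigma0 f tau & sig `<=` tau)].

Definition top_simplices Sig : set (set 'rV[R]_n) :=
  [set sig | Sig sig /\ exists A : 'M[nat]_n, unimodular_simplex sig A].

(* The unimodular generators of an n-simplex are unique up to order, so that
   l(sigma) and N(sigma) do not depend on the choice. *)
Definition generators sig : 'M[nat]_n :=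
  xget (const_mx 0%N) [set A | unimodular_simplex sig A].

Definition generator sig (i : 'I_n) : 'rV[R]_n := embed (row i (generators sig)).

Definition l_simplex f sig : R :=
  maximum [set lmin f (generator sig i) | i in [set: 'I_n]].

Definition N_simplex f sig : R := \sum_(i < n) lmin f (generator sig i).

Definition Lnum f Sig : R := maximum [set l_simplex f sig | sig in top_simplices Sig].
Definition Nnum f Sig : R := maximum [set N_simplex f sig | sig in top_simplices Sig].

End definitions.

(* Main.v *)
Require Import Defs.
From HB Require Import structures.
From mathcomp Require Import all_boot all_order all_algebra.
From mathcomp Require Import finmap.
From mathcomp Require Import all_classical all_reals all_analysis.
From mathcomp Require Import ring lra.

Set Implicit Arguments.
Unset Strict Implicit.
Unset Printing Implicit Defensive.

Import Order.TTheory GRing.Theory Num.Theory.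
Import numFieldNormedType.Exports.

Local Open Scope classical_set_scope.
Local Open Scope ring_scope.

(** Let a^1, .., a^n be the generators of an n-simplex of the subdivision and A
    the matrix with these rows. The map x_j = s_j prod_k y_k^(a^k_j), where s is a
    vector of signs, sends the cube (0, 1]^n onto the points x of an orthant for
    which - ln |x| lies in the cone ([chart_cover]). One exponent of the Taylor
    series minimizes all the forms <a^k, .> on the Newton polyhedron
    ([Sigma0_vertex]); write l_k for the minima. The KN-condition says that the
    pullback of f is O(t^l_k) when y_k is replaced by t y_k, so Hadamard's lemma,
    applied l_1 + .. + l_n times, writes this pullback as y^l fs with fs of class
    C^1 across the coordinate hyperplanes ([monomial_division],
    [strict_transform_exists]).

    Let y0 be a point of the unit cube over the origin and I the set of its
    vanishing coordinates. Letting these coordinates tend to 0 identifies fs on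
    y_I = 0 with the polynomial of the compact face defined by the sum of the a^k,
    k in I ([face_limit], [face_transform]). The chart exchanges the Euler fields
    y_k d/dy_k and x_j d/dx_j through the invertible matrix A, so x_j d_j f is y^l
    times a continuous function, and nondegeneracy says that for some j this
    function is nonzero at y0; for that j, moreover, a^k_j <= l_k for k in I
    ([chart_nondegenerate]). The inequalities are consequences of this.

    - If g vanishes where f does, g is the product of the y_k with l_k > 0 times a
      function Gt, and |Gt| = O(|fs|): where fs(y0) = 0, nondegeneracy gives a
      direction in which fs has nonzero derivative, and following it leads to a
      zero of fs, hence of Gt, at distance O(|fs|). Raising to the power L >= l_k
      compares |g|^L with y^l |fs| ([comparison_ineq_local]).
    - For the gradient, let D be its norm, m the least y_k with l_k > 0 and
      X = |x_j|. Then X m^(N-1) <= y^l = O(X D) and |f| = O(m D), whence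
      |f|^(N-1) = O(m^(N-1) D^(N-1)) = O(D^N) ([gradient_ineq_local]).
    - The distance inequality follows from the gradient inequality alone, which
      says that |f|^(1/N) has slope bounded below off the zero set; minimizing
      |f|^(1/N) + k |x - x0| on a ball about x0 then bounds |f(x0)|^(1/N) below by
      a multiple of the distance ([distance_of_gradient]).

    Compactness of the unit cube makes the local estimates uniform
    ([local_to_uniform]). They hold at all points of a small box with nonzero
    coordinates whose vector - ln |x| avoids the lower-dimensional cones of the
    subdivision; these points are dense ([generic_dense]), and both sides are
    continuous. *)

(** * Limits, mean values and differentiability *)

Section big_limits.
Context {R : realType} {T : Type} {F : set_system T} {FF : Filter F}.
Context {I : Type} (r : seq I) (P : pred I).

Lemma cvg_sumr (g : I -> T -> R) (a : I -> R) :
  (forall i, P i -> g i x @[x --> F] --> a i) ->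
  \sum_(i <- r | P i) g i x @[x --> F] --> \sum_(i <- r | P i) a i.
Proof. by move=> H; apply: cvg_big => //; exact: add_continuous. Qed.

End big_limits.

Section lines.
Context {R : realType} {V : normedModType R}.
Implicit Types (f : V -> R) (x v : V).

Lemma is_derive_line f x v (t : R) :
  derivable f (t *: v + x) v ->
  is_derive t 1 (fun s : R => f (s *: v + x)) ('D_v f (t *: v + x)).
Proof.
have E : (fun h : R => h^-1 *: (f ((h *: 1 + t) *: v + x) - f (t *: v + x)))
       = (fun h : R => h^-1 *: (f (h *: v + (t *: v + x)) - f (t *: v + x))).
  by apply/funext => h; rewrite [_%:A]mulr1 scalerDl addrA.
move=> df; apply: DeriveDef; first by rewrite /derivable /= E.
by rewrite /derive /= E.
Qed.

Lemma MVT_line f x v (h : R) :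
  (forall t : R, `|t| <= `|h| -> derivable f (t *: v + x) v) ->
  exists2 t, `|t| <= `|h| & f (h *: v + x) - f x = 'D_v f (t *: v + x) * h.
Proof.
move=> df; pose g (s : R) := f (s *: v + x).
have dg (t : R) : `|t| <= `|h| -> is_derive t 1 g ('D_v f (t *: v + x)).
  by move=> /df; exact: is_derive_line.
have cg (a b : R) : `|a| <= `|h| -> `|b| <= `|h| ->
    {within `[a, b], continuous g}.
  move=> ah bh; apply: derivable_within_continuous => t /[!in_itv]/= /andP[at_ tb].
  have [] // := dg t.
  move: ah bh; rewrite !ler_norml => /andP[a1 _] /andP[_ b1].
  by rewrite (le_trans a1) //= (le_trans tb).
have [h0|h0] := leP 0 h.
- have [| |t] := @MVT_segment R g (fun t => 'D_v f (t *: v + x)) 0 h h0.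
  + move=> t /[!in_itv]/= /andP[t0 th]; apply: dg.
    by rewrite !ger0_norm// ltW.
  + by apply: cg => //; rewrite normr0.
  + rewrite in_itv/= => /andP[t0 th].
    rewrite /g scale0r add0r subr0 => E; exists t => //.
    by rewrite !ger0_norm.
- have [| |t] := @MVT_segment R g (fun t => 'D_v f (t *: v + x)) h 0 (ltW h0).
  + move=> t /[!in_itv]/= /andP[t0 th]; apply: dg.
    by rewrite !ler0_norm ?lerN2// ltW.
  + by apply: cg => //; rewrite normr0.
  + rewrite in_itv/= => /andP[t0 th].
    rewrite /g scale0r add0r sub0r mulrN => E; exists t.
      by rewrite !ler0_norm ?lerN2// ltW.
    by rewrite -opprB E opprK.
Qed.

End lines.

Section differentiability.
Context {R : realType} {n : nat}.
Implicit Types (f g : 'rV[R]_n -> R) (x y v : 'rV[R]_n) (D : set 'rV[R]_n).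

Definition dotpr (a v : 'rV[R]_n) : R := dotp v a.

Lemma dotpr_is_linear a : linear (dotpr a).
Proof.
move=> k u v; rewrite /dotpr /dotp /GRing.scale/= mulr_sumr -big_split /=.
by apply: eq_bigr => j _; rewrite !mxE mulrDl mulrA.
Qed.
HB.instance Definition _ a :=
  GRing.isLinear.Build R 'rV[R]_n R _ (dotpr a) (dotpr_is_linear a).

Lemma dotpr_continuous a : continuous (dotpr a).
Proof.
move=> x; rewrite /dotpr /dotp.
apply: (cvg_sumr (F := nbhs x)) => j _; apply: cvgMr_tmp; exact: coord_continuous.
Qed.

Lemma norm_coord x j : `|x 0 j| <= `|x|.
Proof.
rewrite [leRHS]/Num.Def.normr/= mx_normrE.
exact: (le_bigmax _ (fun i => `|x i.1 i.2|) (0, j)).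
Qed.

Lemma norm_ltP x (e : R) : 0 < e -> (`|x| < e) <-> (forall j, `|x 0 j| < e).
Proof.
move=> e0; split=> [xe j|H]; first exact: le_lt_trans (norm_coord x j) xe.
rewrite [ltLHS]/Num.Def.normr/= mx_normrE; apply/bigmax_ltP; split => //.
by case=> i j _ /=; rewrite (ord1 i).
Qed.

Lemma cvg_rV (T : Type) (F : set_system T) {FF : Filter F}
    (Phi : T -> 'rV[R]_n) (l : 'rV[R]_n) :
  (forall j, Phi t 0 j @[t --> F] --> l 0 j) -> Phi t @[t --> F] --> l.
Proof.
move=> H; apply/cvgrPdist_lt => e e0; near=> z.
apply/norm_ltP => // j; rewrite !mxE; move: j; near: z.
apply: filter_forall => j.
by have /cvgrPdist_lt := H j; apply.
Unshelve. all: by end_near. Qed.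

Lemma norm_delta j : `|delta_mx 0 j : 'rV[R]_n| <= 1.
Proof.
rewrite [leLHS]/Num.Def.normr/= mx_normrE; apply/bigmax_leP; split => // -[i k] _ /=.
by rewrite mxE; case: (_ && _); rewrite ?normr1 ?normr0.
Qed.

(** The increment along v is split into n increments along the coordinate
    axes; the mean value theorem turns each into a partial derivative at a point
    close to x, and continuity replaces it by the partial derivative at x. *)
Lemma C1_diff D f x : open D -> D x ->
  (forall y, D y -> forall j, derivable f y (delta_mx 0 j)) ->
  (forall j, {for x, continuous (partial j f)}) ->
  differentiable f x /\ 'd f x = dotpr (gradient f x) :> ('rV[R]_n -> R).
Proof.
move=> oD Dx df cf.
have main : f \o shift x =
  cst (f x) + dotpr (gradient f x) +o_ (0 : 'rV[R]_n) (id : 'rV[R]_n -> 'rV[R]_n).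
  apply/eqaddoP => _/posnumP[e] /=.
  have [d d0 dD] : exists2 d : R, 0 < d & forall y, `|y| < d ->
     D (y + x) /\ forall j, `|partial j f (y + x) - partial j f x| <= e%:num / n.+1%:R.
    have : \forall y \near x, D y /\
        forall j, `|partial j f y - partial j f x| <= e%:num / n.+1%:R.
      near=> y; split; first by near: y; exact: open_nbhs_nbhs.
      move=> j; rewrite distrC; move: j; near: y; apply: filter_forall => j.
      by have /cvgrPdist_le := cf j; apply.
    move=> /nbhs_ballP[d /= d0 dH]; exists d => // y yd; apply: dH.
    by rewrite -ball_normE /ball_/= opprD addrC subrK normrN.
  near=> v.
  have vd : `|v| < d / n.+1%:R.
    near: v; apply/nbhs_ballP; exists (d / n.+1%:R); first by rewrite /= divr_gt0.
    by move=> y; rewrite -ball_normE /ball_ /= sub0r normrN.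
  have claim (s : seq 'I_n) : (size s <= n)%N ->
     let w := \sum_(j <- s) v 0 j *: delta_mx 0 j in
     `|f (w + x) - f x - \sum_(j <- s) v 0 j * partial j f x|
        <= e%:num / n.+1%:R * ((size s)%:R * `|v|) /\ `|w| <= (size s)%:R * `|v|.
    elim: s => [_|j s IH ss] /=.
      by rewrite !big_nil add0r !subrr !normr0 !mul0r mulr0 lexx.
    have /= := IH (ltnW ss); rewrite !big_cons.
    set w := \sum_(j <- s) _; set g := \sum_(j <- s) _ => -[IH1 IH2].
    have small t : `|t| <= `|v 0 j| -> `|t *: delta_mx 0 j + w| < d.
      move=> tv; apply: le_lt_trans (ler_normD _ _) _.
      apply: (@le_lt_trans _ _ (n.+1%:R * `|v|)).
        rewrite normrZ; apply: (@le_trans _ _ (`|v| + n%:R * `|v|)).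
          apply: lerD.
            apply: le_trans (ler_pM _ _ tv (norm_delta j)) _ => //.
            by rewrite mulr1 norm_coord.
          apply: (le_trans IH2); apply: ler_wpM2r => //.
          by rewrite ler_nat ltnW.
        by rewrite -natr1 mulrDl mul1r addrC.
      by rewrite mulrC -ltr_pdivlMr.
    have [|t tv] := @MVT_line R _ f (w + x) (delta_mx 0 j) (v 0 j).
      by move=> t /small; rewrite addrA => /dD[H _]; exact: df.
    rewrite !addrA => E.
    have -> : (size s).+1%:R = (size s)%:R + 1 :> R by rewrite natr1.
    split.
      have -> : f (v 0 j *: delta_mx 0 j + w + x) - f x - (v 0 j * partial j f x + g) =
         (f (v 0 j *: delta_mx 0 j + w + x) - f (w + x) - v 0 j * partial j f x) +
         (f (w + x) - f x - g) by ring.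
      rewrite E mulrDl mul1r mulrDr [leRHS]addrC.
      apply: le_trans (ler_normD _ _) _; apply: lerD => //.
      rewrite mulrC -mulrBr normrM mulrC; apply: ler_pM => //.
        by have [_] := dD _ (small _ tv); rewrite ?addrA; apply.
      exact: norm_coord.
    apply: le_trans (ler_normD _ _) _.
    rewrite mulrDl mul1r addrC; apply: lerD => //.
    rewrite normrZ; apply: le_trans (ler_pM _ _ (lexx _) (norm_delta j)) _ => //.
    by rewrite mulr1 norm_coord.
  have := claim (enum 'I_n); rewrite size_enum_ord => /(_ (leqnn _)) /= [+ _].
  rewrite !big_enum /= -row_sum_delta => H.
  rewrite -[X in `|X| <= _]/(f (v + x) - (f x + dotpr (gradient f x) v)).
  rewrite opprD addrA /dotpr /dotp.
  under eq_bigr do rewrite mxE.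
  apply: (le_trans H); rewrite mulrA; apply: ler_wpM2r => //.
  by rewrite -mulrA ler_piMr // mulrC ler_pdivrMr // mul1r ler_nat.
have dE := diff_unique (@dotpr_continuous _) main.
split => //; apply/diff_locallyP; rewrite dE; split => //.
exact: dotpr_continuous.
Unshelve. all: by end_near. Qed.

End differentiability.

Section near_point.
Context {R : realType} {n : nat}.
Implicit Types (y : 'rV[R]_n).

Lemma near_bounded (h : 'rV[R]_n -> R) y0 : {for y0, continuous h} ->
  \forall y \near y0, `|h y| <= `|h y0| + 1.
Proof.
move=> ch; have : \forall y \near y0, `|h y| < `|h y0| + 1.
  have c : `|h y| @[y --> y0] --> `|h y0| by exact: (cvg_norm ch).
  by have := cvgr_lt _ c; apply; rewrite ltrDl.
by apply: filterS => y /ltW.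
Qed.

Lemma near_away (h : 'rV[R]_n -> R) y0 : {for y0, continuous h} -> h y0 != 0 ->
  \forall y \near y0, `|h y0| / 2 <= `|h y|.
Proof.
move=> ch h0; have : \forall y \near y0, `|h y0| / 2 < `|h y|.
  have c : `|h y| @[y --> y0] --> `|h y0| by exact: (cvg_norm ch).
  by have := cvgr_gt _ c; apply; rewrite gtr_pMr ?normr_gt0 // invf_lt1 // ltr1n.
by apply: filterS => y /ltW.
Qed.

End near_point.

(** * The Euclidean norm *)

Section euclidean_norm.
Context {R : realType} {n : nat}.
Implicit Types (x y z : 'rV[R]_n) (t : R).

Lemma dotpD a x y : dotp a (x + y) = dotp a x + dotp a y.
Proof.
by rewrite /dotp -big_split; apply: eq_bigr => j _; rewrite mxE mulrDr.
Qed.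

Lemma dotpZ a t x : dotp a (t *: x) = t * dotp a x.
Proof.
by rewrite /dotp mulr_sumr; apply: eq_bigr => j _; rewrite mxE mulrCA.
Qed.

Lemma dotpC a x : dotp a x = dotp x a.
Proof. by apply: eq_bigr => j _; rewrite mulrC. Qed.

Lemma dotp_self_ge0 x : 0 <= dotp x x.
Proof. by apply: sumr_ge0 => j _; rewrite -expr2 sqr_ge0. Qed.

Lemma coord_le_enorm x j : `|x 0 j| <= enorm x.
Proof.
rewrite /enorm -sqrtr_sqr ler_wsqrtr // /dotp (bigD1 j) //= expr2 lerDl.
by apply: sumr_ge0 => i _; rewrite -expr2 sqr_ge0.
Qed.

Lemma enorm_ge0 x : 0 <= enorm x.
Proof. exact: sqrtr_ge0. Qed.

Lemma enorm_sqr x : enorm x ^+ 2 = dotp x x.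
Proof. exact: sqr_sqrtr (dotp_self_ge0 x). Qed.

Lemma enorm0 : enorm (0 : 'rV[R]_n) = 0.
Proof. by rewrite /enorm /dotp big1 ?sqrtr0 // => j _; rewrite mxE mul0r. Qed.

Lemma enormZ t x : enorm (t *: x) = `|t| * enorm x.
Proof.
rewrite /enorm dotpZ dotpC dotpZ mulrA -expr2 sqrtrM ?sqr_ge0 //.
by rewrite sqrtr_sqr.
Qed.

Lemma enormN x : enorm (- x) = enorm x.
Proof. by rewrite -scaleN1r enormZ normrN1 mul1r. Qed.

(** Expand the square of the norm of |y| x - |x| y. *)
Lemma cauchy_schwarz x y : dotp x y <= enorm x * enorm y.
Proof.
set p := enorm x; set q := enorm y.
have p0 : 0 <= p by exact: enorm_ge0.
have q0 : 0 <= q by exact: enorm_ge0.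
have [q0'|qn0] := eqVneq q 0.
  rewrite q0' mulr0 /dotp big1 // => j _; have := coord_le_enorm y j.
  by rewrite -/q q0' normr_le0 => /eqP ->; rewrite mulr0.
have qp : 0 < q by rewrite lt_neqAle eq_sym qn0.
have [p0'|pn0] := eqVneq p 0.
  rewrite p0' mul0r /dotp big1 // => j _; have := coord_le_enorm x j.
  by rewrite -/p p0' normr_le0 => /eqP ->; rewrite mul0r.
have pp : 0 < p by rewrite lt_neqAle eq_sym pn0.
have := dotp_self_ge0 (q *: x - p *: y).
rewrite -scaleN1r !(dotpD, dotpZ) ![dotp (_ + _) _]dotpC !(dotpD, dotpZ).
rewrite -!enorm_sqr -/p -/q [dotp y x]dotpC => H.
have : 0 <= 2 * p * q * (p * q - dotp x y) by apply: le_trans H _; rewrite le_eqVlt;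
  apply/orP; left; apply/eqP; ring.
by rewrite pmulr_rge0 ?subr_ge0 // !mulr_gt0.
Qed.

Lemma enorm_triangle x y : enorm (x + y) <= enorm x + enorm y.
Proof.
rewrite -(@ler_pXn2r _ 2) ?nnegrE ?addr_ge0 ?enorm_ge0 //.
rewrite enorm_sqr dotpD ![dotp (_ + _) _]dotpC !dotpD -!enorm_sqr [dotp y x]dotpC.
have := cauchy_schwarz x y.
set a := enorm x; set b := enorm y; set d := dotp x y => H; lra.
Qed.

Lemma enorm_continuous : continuous (@enorm R n).
Proof.
move=> x; rewrite /continuous_at.
have cd : dotp z z @[z --> x] --> dotp x x.
  apply: (@cvg_sumr _ _ (nbhs x)) => j _.
  exact: (cvgM (@coord_continuous R 1 n 0 j x) (@coord_continuous R 1 n 0 j x)).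
exact: (cvg_comp _ _ cd (@sqrt_continuous R _)).
Qed.

Lemma eball_compact x0 (d : R) : compact [set x : 'rV[R]_n | enorm (x - x0) <= d].
Proof.
apply: bounded_closed_compact.
  exists (`|d| + `|x0|); split => // M HM x /= xd.
  apply: ltW; apply: le_lt_trans HM.
  rewrite -[x](subrK x0); apply: le_trans (ler_normD _ _) _; apply: lerD => //.
  rewrite [leLHS]/Num.Def.normr/= mx_normrE; apply/bigmax_leP; split => //.
  case=> i j _ /=; rewrite (ord1 i); apply: le_trans (coord_le_enorm _ j) _.
  exact: le_trans xd (ler_norm d).
apply: (@closed_comp _ _ (fun x : 'rV[R]_n => enorm (x - x0)) [set u | u <= d]);
  last exact: closed_le.
move=> x _; have cs : z - x0 @[z --> x] --> x - x0.
  by apply: (@cvgB _ _ _ (nbhs x) _ id (fun=> x0)) => //; exact: cvg_cst.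
exact: (cvg_comp _ _ cs (@enorm_continuous _)).
Qed.

End euclidean_norm.

(** * Functions with continuous partial derivatives up to a given order *)

Section Ck.
Context {R : realType} {n : nat}.
Implicit Types (f g : 'rV[R]_n -> R) (x y v : 'rV[R]_n) (D : set 'rV[R]_n).
Implicit Types (i j k : 'I_n) (m : nat).

(** Unlike [smooth_on], this has a finite order, so that operations that
    cost one derivative at each step (division by a coordinate) can be iterated
    by counting. *)
Fixpoint Ck D m f : Prop :=
  (forall x, D x -> {for x, continuous f}) /\
  if m is m'.+1 then
    forall j, (forall x, D x -> derivable f x 'e_j) /\ Ck D m' (partial j f)
  else True.

Lemma Ck_cont D m f x : Ck D m f -> D x -> {for x, continuous f}.
Proof. by case: m => [|m] [H _]; exact: H. Qed.

Lemma Ck_der D m f j x : Ck D m.+1 f -> D x -> derivable f x 'e_j.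
Proof. by move=> [_ /(_ j)[H _]]; exact: H. Qed.

Lemma Ck_partial D m f j : Ck D m.+1 f -> Ck D m (partial j f).
Proof. by move=> [_ /(_ j)[_ H]]. Qed.

Lemma Ck_pred D m f : Ck D m.+1 f -> Ck D m f.
Proof.
elim: m f => [|m IH] f [cf df]; split => // j.
by split; [have [] := df j|apply: IH; have [] := df j].
Qed.

Lemma Ck_leq D m p f : (m <= p)%N -> Ck D p f -> Ck D m f.
Proof.
by elim: p => [|p IH]; [rewrite leqn0 => /eqP->
  | rewrite leq_eqVlt => /orP[/eqP-> //|/IH H /Ck_pred]].
Qed.

Lemma Ck_sub D E m f : E `<=` D -> Ck D m f -> Ck E m f.
Proof.
move=> ED; elim: m f => [|m IH] f [cf df]; split => //.
- by move=> x /ED; exact: cf.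
- by move=> x /ED; exact: cf.
- by move=> j; have [d1 d2] := df j; split => [x /ED|]; [exact: d1|exact: IH].
Qed.

Lemma smooth_on_Ck D f m : smooth_on D f -> Ck D m f.
Proof.
elim: m f => [|m IH] f sf; split => //; try by move=> x /(sf [::])[].
move=> j; split; first by move=> x /(sf [::])[_]; exact.
apply: IH => s x Dx; have := sf (rcons s j) x Dx.
by rewrite /partials foldr_rcons.
Qed.

Context (D : set 'rV[R]_n) (oD : open D).

Let near_D x : D x -> \forall y \near x, D y.
Proof. by move=> Dx; apply: open_nbhs_nbhs. Qed.

Lemma partial_ext j f g x : D x -> (forall y, D y -> f y = g y) ->
  partial j f x = partial j g x.
Proof.
move=> Dx fg; apply: near_eq_derive.
near=> y; apply: fg; near: y; exact: near_D.
Unshelve. all: by end_near. Qed.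

Lemma Ck_ext m f g : (forall y, D y -> f y = g y) -> Ck D m f -> Ck D m g.
Proof.
have cext f' g' x : (forall y, D y -> f' y = g' y) -> D x ->
    {for x, continuous f'} -> {for x, continuous g'}.
  move=> fg Dx cf; rewrite /prop_for /continuous_at -(fg _ Dx).
  apply: cvg_trans cf; apply: (@near_eq_cvg _ _ (nbhs x) _ f' g').
  near=> y; rewrite fg //; near: y; exact: near_D.
elim: m f g => [|m IH] f g fg [cf df]; split => //.
- by move=> x Dx; apply: (cext f) => //; exact: cf.
- by move=> x Dx; apply: (cext f) => //; exact: cf.
- move=> j; have [d1 d2] := df j; split => [x Dx|].
    apply: near_eq_derivable (d1 _ Dx).
    near=> y; apply: fg; near: y; exact: near_D.
  by apply: IH d2 => y Dy; exact: partial_ext.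
Unshelve. all: by end_near. Qed.

Lemma Ck_cst m (c : R) : Ck D m (fun=> c).
Proof.
elim: m c => [|m IH] c; split => //; try by move=> x _; exact: cst_continuous.
move=> j; split; first by move=> x _; exact: derivable_cst.
by apply: (Ck_ext (f := fun=> 0)) (IH 0) => y _; rewrite /partial derive_cst.
Qed.

Lemma Ck_add m f g : Ck D m f -> Ck D m g -> Ck D m (fun x => f x + g x).
Proof.
elim: m f g => [|m IH] f g [cf df] [cg dg]; split => //;
  try by move=> x Dx; apply: continuousD; [exact: cf|exact: cg].
move=> j; have [d1 d2] := df j; have [e1 e2] := dg j; split.
  by move=> x Dx; apply: derivableD; [exact: d1|exact: e1].
apply: (Ck_ext _ (IH _ _ d2 e2)) => y Dy.
by rewrite /partial (@deriveD _ _ _ f g) //; [exact: d1|exact: e1].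
Qed.

Lemma Ck_mul m f g : Ck D m f -> Ck D m g -> Ck D m (fun x => f x * g x).
Proof.
elim: m f g => [|m IH] f g [cf df] [cg dg]; split => //;
  try by move=> x Dx; apply: continuousM; [exact: cf|exact: cg].
move=> j; have [d1 d2] := df j; have [e1 e2] := dg j; split.
  by move=> x Dx; apply: derivableM; [exact: d1|exact: e1].
have Cf : Ck D m f by apply: Ck_pred; split.
have Cg : Ck D m g by apply: Ck_pred; split.
apply: (Ck_ext _ (Ck_add (IH _ _ Cf e2) (IH _ _ Cg d2))) => y Dy.
by rewrite /partial (@deriveM _ _ f g) //; [exact: d1|exact: e1].
Qed.

Lemma Ck_sum m (I : Type) (r : seq I) (P : pred I) (F : I -> 'rV[R]_n -> R) :
  (forall a, P a -> Ck D m (F a)) -> Ck D m (fun x => \sum_(a <- r | P a) F a x).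
Proof.
move=> H; elim: r => [|a r IH].
  by apply: (Ck_ext _ (Ck_cst m 0)) => y _; rewrite big_nil.
case Pa : (P a); last by apply: (Ck_ext _ IH) => y _; rewrite big_cons Pa.
by apply: (Ck_ext _ (Ck_add (H _ Pa) IH)) => y _; rewrite big_cons Pa.
Qed.

Lemma Ck_prod m (I : Type) (r : seq I) (P : pred I) (F : I -> 'rV[R]_n -> R) :
  (forall a, P a -> Ck D m (F a)) -> Ck D m (fun x => \prod_(a <- r | P a) F a x).
Proof.
move=> H; elim: r => [|a r IH].
  by apply: (Ck_ext _ (Ck_cst m 1)) => y _; rewrite big_nil.
case Pa : (P a); last by apply: (Ck_ext _ IH) => y _; rewrite big_cons Pa.
by apply: (Ck_ext _ (Ck_mul (H _ Pa) IH)) => y _; rewrite big_cons Pa.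
Qed.

Lemma Ck_exp m f p : Ck D m f -> Ck D m (fun x => f x ^+ p).
Proof.
move=> H; elim: p => [|p IH].
  by apply: (Ck_ext _ (Ck_cst m 1)) => y _; rewrite expr0.
by apply: (Ck_ext _ (Ck_mul H IH)) => y _; rewrite exprS.
Qed.

Lemma is_derive_coord k j x :
  is_derive x ('e_k : 'rV[R]_n) (fun y : 'rV[R]_n => y 0 j) ((j == k)%:R : R).
Proof.
have E : (fun h : R => h^-1 *: ((h *: ('e_k : 'rV[R]_n) + x) 0 j - x 0 j)) @ 0^' -->
    ((j == k)%:R : R).
  apply: cvg_near_cst; near=> h.
  rewrite !mxE eqxx /= addrK [LHS]mulrA mulVf ?mul1r //.
  by near: h; exact: nbhs_dnbhs_neq.
apply: DeriveDef; first by apply/cvg_ex; exists ((j == k)%:R : R).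
exact: cvg_lim E.
Unshelve. all: by end_near. Qed.

Lemma Ck_coord m j : Ck D m (fun x => x 0 j).
Proof.
case: m => [|m]; split => //; try by move=> x _; exact: coord_continuous.
move=> k; split; first by move=> x _; have [] := is_derive_coord k j x.
apply: (Ck_ext _ (Ck_cst m (j == k)%:R)) => y _.
by rewrite /partial (@derive_val _ _ _ _ _ _ _ (is_derive_coord k j y)).
Qed.

Lemma partialM j f g x : derivable f x 'e_j -> derivable g x 'e_j ->
  partial j (fun y => f y * g y) x = f x * partial j g x + g x * partial j f x.
Proof. by move=> df dg; rewrite /partial (@deriveM _ _ f g). Qed.

Lemma Ck_diff m f x : Ck D m.+1 f -> D x ->
  differentiable f x /\ 'd f x = dotpr (gradient f x) :> ('rV[R]_n -> R).
Proof.
move=> Cf Dx; apply: (@C1_diff _ _ D) => //.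
- by move=> y Dy j; exact: Ck_der Cf _.
- by move=> j; exact: Ck_cont (Ck_partial j Cf) Dx.
Qed.

End Ck.

Lemma derive_line0 {R : realType} {V W : normedModType R} (f : V -> W) (x v : V) :
  'D_v f x = 'D_(1 : R) (fun t : R => f (t *: v + x)) 0.
Proof.
rewrite /derive; apply: (congr1 (fun u : R -> W => lim (u h @[h --> 0^']))).
apply/funext => t /=.
by rewrite addr0 scale0r add0r [_%:A]mulr1.
Qed.

Lemma is_derive_curve {R : realType} {W : normedModType R} (h : W -> R)
    (c : R -> W) (t : R) :
  derivable c t 1 -> differentiable h (c t) ->
  is_derive t 1 (h \o c) ('d h (c t) ('D_1 c t)).
Proof.
move=> /derivable1_diffP dc dh.
have dcomp : differentiable (h \o c) t by exact: differentiable_comp.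
apply: DeriveDef; first exact/derivable1_diffP.
by rewrite deriveE // diff_comp // deriveE.
Qed.

Section composition.
Context {R : realType} {n p : nat}.
Implicit Types (h : 'rV[R]_p -> R) (Phi : 'rV[R]_n -> 'rV[R]_p).

Lemma is_derive_comp h Phi x v :
  differentiable h (Phi x) ->
  'd h (Phi x) = dotpr (gradient h (Phi x)) :> ('rV[R]_p -> R) ->
  (forall j, derivable (fun y => Phi y 0 j) x v) ->
  is_derive x v (h \o Phi)
    (\sum_j partial j h (Phi x) * 'D_v (fun y => Phi y 0 j) x).
Proof.
move=> dh hE dPhi.
have dP : derivable Phi x v by apply/derivable_mxP => i j; rewrite (ord1 i).
pose c (t : R) := Phi (t *: v + x).
have c0 : c 0 = Phi x by rewrite /c scale0r add0r.
have dc : derivable c 0 1 by have [H _] := derivable1P Phi x v; exact: H.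
have cE : 'D_1 c 0 = 'D_v Phi x by rewrite [RHS]derive_line0.
have [D1 D2] : is_derive (0 : R) 1 (h \o c) ('d h (Phi x) ('D_v Phi x)).
  by rewrite -cE -c0; apply: is_derive_curve; rewrite ?c0.
apply: DeriveDef; first by have [_ H] := derivable1P (h \o Phi) x v; exact: H.
rewrite [LHS]derive_line0; apply: etrans D2 _.
rewrite hE (derive_mx dP) /dotpr /dotp.
by apply: eq_bigr => j _; rewrite !mxE mulrC.
Qed.

Lemma Ck_comp (D : set 'rV[R]_n) (U : set 'rV[R]_p) m h Phi :
  open D -> open U -> (forall y, D y -> U (Phi y)) ->
  Ck U m h -> (forall j, Ck D m (fun y => Phi y 0 j)) -> Ck D m (h \o Phi).
Proof.
move=> oD oU DU; elim: m h => [|m IH] h Ch CP.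
  split => // y Dy; apply: continuous_comp; last exact: Ck_cont Ch (DU _ Dy).
  by apply: (@cvg_rV _ _ _ (nbhs y)) => j; exact: Ck_cont (CP j) Dy.
have dP y : D y -> forall k, is_derive y ('e_k : 'rV[R]_n) (h \o Phi)
    (\sum_j partial j h (Phi y) * partial k (fun y => Phi y 0 j) y).
  move=> Dy k; have [d1 d2] := Ck_diff oU Ch (DU _ Dy).
  by apply: is_derive_comp => // j; exact: Ck_der (CP j) Dy.
have C0 : Ck D m (h \o Phi).
  by apply: IH; [exact: Ck_pred|move=> j; exact/Ck_pred].
split; first by move=> x; exact: Ck_cont C0.
move=> k; split; first by move=> x Dx; have [] := dP _ Dx k.
apply: (Ck_ext oD (f := fun y => \sum_j partial j h (Phi y) *
   partial k (fun y => Phi y 0 j) y)).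
  by move=> y Dy; rewrite [RHS](@derive_val _ _ _ _ _ _ _ (dP _ Dy k)).
apply: (Ck_sum oD) => j _; apply: (Ck_mul oD).
  apply: (IH (partial j h)); first exact: Ck_partial.
  by move=> i; exact/Ck_pred.
exact: Ck_partial.
Unshelve. all: by end_near. Qed.

End composition.

(** * Division by a coordinate *)

Section unit_integral.
Context {R : realType}.
Implicit Types phi chi : R -> R.

Definition unit_integral phi : R := \int[lebesgue_measure]_(s in `[0, 1]) phi s.

Definition cont01 phi := forall s : R, 0 <= s <= 1 -> {for s, continuous phi}.

Lemma cont01_integrable phi : cont01 phi ->
  (@lebesgue_measure R).-integrable `[0, 1] (EFin \o phi).
Proof.
move=> c; apply: continuous_compact_integrable; first exact: segment_compact.
by apply: continuous_in_subspaceT => s; rewrite inE /= in_itv /=; exact: c.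
Qed.

Lemma unit_integralB phi chi : cont01 phi -> cont01 chi ->
  unit_integral (fun s => phi s - chi s) = unit_integral phi - unit_integral chi.
Proof. by move=> cp cc; apply: RintegralB => //; exact: cont01_integrable. Qed.

Lemma unit_integralZ phi c : cont01 phi ->
  unit_integral (fun s => c * phi s) = c * unit_integral phi.
Proof. by move=> cp; apply: RintegralZl => //; exact: cont01_integrable. Qed.

Lemma unit_integral_le phi (M : R) : cont01 phi -> (forall s, 0 <= s <= 1 -> `|phi s| <= M) ->
  `|unit_integral phi| <= M.
Proof.
move=> cp pM.
apply: le_trans (le_normr_Rintegral _ (cont01_integrable cp)) _ => //.
have cM : cont01 (fun=> M) by move=> s _; exact: cst_continuous.
have cn : cont01 (fun s => `|phi s|).
  by move=> s s01; apply: cvg_norm; exact: cp.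
apply: (@le_trans _ _ (\int[lebesgue_measure]_(s in `[(0:R), 1]) M)).
  by apply: le_Rintegral => //;
    [exact: (cont01_integrable cn)|exact: (cont01_integrable cM)].
rewrite Rintegral_cst //= lebesgue_measure_itv /= lte_fin ltr01 /=.
by rewrite oppr0 addr0 mulr1.
Qed.

Lemma unit_integral_FTC phi (Phi : R -> R) : cont01 phi ->
  (forall s : R, 0 <= s <= 1 -> is_derive s 1 Phi (phi s)) -> unit_integral phi = Phi 1 - Phi 0.
Proof.
move=> cp dP; rewrite /unit_integral /Rintegral (@continuous_FTC2 _ _ Phi) //.
- by apply: continuous_in_subspaceT => s; rewrite inE /= in_itv /=; exact: cp.
- have cP s : 0 <= s <= 1 -> {for s, continuous Phi}.
    by move=> /dP[/derivable1_diffP d _]; exact: differentiable_continuous.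
  split.
  + move=> s; rewrite in_itv /= => /andP[s0 s1].
    by have [|] := dP s; rewrite ?ltW.
  + by apply: cvg_at_right_filter; apply: cP; rewrite lexx ler01.
  + by apply: cvg_at_left_filter; apply: cP; rewrite lexx ler01.
- move=> s; rewrite in_itv /= => /andP[s0 s1].
  have [|_ E] := dP s; first by rewrite !ltW.
  by rewrite derive1E.
Qed.

End unit_integral.

Section hadamard.
Context {R : realType} {n : nat}.
Implicit Types (f g H : 'rV[R]_n -> R) (x y v : 'rV[R]_n) (D : set 'rV[R]_n).
Implicit Types (i j k : 'I_n) (m p : nat) (s t : R).

Definition shrink k s y : 'rV[R]_n := \row_j (if j == k then s * y 0 j else y 0 j).

Lemma shrink1 k y : shrink k 1 y = y.
Proof. by apply/rowP => j; rewrite mxE mul1r if_same. Qed.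

Lemma shrink_line k i s t y :
  shrink k s (t *: 'e_i + y) = (t * s ^+ (i == k)) *: 'e_i + shrink k s y.
Proof.
apply/rowP => j; rewrite !mxE eqxx /=; have [->|jk] := eqVneq j k.
  rewrite [k == i]eq_sym; case: (i == k); rewrite ?mulr1 ?mulr0 ?expr1 ?expr0 ?add0r //.
  by rewrite mulrDr mulrC.
have [ij|ij] := eqVneq j i; last by rewrite !mulr0.
by rewrite -ij (negbTE jk) expr0 !mulr1.
Qed.

(** The segment [0, 1] is compact, so continuity in the parameter x0 is
    uniform in s. This is all that continuity and differentiation under the
    integral sign need below. *)
Lemma uniform_near (X : topologicalType) (Psi : R -> X -> 'rV[R]_n) (x0 : X) D f :
  open D -> (forall x, D x -> {for x, continuous f}) ->
  (forall s, 0 <= s <= 1 -> D (Psi s x0) /\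
     Psi z.1 z.2 @[z --> (s, x0)] --> Psi s x0) ->
  forall e, 0 < e -> \forall x \near x0, forall s, 0 <= s <= 1 ->
     D (Psi s x) /\ `|f (Psi s x) - f (Psi s x0)| <= e.
Proof.
move=> oD cf cP e e0.
pose P (x : X) (s : R) := D (Psi s x) /\ `|f (Psi s x) - f (Psi s x0)| <= e.
have /compact_near_coveringP := @segment_compact R 0 1.
move=> /(_ X (nbhs x0) P _) nc.
suff : \forall x \near x0, `[0, 1] `<=` P x.
  by apply: filterS => x H s s01; apply: H; rewrite /= in_itv.
apply: nc => s; rewrite /= in_itv /= => /cP[Ds Ps].
have cfs : f (Psi z.1 z.2) @[z --> (s, x0)] --> f (Psi s x0).
  exact: (cvg_comp _ _ Ps (cf _ Ds)).
have ndD : \forall z \near (s, x0), D (Psi z.1 z.2).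
  by apply: Ps; apply: open_nbhs_nbhs.
have nf : \forall z \near (s, x0), `|f (Psi s x0) - f (Psi z.1 z.2)| < e / 2.
  by have /cvgrPdist_lt := cfs; apply; rewrite divr_gt0.
have [[/= A B] [nA nB] AB] := filterI ndD nf.
exists (A, B) => //= -[s' x] /= [As Bx].
have [/= D1 f1] := AB (s', x) (conj As Bx).
have [/= D2 f2] := AB (s', x0) (conj As (nbhs_singleton nB)).
split => //.
have -> : f (Psi s' x) - f (Psi s' x0) =
  (f (Psi s x0) - f (Psi s' x0)) - (f (Psi s x0) - f (Psi s' x)) by ring.
by apply: le_trans (ler_normB _ _) _; rewrite [leRHS]splitr; apply: lerD; apply: ltW.
Qed.

(** Domains on which the k-th coordinate can be contracted to 0, as
    needed to integrate along that coordinate from 0. *)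
Definition balanced D k :=
  forall y s, D y -> 0 <= s <= 1 -> D (shrink k s y).

(** The weights s^p make this family stable under differentiation: a
    derivative in direction k raises p by one, any other leaves p unchanged
    ([shrink_mean_derive]). *)
Definition shrink_mean p k H y : R := unit_integral (fun s => s ^+ p * H (shrink k s y)).

Section fixed_domain.
Context (D : set 'rV[R]_n) (k : 'I_n) (oD : open D) (bD : balanced D k).

Lemma shrink_cvg s y : shrink k z.1 z.2 @[z --> (s, y)] --> shrink k s y.
Proof.
apply: (@cvg_rV _ _ _ (nbhs (s, y))) => j; rewrite mxE.
under eq_cvg do rewrite mxE.
have cj : (z : R * 'rV[R]_n).2 0 j @[z --> (s, y)] --> y 0 j.
  have H2 : (z : R * 'rV[R]_n).2 @[z --> (s, y)] --> y by exact: cvg_snd.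
  exact: (cvg_comp _ _ H2 (@coord_continuous R 1 n 0 j y)).
case: (j == k) => //; apply: cvgM => //; exact: cvg_fst.
Qed.

Lemma cont01_shrink p H y : (forall x, D x -> {for x, continuous H}) -> D y ->
  cont01 (fun s => s ^+ p * H (shrink k s y)).
Proof.
move=> cH Dy s s01; apply: continuousM; first exact: exprn_continuous.
have Hs : shrink k z y @[z --> s] --> shrink k s y.
  have Hp : (z, y) @[z --> s] --> (s, y) by apply:
    (@cvg_pair _ _ _ (nbhs s) (nbhs s) (nbhs y) _ _ _ id (fun=> y)) => //; exact: cvg_cst.
  exact: (cvg_comp _ _ Hp (@shrink_cvg s y)).
exact: (cvg_comp _ _ Hs (cH _ (bD Dy s01))).
Qed.

Lemma norm_expr_le1 s p : 0 <= s <= 1 -> `|s ^+ p| <= 1.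
Proof.
by move=> /andP[s0 s1]; rewrite ger0_norm ?exprn_ge0 // exprn_ile1.
Qed.

Lemma shrink_mean_continuous p H : (forall x, D x -> {for x, continuous H}) ->
  forall y, D y -> {for y, continuous (shrink_mean p k H)}.
Proof.
move=> cH y Dy; apply/(@cvgrPdist_le _ _ _ (nbhs y)) => e e0.
have := @uniform_near _ (shrink k) y D H oD cH _ e e0.
move=> /(_ (fun s s01 => conj (bD Dy s01) (@shrink_cvg s y))).
apply: filter_app; near=> z => HP.
have Dz : D z by near: z; exact: open_nbhs_nbhs.
rewrite /shrink_mean -unit_integralB; try exact: cont01_shrink.
apply: unit_integral_le.
  by move=> s s01; apply: continuousB; exact: cont01_shrink.
move=> s s01; rewrite -mulrBr normrM distrC -[e]mul1r.
by apply: ler_pM => //; [exact: norm_expr_le1|have [] := HP _ s01].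
Unshelve. all: by end_near. Qed.

(** Moving y by t e_i moves [shrink k s y] by t s e_k if i = k and by
    t e_i otherwise; the mean value theorem and [uniform_near] then allow the
    derivative to pass under the integral. *)
Lemma shrink_mean_derive p H i : Ck D 1 H -> forall y, D y ->
  is_derive y 'e_i (shrink_mean p k H) (shrink_mean (p + (i == k)) k (partial i H) y).
Proof.
move=> CH y Dy.
have cH x : D x -> {for x, continuous H} by exact: Ck_cont CH.
have cdH x : D x -> {for x, continuous (partial i H)}.
  by apply: Ck_cont; exact: Ck_partial CH.
suff L : (fun h : R => h^-1 *: (shrink_mean p k H (h *: 'e_i + y) - shrink_mean p k H y)) @ 0^' -->
    shrink_mean (p + (i == k)) k (partial i H) y.
  by apply: DeriveDef; [apply/cvg_ex; eexists; exact: L | exact: cvg_lim L].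
apply/cvgrPdist_le => e e0.
(* displacing the shrunk point by t e_i, uniformly in s *)
pose Psi (s t : R) := t *: 'e_i + shrink k s y.
have cPsi s : 0 <= s <= 1 -> D (Psi s 0) /\
    Psi z.1 z.2 @[z --> (s, 0)] --> Psi s 0.
  move=> s01; rewrite /Psi; split; first by rewrite scale0r add0r; exact: bD.
  apply: (@cvgD _ _ _ (nbhs (s, 0 : R))); first by apply: cvgZr_tmp; exact: cvg_snd.
  have Hp : ((z : R * R).1, y) @[z --> (s, 0 : R)] --> (s, y).
    by apply: (@cvg_pair _ _ _ (nbhs (s, 0 : R)) (nbhs s) (nbhs y) _ _ _ fst (fun=> y));
      [exact: cvg_fst|exact: cvg_cst].
  exact: (cvg_comp _ _ Hp (@shrink_cvg s y)).
have := @uniform_near _ Psi 0 D (partial i H) oD cdH cPsi e e0.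
move=> /nbhs_ballP[d /= d0 dP].
have dP' (t : R) : `|t| < d -> forall s, 0 <= s <= 1 ->
    D (Psi s t) /\ `|partial i H (Psi s t) - partial i H (shrink k s y)| <= e.
  move=> td s s01; have := dP t; rewrite /ball /= sub0r normrN => /(_ td s s01).
  by rewrite /Psi scale0r add0r.
near=> h.
have h0 : h != 0 by near: h; exact: nbhs_dnbhs_neq.
have hd : `|h| < d by near: h; exact: dnbhs0_lt.
have Dh : D (h *: 'e_i + y).
  have := dP' h hd 1; rewrite ler01 lexx /Psi shrink1 => /(_ isT)[]//.
rewrite /shrink_mean -unit_integralB; try exact: cont01_shrink.
rewrite -[h^-1 *: _]unit_integralZ; last first.
  by move=> s s01; apply: continuousB; exact: cont01_shrink.
rewrite -unit_integralB; last 2 first.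
- by apply: cont01_shrink.
- move=> s s01; apply: continuousM; first exact: cst_continuous.
  by apply: continuousB; exact: cont01_shrink.
apply: unit_integral_le.
  move=> s s01; apply: continuousB; first exact: cont01_shrink.
  apply: continuousM; first exact: cst_continuous.
  by apply: continuousB; exact: cont01_shrink.
move=> s s01; have := s01 => /andP[s0 s1].
have hs : `|h * s ^+ (i == k)| <= `|h|.
  by rewrite normrM ler_piMr // norm_expr_le1.
rewrite shrink_line.
have [|t th] := @MVT_line R _ H (shrink k s y) 'e_i (h * s ^+ (i == k)).
  move=> t th; apply: Ck_der CH _.
  by have [] := dP' t (le_lt_trans (le_trans th hs) hd) s s01.
move=> E.
have -> : s ^+ p * H ((h * s ^+ (i == k)) *: 'e_i + shrink k s y) - s ^+ p * H (shrink k s y)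
  = s ^+ p * (H ((h * s ^+ (i == k)) *: 'e_i + shrink k s y) - H (shrink k s y)) by ring.
rewrite E exprD.
have -> : s ^+ p * s ^+ (i == k) * partial i H (shrink k s y) -
   h^-1 * (s ^+ p * ('D_('e_i) H (t *: 'e_i + shrink k s y) * (h * s ^+ (i == k)))) =
   (s ^+ p * s ^+ (i == k)) *
     (partial i H (shrink k s y) - partial i H (t *: 'e_i + shrink k s y)).
  by rewrite /partial; field.
rewrite normrM distrC -[e]mul1r; apply: ler_pM => //.
  by rewrite -exprD; exact: norm_expr_le1.
by have [] := dP' t (le_lt_trans (le_trans th hs) hd) s s01.
Unshelve. all: by end_near. Qed.

Lemma shrink_mean_Ck m p H : Ck D m H -> Ck D m (shrink_mean p k H).
Proof.
elim: m p H => [|m IH] p H CH.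
  by split => // y; apply: shrink_mean_continuous => x; exact: Ck_cont CH.
split; first by apply: shrink_mean_continuous => x; exact: Ck_cont CH.
have C1 : Ck D 1 H by apply: Ck_leq CH.
move=> i; split; first by move=> y Dy; have [] := shrink_mean_derive p i C1 Dy.
apply: (Ck_ext oD (f := shrink_mean (p + (i == k)) k (partial i H))).
  by move=> y Dy; have [_ <-] := shrink_mean_derive p i C1 Dy.
by apply: IH; exact: Ck_partial.
Qed.

(** Hadamard's lemma: H(y) is the integral over s in [0, 1] of the derivative
    of H(y_1, .., s y_k, .., y_n), which is y_k times a derivative of H. *)
Lemma hadamard m H : Ck D m.+1 H -> (forall y, D y -> H (shrink k 0 y) = 0) ->
  Ck D m (shrink_mean 0 k (partial k H)) /\
  forall y, D y -> H y = y 0 k * shrink_mean 0 k (partial k H) y.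
Proof.
move=> CH H0; split; first by apply: shrink_mean_Ck; exact: Ck_partial.
move=> y Dy; have cdH x : D x -> {for x, continuous (partial k H)}.
  by apply: Ck_cont; exact: Ck_partial CH.
rewrite -unit_integralZ; last exact: cont01_shrink.
suff E s : 0 <= s <= 1 -> is_derive s 1 (fun t => H (shrink k t y))
    (y 0 k * (s ^+ 0 * partial k H (shrink k s y))).
  have C : cont01 (fun s => y 0 k * (s ^+ 0 * partial k H (shrink k s y))).
    by move=> s s01; apply: continuousM; [exact: cst_continuous|exact: cont01_shrink].
  by rewrite (unit_integral_FTC C E) shrink1 H0 // subr0.
move=> s01; rewrite expr0 mul1r.
have shE (t : R) : shrink k t y = (t * y 0 k) *: 'e_k + shrink k 0 y.
  apply/rowP => j; rewrite !mxE eqxx /=; have [->|jk] := eqVneq j k.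
    by rewrite mulr1 mul0r addr0.
  by rewrite mulr0 add0r.
have -> : (fun t => H (shrink k t y)) = (fun t => H (t *: (y 0 k *: 'e_k) + shrink k 0 y)).
  by apply/funext => t; rewrite shE scalerA.
have [dH dHE] := Ck_diff oD CH (bD Dy s01).
have E1 : s *: (y 0 k *: 'e_k) + shrink k 0 y = shrink k s y by rewrite [RHS]shE scalerA.
have dd : derivable H (s *: (y 0 k *: 'e_k) + shrink k 0 y) (y 0 k *: 'e_k).
  by rewrite E1; exact: diff_derivable.
have DE : 'D_(y 0 k *: 'e_k) H (shrink k s y) = y 0 k * partial k H (shrink k s y).
  by rewrite /partial (deriveE _ dH) (deriveE _ dH) linearZ.
by rewrite -DE -E1; exact: is_derive_line dd.
Qed.

End fixed_domain.
End hadamard.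

(** * Division by a monomial *)

Section monomial_division.
Context {R : realType} {n : nat}.
Implicit Types (f g H : 'rV[R]_n -> R) (x y v : 'rV[R]_n) (D : set 'rV[R]_n).
Implicit Types (i j k : 'I_n) (m p : nat) (s t : R).

Lemma near_shift_neq0 y :
  \forall t \near (0 : R)^'+, forall j, (t *: const_mx 1 + y) 0 j != 0.
Proof.
apply: filter_forall => j.
have [y0|y0] := eqVneq (y 0 j) 0.
  near=> t; rewrite !mxE y0 addr0 mulr1.
  by rewrite gt_eqF //; near: t; exact: nbhs_right_gt.
near=> t; rewrite !mxE mulr1; apply/eqP => E.
have : t < `|y 0 j| by near: t; apply: nbhs_right_lt; rewrite normr_gt0.
have : 0 < t by near: t; exact: nbhs_right_gt.
by move=> t0; rewrite -(addr0_eq E) normrN gtr0_norm // ltxx.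
Unshelve. all: by end_near. Qed.

Lemma cvg_shift_right y (v : 'rV[R]_n) : t *: v + y @[t --> (0 : R)^'+] --> y.
Proof.
have E : 0 *: v + y = y by rewrite scale0r add0r.
rewrite -[X in _ --> X]E.
apply: cvgD; last exact: cvg_cst.
apply: cvgZr_tmp; apply: cvg_at_right_filter => A nA; exact: nA.
Qed.

(** The points t (1, .., 1) + y avoid the coordinate hyperplanes for small
    t > 0 and tend to y. *)
Lemma vanish_dense D H : open D -> (forall y, D y -> {for y, continuous H}) ->
  (forall y, D y -> (forall i, y 0 i != 0) -> H y = 0) ->
  forall y, D y -> H y = 0.
Proof.
move=> oD cH H0 y Dy.
pose z (t : R) := t *: const_mx 1 + y.
have cz : z t @[t --> 0^'+] --> y by exact: cvg_shift_right.
have cHz : H (z t) @[t --> 0^'+] --> H y by exact: (cvg_comp _ _ cz (cH _ Dy)).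
have c0 : H (z t) @[t --> 0^'+] --> (0 : R).
  apply: cvg_near_cst; near=> t; apply: H0; last first.
    by near: t; exact: near_shift_neq0.
  by near: t; apply: cz; exact: open_nbhs_nbhs.
exact: (cvg_unique _ cHz c0).
Unshelve. all: by end_near. Qed.

Context (D : set 'rV[R]_n) (oD : open D) (bD : forall k, balanced D k).

(** The constant may depend on y: this pointwise decay is all that the
    KN-condition provides. Uniformity is recovered by division. *)
Definition order_along H k y p := exists C : R,
  \forall t \near (0 : R)^'+, `|H (shrink k t y)| <= C * t ^+ p.

Lemma shrink_cvgl k s y : shrink k t y @[t --> s] --> shrink k s y.
Proof.
have Hp : (t, y) @[t --> s] --> (s, y).
  by apply: (@cvg_pair _ _ _ (nbhs s) (nbhs s) (nbhs y) _ _ _ id (fun=> y)) => //;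
    exact: cvg_cst.
exact: (cvg_comp _ _ Hp (@shrink_cvg _ _ k s y)).
Qed.

Lemma order_along_vanish H k p : (forall y, D y -> {for y, continuous H}) ->
  (forall y, D y -> (forall i, y 0 i != 0) -> order_along H k y p.+1) ->
  forall y, D y -> H (shrink k 0 y) = 0.
Proof.
move=> cH Hs; apply: (@vanish_dense D (fun y => H (shrink k 0 y)) oD).
  move=> y Dy; have D0 : D (shrink k 0 y) by apply: bD => //; rewrite lexx ler01.
  have c1 : shrink k 0 z @[z --> y] --> shrink k 0 y.
    apply: (@cvg_rV _ _ _ (nbhs y)) => j; rewrite mxE; under eq_cvg do rewrite mxE.
    case: (j == k); last exact: coord_continuous.
    by apply: cvgMl_tmp; exact: coord_continuous.
  exact: (cvg_comp _ _ c1 (cH _ D0)).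
move=> y Dy yn0; have [C HC] := Hs y Dy yn0.
have D0 : D (shrink k 0 y) by apply: bD => //; rewrite lexx ler01.
have c1 : H (shrink k t y) @[t --> 0^'+] --> H (shrink k 0 y).
  apply: cvg_at_right_filter; exact: (cvg_comp _ _ (@shrink_cvgl k 0 y) (cH _ D0)).
have c2 : C * t ^+ p.+1 @[t --> (0 : R)^'+] --> (0 : R).
  have E0 : C * 0 ^+ p.+1 = 0 :> R by rewrite expr0n mulr0.
  rewrite -[X in _ --> X]E0.
  by apply: cvg_at_right_filter; apply: cvgMl_tmp; exact: exprn_continuous.
have c3 : `|H (shrink k t y)| @[t --> 0^'+] --> (0 : R).
  apply: squeeze_cvgr (cvg_cst 0) c2.
  by apply: filterS HC => t -> /=; rewrite normr_ge0.
by apply: normr0_eq0; exact: (cvg_unique _ (cvg_norm c1) c3).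
Qed.

(** Positive order along the k-th coordinate makes H vanish on the
    hyperplane y_k = 0, so Hadamard's lemma divides H by y_k. Off the coordinate
    hyperplanes the quotient is H / y_k, whose orders are those of H with the
    k-th one lowered by one; hence induction on their sum. *)
Lemma monomial_division (l : 'I_n -> nat) m H : Ck D (\sum_k l k + m) H ->
  (forall y, D y -> (forall i, y 0 i != 0) -> forall k, order_along H k y (l k)) ->
  exists Q, Ck D m Q /\ forall y, D y -> H y = (\prod_k y 0 k ^+ l k) * Q y.
Proof.
move E : (\sum_k l k)%N => N; elim: N l H E => [|N IH] l H E CH Hs.
  exists H; split => // y Dy; rewrite big1 ?mul1r // => k _.
  by have /eqP := E; rewrite sum_nat_eq0 => /forallP/(_ k)/eqP ->.
have [k lk] : exists k, (0 < l k)%N.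
  apply/existsP; apply: contra_eqT E; rewrite negb_exists => /forallP H0.
  by rewrite big1 // => k _; apply/eqP; have := H0 k; rewrite -eqn0Ngt.
have cH y : D y -> {for y, continuous H} by exact: Ck_cont CH.
have van : forall y, D y -> H (shrink k 0 y) = 0.
  apply: (@order_along_vanish _ k (l k).-1) => // y Dy y0.
  by rewrite prednK //; exact: Hs.
have [CH1 HE] := hadamard oD (bD k) CH van.
set H1 := shrink_mean 0 k (partial k H) in CH1 HE.
pose l' i := (l i - (i == k))%N.
have ll' i : l i = (l' i + (i == k))%N.
  by rewrite /l'; have [->|_] := eqVneq i k; rewrite ?subnK // subn0 addn0.
have [||Q [CQ QE]] := IH l' H1 _ CH1.
- have : (\sum_i l i = \sum_i l' i + 1)%N.
    rewrite (eq_bigr (fun i => l' i + (i == k))%N); last by move=> i _; exact: ll'.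
    rewrite big_split /=; congr (_ + _)%N.
    by rewrite (bigD1 k) //= eqxx big1 // => i /negbTE ->.
  by rewrite E addn1 => -[].
- move=> y Dy y0 i; have [C HC] := Hs y Dy y0 i.
  exists (C / `|y 0 k|); near=> t.
  have t0 : 0 < t by near: t; exact: nbhs_right_gt.
  have t1 : t <= 1 by near: t; exact: nbhs_right_le.
  have Ht : `|H (shrink i t y)| <= C * t ^+ l i by near: t.
  have Ds : D (shrink i t y) by apply: bD => //; rewrite t1 ltW.
  have yk : 0 < `|y 0 k| by rewrite normr_gt0.
  move: Ht; rewrite (HE _ Ds) normrM ll' mxE eq_sym.
  have [ik|ik] := eqVneq i k.
    rewrite normrM (gtr0_norm t0) exprD expr1 => Ht.
    rewrite -(ler_pM2l (mulr_gt0 t0 yk)); apply: le_trans Ht _.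
    rewrite le_eqVlt; apply/orP; left; apply/eqP.
    by field; rewrite gt_eqF.
  rewrite addn0 => Ht; rewrite -(ler_pM2l yk); apply: le_trans Ht _.
  rewrite le_eqVlt; apply/orP; left; apply/eqP.
  by field; rewrite gt_eqF.
exists Q; split => // y Dy; rewrite (HE _ Dy) (QE _ Dy) mulrA; congr (_ * _).
rewrite [RHS](eq_bigr (fun i => y 0 i ^+ l' i * y 0 i ^+ (i == k))); last first.
  by move=> i _; rewrite -exprD -ll'.
rewrite big_split /= mulrC; congr (_ * _).
rewrite (bigD1 k) //= eqxx expr1 big1 ?mulr1 // => i /negbTE ->.
by rewrite expr0.
Unshelve. all: by end_near. Qed.

End monomial_division.

(** * Monomial charts *)

Section monomial_chart.
Context {R : realType} {n : nat}.
Implicit Types (f g h : 'rV[R]_n -> R) (x y v : 'rV[R]_n) (D U : set 'rV[R]_n).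
Implicit Types (i j k : 'I_n) (m p : nat) (s t : R) (l : 'I_n -> nat).

Definition monom l y : R := \prod_k y 0 k ^+ l k.

Lemma Ck_monom D m l : open D -> Ck D m (monom l).
Proof.
move=> oD; apply: (Ck_prod oD) => k _; apply: (Ck_exp oD).
exact: Ck_coord.
Qed.

Lemma partial_coord k j y : partial k (fun z => z 0 j) y = (j == k)%:R.
Proof. exact: (@derive_val _ _ _ _ _ _ _ (is_derive_coord k j y)). Qed.

(** Stated with the factor y_k, Euler's relation needs no division and
    holds also on the hyperplane y_k = 0. *)
Lemma monom_euler l k y : y 0 k * partial k (monom l) y = (l k)%:R * monom l y.
Proof.
have oT : open [set: 'rV[R]_n] by exact: openT.
have CX j p : Ck setT 1 (fun z : 'rV[R]_n => z 0 j ^+ p).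
  by apply: (Ck_exp oT); exact: Ck_coord.
have EX j p : y 0 k * partial k (fun z => z 0 j ^+ p) y =
    ((j == k) * p)%:R * y 0 j ^+ p.
  elim: p => [|p IH].
    rewrite muln0 mul0r (partial_ext oT k (g := fun=> 1)) //; last first.
    by rewrite /partial derive_cst mulr0.
  rewrite (partial_ext oT k (g := fun z => z 0 j * z 0 j ^+ p)) //; last first.
    by move=> z _; rewrite exprS.
  rewrite partialM; last 2 first.
  - by have [] := is_derive_coord k j y.
  - exact: Ck_der (CX j p) _.
  rewrite mulrDr mulrCA IH partial_coord exprS.
  have [->|_] := eqVneq j k; last by rewrite !mul0n !mul0r !mulr0 addr0.
  have -> : (true * p.+1)%:R = p%:R + 1 :> R by rewrite mul1n natr1.
  by rewrite mul1n mulr1n; ring.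
have claim (r : seq 'I_n) :
    y 0 k * partial k (fun z => \prod_(j <- r) z 0 j ^+ l j) y =
    (\sum_(j <- r) ((j == k) * l j))%:R * \prod_(j <- r) y 0 j ^+ l j.
  elim: r => [|j r IH].
    rewrite !big_nil mul0r (partial_ext oT k (g := fun=> 1)) //; last first.
      by move=> z _; rewrite big_nil.
    by rewrite /partial derive_cst mulr0.
  rewrite (partial_ext oT k
     (g := fun z => z 0 j ^+ l j * \prod_(j <- r) z 0 j ^+ l j)) //; last first.
    by move=> z _; rewrite big_cons.
  rewrite partialM; last 2 first.
  - exact: Ck_der (CX j (l j)) _.
  - have C : Ck setT 1 (fun z : 'rV[R]_n => \prod_(j <- r) z 0 j ^+ l j).
      by apply: (@Ck_prod _ _ _ oT 1 _ r xpredT (fun j z => z 0 j ^+ l j)) => i _.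
    exact: Ck_der C _.
  by rewrite mulrDr mulrCA IH [X in _ + X]mulrCA EX !big_cons natrD; ring.
rewrite [LHS]claim; congr (_%:R * _).
rewrite (bigD1 k) //= eqxx mul1n big1 ?addn0 // => j /negbTE ->.
by rewrite mul0n.
Qed.

Context (A : 'M[nat]_n) (sg : 'I_n -> R) (sg1 : forall j, `|sg j| = 1).

(** The toric chart of the cone generated by the rows of A, composed with
    changes of sign of the coordinates so that positive y suffice to reach every
    orthant. *)
Definition chart y : 'rV[R]_n := \row_j (sg j * monom (A^~ j) y).

Lemma Ck_chart D m j : open D -> Ck D m (fun y => chart y 0 j).
Proof.
move=> oD; apply: (Ck_ext oD (f := fun y => sg j * monom (A^~ j) y)).
  by move=> y _; rewrite mxE.
by apply: (Ck_mul oD); [exact: Ck_cst|exact: Ck_monom].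
Qed.

Lemma chart_euler k j y :
  y 0 k * partial k (fun z => chart z 0 j) y = (A k j)%:R * chart y 0 j.
Proof.
have oT : open [set: 'rV[R]_n] by exact: openT.
rewrite (partial_ext oT k (g := fun z => sg j * monom (A^~ j) z)) //; last first.
  by move=> z _; rewrite mxE.
rewrite partialM; last 2 first.
- exact: Ck_der (Ck_cst oT 1 (sg j)) _.
- exact: Ck_der (Ck_monom 1 (A^~ j) oT) _.
rewrite {2}/partial derive_cst mulr0 addr0 mulrCA monom_euler mxE.
by rewrite mulrCA.
Qed.

(** The chart turns the Euler fields y_k d/dy_k into combinations of the
    fields x_j d/dx_j with the constant coefficients A k j. *)
Lemma euler_chain U h k y : open U -> Ck U 1 h -> U (chart y) ->
  y 0 k * partial k (h \o chart) y =
  \sum_j (A k j)%:R * (chart y 0 j * partial j h (chart y)).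
Proof.
move=> oU Ch Uy; have [d1 d2] := Ck_diff oU Ch Uy.
have dc j : derivable (fun z => chart z 0 j) y 'e_k.
  exact: Ck_der (Ck_chart 1 j openT) _.
rewrite [X in _ * X](@derive_val _ _ _ _ _ _ _ (is_derive_comp d1 d2 dc)).
rewrite mulr_sumr; apply: eq_bigr => j _.
rewrite mulrCA.
have := chart_euler k j y; rewrite /partial => ->.
by rewrite mulrCA; congr (_ * _); rewrite mulrC.
Qed.

Lemma chart_shrink k t y j : chart (shrink k t y) 0 j = t ^+ A k j * chart y 0 j.
Proof.
rewrite !mxE mulrCA; congr (_ * _).
rewrite /monom (bigD1 k) //= [in RHS](bigD1 k) //= !mxE eqxx exprMn -mulrA.
congr (_ * (_ * _)); apply: eq_bigr => i ik; by rewrite mxE (negbTE ik).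
Qed.

Definition box (e : R) : set 'rV[R]_n := [set x | forall j, `|x 0 j| < e].

Lemma box_open e : open (box e).
Proof.
rewrite openE => x xe.
have c j : \forall y \near (x : 'rV[R]_n), `|(y : 'rV[R]_n) 0 j| < e.
  have cj : `|(y : 'rV[R]_n) 0 j| @[y --> x] --> `|x 0 j|.
    exact: (cvg_norm (@coord_continuous R 1 n 0 j x)).
  by have := cvgr_lt _ cj; apply.
exact: (filter_forall _ c).
Qed.

End monomial_chart.

(** * The strict transform and its Euler coefficients *)

Section strict_transform.
Context {R : realType} {n : nat}.
Implicit Types (f g h : 'rV[R]_n -> R) (x y v : 'rV[R]_n).
Implicit Types (i j k : 'I_n) (m p : nat) (s t : R).
Context (A : 'M[nat]_n) (sg : 'I_n -> R) (sg1 : forall j, `|sg j| = 1).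
Context (e0 : R) (e0_gt0 : 0 < e0).

Local Notation chart := (chart A sg).
(** The domain is stable under shrinking each coordinate because doing so
    only decreases the coordinates of the image. *)
Definition chart_dom : set 'rV[R]_n := chart @^-1` box e0.

Lemma chart_continuous y : {for y, continuous chart}.
Proof.
apply: (@cvg_rV _ _ _ (nbhs y)) => j.
exact: (Ck_cont (Ck_chart A sg 0 j openT)).
Qed.

Lemma chart_dom_open : open chart_dom.
Proof.
by apply: open_comp; [move=> y _; exact: chart_continuous|exact: box_open].
Qed.

Lemma chart_dom_balanced k : balanced chart_dom k.
Proof.
move=> y s Dy /andP[s0 s1] j; rewrite chart_shrink normrM.
apply: le_lt_trans (Dy j); rewrite ler_piMl // ger0_norm ?exprn_ge0 //.
by rewrite exprn_ile1.
Qed.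

Lemma monom_neq0 l y : (forall i, y 0 i != 0) -> monom l y != 0.
Proof. by move=> y0; apply/prodf_neq0 => k _; rewrite expf_neq0. Qed.

Lemma chart_neq0 y : (forall i, y 0 i != 0) -> forall j, chart y 0 j != 0.
Proof.
move=> y0 j; rewrite mxE mulf_neq0 ?monom_neq0 //.
by rewrite -normr_gt0 sg1.
Qed.

Lemma Ck_chart_comp U h m : open U -> box e0 `<=` U -> Ck U m h -> Ck chart_dom m (h \o chart).
Proof.
move=> oU bU Ch; apply: Ck_comp Ch _ => //; first exact: chart_dom_open.
- by move=> y; exact: bU.
- by move=> j; apply: Ck_chart; exact: chart_dom_open.
Qed.

Lemma chart_division U h m l : open U -> box e0 `<=` U ->
  (forall m, Ck U m h) ->
  (forall y, chart_dom y -> (forall i, y 0 i != 0) ->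
     forall k, order_along (h \o chart) k y (l k)) ->
  exists Q, Ck chart_dom m Q /\ forall y, chart_dom y -> h (chart y) = monom l y * Q y.
Proof.
move=> oU bU Ch Hs.
exact: (monomial_division chart_dom_open chart_dom_balanced (Ck_chart_comp oU bU (Ch _)) Hs).
Qed.

Context (f : 'rV[R]_n -> R) (U : set 'rV[R]_n) (oU : open U).
Context (bU : box e0 `<=` U) (Cf : forall m, Ck U m f).
Context (l : 'I_n -> nat) (fs : 'rV[R]_n -> R) (Cfs : Ck chart_dom 1 fs).
Hypothesis fE : forall y, chart_dom y -> f (chart y) = monom l y * fs y.
Hypothesis Aunit : (embed A : 'M[R]_n) \in unitmx.

(** With f o chart = y^l fs, this is y_k d(f o chart)/dy_k divided by
    y^l; unlike that quotient, it is defined and continuous on y_k = 0. *)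
Definition chart_euler_coef k y : R := (l k)%:R * fs y + y 0 k * partial k fs y.
(** x_j df/dx_j divided by y^l, obtained from the chart coefficients by
    inverting A. *)
Definition euler_coef j y : R := \sum_k invmx (embed A) j k * chart_euler_coef k y.

Lemma chart_euler_coefE k y : chart_dom y ->
  \sum_j (A k j)%:R * (chart y 0 j * partial j f (chart y)) = monom l y * chart_euler_coef k y.
Proof.
move=> Dy; rewrite -(euler_chain k oU (Cf 1)); last exact: bU.
rewrite (partial_ext chart_dom_open k (g := fun y => monom l y * fs y)) //.
rewrite partialM; last 2 first.
- exact: Ck_der (Ck_monom 1 l openT) _.
- exact: Ck_der Cfs _.
have := monom_euler l k y => E.
by rewrite /chart_euler_coef mulrDr [X in _ + X]mulrCA E; ring.
Qed.

Lemma invmx_solve (b c : 'I_n -> R) :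
  (forall k, \sum_j (A k j)%:R * b j = c k) ->
  forall j, b j = \sum_k invmx (embed A) j k * c k.
Proof.
move=> H j; pose bc : 'cV[R]_n := \col_j b j; pose cc : 'cV[R]_n := \col_j c j.
have E : embed A *m bc = cc.
  apply/matrixP => k z; rewrite !mxE -H; apply: eq_bigr => i _.
  by rewrite !mxE.
have : bc = invmx (embed A) *m cc by rewrite -E mulKmx.
move=> /matrixP /(_ j 0); rewrite !mxE => ->.
by apply: eq_bigr => k _; rewrite mxE.
Qed.

Lemma euler_coefE j y : chart_dom y ->
  chart y 0 j * partial j f (chart y) = monom l y * euler_coef j y.
Proof.
move=> Dy; rewrite (invmx_solve (fun k => chart_euler_coefE k Dy) j) /euler_coef mulr_sumr.
by apply: eq_bigr => k _; rewrite mulrCA.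
Qed.

Lemma chart_euler_coef_continuous k y : chart_dom y -> {for y, continuous (chart_euler_coef k)}.
Proof.
move=> Dy; apply: continuousD.
  apply: continuousM; first exact: cst_continuous.
  exact: Ck_cont Cfs Dy.
apply: continuousM; first exact: coord_continuous.
exact: Ck_cont (Ck_partial k Cfs) Dy.
Qed.

Lemma euler_coef_continuous j y : chart_dom y -> {for y, continuous (euler_coef j)}.
Proof.
move=> Dy; apply: (@cvg_sumr _ _ (nbhs y)) => k _.
by apply: cvgMl_tmp; exact: chart_euler_coef_continuous.
Qed.

Definition zero_on (I : {set 'I_n}) y : 'rV[R]_n :=
  \row_k (if k \in I then 0 else y 0 k).

Section face.
Context (I : {set 'I_n}) (fg : 'rV[R]_n -> R).
Hypothesis I_cover : forall j, exists2 k, k \in I & (0 < A k j)%N.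
Hypothesis Cfg : forall m, Ck setT m fg.
Hypothesis fg_lim : forall x,
  f (\row_j (t ^+ (\sum_(k in I) A k j) * x 0 j)) / t ^+ (\sum_(k in I) l k)
     @[t --> (0 : R)^'+] --> fg x.

Lemma chart_dom_zero_on y : chart_dom (zero_on I y).
Proof.
move=> j; have [k kI Ak] := I_cover j.
rewrite mxE /monom (bigD1 k) //= mxE kI expr0n -leqn0 leqNgt Ak mul0r mulr0.
by rewrite normr0.
Qed.

(** Let the coordinates in I tend to 0 together, as t y_k. On one hand
    f o chart divided by the power of t tends to y^l fs at the limit point; on
    the other hand the image moves along t^b x, where b is the sum of the
    generators indexed by I, and the limit is the face polynomial. *)
Lemma face_transform y : fg (chart y) = monom l y * fs (zero_on I y).
Proof.
pose z (t : R) : 'rV[R]_n := \row_k (if k \in I then t * y 0 k else y 0 k).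
have monz l' t : monom l' (z t) = t ^+ (\sum_(k in I) l' k) * monom l' y.
  rewrite /monom -prodrXr (big_mkcond (mem I)) -big_split /=.
  apply: eq_bigr => k _; rewrite mxE; case: ifP => _; last by rewrite mul1r.
  by rewrite exprMn.
have chz t : chart (z t) = \row_j (t ^+ (\sum_(k in I) A k j) * chart y 0 j).
  by apply/rowP => j; rewrite !mxE monz mulrCA.
have cz : z t @[t --> (0 : R)^'+] --> zero_on I y.
  apply: (@cvg_rV _ _ _ _ _ _) => k; rewrite mxE; under eq_cvg do rewrite mxE.
  case: ifP => _; last exact: cvg_cst.
  have c : t * y 0 k @[t --> (0 : R)^'+] --> 0 * y 0 k.
    by apply: cvgMr_tmp; apply: cvg_at_right_filter => B nB.
  by move: c; rewrite mul0r.
have cfz : monom l y * fs (z t) @[t --> (0 : R)^'+] --> monom l y * fs (zero_on I y).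
  by apply: cvgMl_tmp; exact: (cvg_comp _ _ cz (Ck_cont Cfs (chart_dom_zero_on y))).
have nD : \forall t \near (0 : R)^'+, chart_dom (z t).
  by have := cz chart_dom (open_nbhs_nbhs (conj chart_dom_open (@chart_dom_zero_on y))).
have cf2 : f (\row_j (t ^+ (\sum_(k in I) A k j) * chart y 0 j)) /
   t ^+ (\sum_(k in I) l k) @[t --> (0 : R)^'+] --> monom l y * fs (zero_on I y); last first.
  exact: (cvg_unique _ (@fg_lim (chart y)) cf2).
apply: cvg_trans cfz; apply: near_eq_cvg; near=> t.
have t0 : 0 < t by near: t; exact: nbhs_right_gt.
rewrite -chz fE; last first.
  by near: t.
by rewrite monz; field; rewrite expf_neq0 // gt_eqF.
Unshelve. all: by end_near. Qed.

(** Replacing the vanishing coordinates of y0 by 1 gives a point y1 whose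
    image x0 lies in the torus. Applying the Euler fields to both sides of
    [face_transform] at y1 shows that A maps the vector of the x_j d_j fg(x0) to
    y1^l times the vector of chart coefficients at y0; inverting A identifies
    [euler_coef j y0] with x_j d_j fg(x0) up to a nonzero factor. *)
Lemma face_euler_coef_neq0 y0 : (forall k, k \in I -> y0 0 k = 0) ->
  (forall k, k \notin I -> y0 0 k != 0) ->
  exists2 x0 : 'rV[R]_n, (forall j, x0 0 j != 0) &
    forall j, partial j fg x0 != 0 -> euler_coef j y0 != 0.
Proof.
move=> y0I y0N.
pose y1 : 'rV[R]_n := \row_k (if k \in I then 1 else y0 0 k).
have zy1 : zero_on I y1 = y0.
  by apply/rowP => k; rewrite !mxE; case: (boolP (k \in I)) => // /y0I ->.
have y1n0 k : y1 0 k != 0 by rewrite mxE; case: ifPn => [_|/y0N //]; exact: oner_neq0.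
exists (chart y1) => [|i Hi]; first exact: chart_neq0.
have oT : open [set: 'rV[R]_n] by exact: openT.
have Czeta i' : Ck setT 1 (fun y => zero_on I y 0 i').
  case iI : (i' \in I).
    by apply: (Ck_ext oT (f := fun=> 0)); [move=> y _; rewrite mxE iI|exact: Ck_cst].
  by apply: (Ck_ext oT (f := fun y => y 0 i')); [move=> y _; rewrite mxE iI|exact: Ck_coord].
have Cfz : Ck setT 1 (fs \o zero_on I).
  exact: (Ck_comp oT chart_dom_open (fun y _ => @chart_dom_zero_on y) Cfs Czeta).
have pz k : partial k (fs \o zero_on I) y1 = (k \notin I)%:R * partial k fs y0.
  have [d1 d2] := Ck_diff chart_dom_open Cfs (chart_dom_zero_on y1).
  have dc j' : derivable (fun z => zero_on I z 0 j') y1 'e_k.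
    exact: Ck_der (Czeta j') _.
  rewrite [LHS](@derive_val _ _ _ _ _ _ _ (is_derive_comp d1 d2 dc)) zy1.
  have E j' : 'D_('e_k) (fun z => zero_on I z 0 j') y1 = ((j' == k) && (j' \notin I))%:R.
    case iI : (j' \in I).
      rewrite andbF -[LHS]/(partial k (fun z => zero_on I z 0 j') y1).
      rewrite (partial_ext oT k (g := fun=> 0)) //; last by move=> z _; rewrite mxE iI.
      by rewrite /partial derive_cst.
    rewrite andbT -[LHS]/(partial k (fun z => zero_on I z 0 j') y1).
    rewrite (partial_ext oT k (g := fun z => z 0 j')) //; last by move=> z _; rewrite mxE iI.
    exact: partial_coord.
  rewrite (bigD1 k) //= big1 ?addr0 => [|j' /negbTE jk]; last by rewrite E jk mulr0.
  by rewrite E eqxx /= mulrC.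
have key k : \sum_i (A k i)%:R * (chart y1 0 i * partial i fg (chart y1)) =
    monom l y1 * chart_euler_coef k y0.
  rewrite -(euler_chain k oT (Cfg 1)) //.
  rewrite (partial_ext oT k (g := fun y => monom l y * (fs \o zero_on I) y)) //; last first.
    by move=> y _; exact: face_transform.
  rewrite partialM; last 2 first.
  - exact: Ck_der (Ck_monom 1 l oT) _.
  - exact: Ck_der Cfz _.
  rewrite pz /= zy1 /chart_euler_coef !mulrDr addrC.
  have E := monom_euler l k y1.
  rewrite mulrCA E; congr (_ + _); first by ring.
  rewrite mulrCA; congr (_ * _); rewrite mulrA; congr (_ * _).
  rewrite mxE; case: ifPn => [kI|kI]; last by rewrite mulr1.
  by rewrite y0I // mulr0.
have := invmx_solve key i.
under eq_bigr do rewrite mulrCA.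
rewrite -mulr_sumr -/(euler_coef i y0) => E.
apply: contra_neq Hi => V0; move: E; rewrite V0 mulr0 => /eqP.
by rewrite mulf_eq0 (negbTE (chart_neq0 y1n0 i)) => /eqP.
Qed.

End face.
End strict_transform.

(** * Estimates near a point over the origin *)

Section local_estimates.
Context {R : realType} {n : nat}.
Implicit Types (x y v : 'rV[R]_n) (i j k : 'I_n) (s t : R) (l q : 'I_n -> nat).

Definition cube y := forall k, 0 < y 0 k <= 1.

Lemma cube_neq0 y : cube y -> forall k, y 0 k != 0.
Proof. by move=> yc k; have /andP[y0 _] := yc k; rewrite gt_eqF. Qed.

Lemma monom_gt0 l y : cube y -> 0 < monom l y.
Proof. by move=> yc; apply: prodr_gt0 => k _; rewrite exprn_gt0 //; have /andP[] := yc k. Qed.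

Lemma monom_le l q y : cube y -> (forall k, (l k <= q k)%N) -> monom q y <= monom l y.
Proof.
move=> yc lq; apply: ler_prod => k _; have /andP[y0 y1] := yc k.
by rewrite exprn_ge0 ?(ltW y0) // ler_wiXn2l // ltW.
Qed.

Lemma monomX l p y : monom l y ^+ p = monom (fun k => (l k * p)%N) y.
Proof. by rewrite /monom -prodrXl; apply: eq_bigr => k _; rewrite -exprM. Qed.

Lemma monomD l q y : monom (fun k => (l k + q k)%N) y = monom l y * monom q y.
Proof. by rewrite /monom -big_split; apply: eq_bigr => k _; rewrite exprD. Qed.

Lemma monom_le_coord l k y : cube y -> (0 < l k)%N -> monom l y <= y 0 k.
Proof.
move=> yc lk; have -> : y 0 k = monom (fun i => nat_of_bool (i == k)) y.
  rewrite /monom (bigD1 k) //= eqxx expr1 big1 ?mulr1 // => i /negbTE ->.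
  by rewrite expr0.
by apply: monom_le => // i; have [->|] := eqVneq i k.
Qed.

Lemma monom_ge_exp l y (m : R) : cube y -> 0 <= m ->
  (forall k, (0 < l k)%N -> m <= y 0 k) -> m ^+ (\sum_k l k) <= monom l y.
Proof.
move=> yc m0 H; rewrite /monom -prodrXr; apply: ler_prod => k _.
rewrite exprn_ge0 //=; case: (posnP (l k)) => [->|lk]; first by rewrite !expr0.
by rewrite lerXn2r ?nnegrE ?H // (le_trans m0 (H k lk)).
Qed.

Context (A : 'M[nat]_n) (sg : 'I_n -> R) (sg1 : forall j, `|sg j| = 1).
Context (e0 : R) (e0_gt0 : 0 < e0).
Local Notation chart := (chart A sg).
Local Notation chart_dom := (chart_dom A sg e0).
Context (f : 'rV[R]_n -> R) (U : set 'rV[R]_n) (oU : open U).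
Context (bU : box e0 `<=` U) (Cf : forall m, Ck U m f).
Context (l : 'I_n -> nat) (fs : 'rV[R]_n -> R) (Cfs : Ck chart_dom 1 fs).
Hypothesis fE : forall y, chart_dom y -> f (chart y) = monom l y * fs y.
Hypothesis Aunit : (embed A : 'M[R]_n) \in unitmx.
Hypothesis ND : forall y0, (forall k, 0 <= y0 0 k) -> chart y0 = 0 ->
  exists j, euler_coef A l fs j y0 != 0 /\ forall k, y0 0 k = 0 -> (A k j <= l k)%N.

Let oD : open chart_dom := @chart_dom_open R n A sg e0.

Lemma chart_dom_origin y : chart y = 0 -> chart_dom y.
Proof. by move=> c0 j; rewrite c0 mxE normr0. Qed.

Lemma normr_chart y j : cube y -> `|chart y 0 j| = monom (A^~ j) y.
Proof. by move=> yc; rewrite mxE normrM sg1 mul1r ger0_norm // ltW // monom_gt0. Qed.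

Lemma chart0_coord y j : chart y = 0 -> exists2 k, y 0 k = 0 & (0 < A k j)%N.
Proof.
move=> /rowP/(_ j); rewrite !mxE => /eqP; rewrite mulf_eq0.
have /negbTE -> /= : sg j != 0 by rewrite -normr_gt0 sg1.
move=> /prodf_eq0[k _]; rewrite expf_eq0 => /andP[Ak /eqP yk]; by exists k.
Qed.

Section companion.
Context (g : 'rV[R]_n -> R) (Cg : forall m, Ck U m g).
Hypothesis fg0 : forall x, box e0 x -> f x = 0 -> g x = 0.

Let l_pos k : nat := (0 < l k)%N.

(** If l_k > 0 then f o chart vanishes on y_k = 0, and so does g o chart:
    it is divisible by the product of these coordinates. *)
Lemma companion_quotient : exists Gt, Ck chart_dom 1 Gt /\
  forall y, chart_dom y -> g (chart y) = monom l_pos y * Gt y.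
Proof.
have bD := @chart_dom_balanced _ _ A sg e0.
have CG m : Ck chart_dom m (g \o chart) by exact: Ck_chart_comp oU bU (Cg m).
apply: (@chart_division _ _ A sg e0 U g 1 l_pos oU bU Cg) => y Dy yn0 k.
have D0 : chart_dom (shrink k 0 y) by apply: bD => //; rewrite lexx ler01.
have bnd h : Ck chart_dom 0 h ->
  \forall t \near (0 : R)^'+, `|h (shrink k t y)| <= `|h (shrink k 0 y)| + 1.
  move=> Ch; have c := near_bounded (Ck_cont Ch D0).
  by apply: cvg_at_right_filter c; exact: shrink_cvgl.
rewrite /l_pos; case: (posnP (l k)) => [_|lk].
  by exists (`|g (chart (shrink k 0 y))| + 1); under eq_near do rewrite expr0 mulr1;
    exact: bnd (CG 0).
have van z : chart_dom z -> (g \o chart) (shrink k 0 z) = 0.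
  move=> Dz; have Dz0 : chart_dom (shrink k 0 z) by apply: bD => //; rewrite lexx ler01.
  apply: fg0 => //; rewrite (fE Dz0) /monom (bigD1 k) //= mxE eqxx mul0r expr0n.
  by rewrite gtn_eqF // !mul0r.
have [CH HE] := hadamard oD (@bD k) (CG 1) van.
set h := shrink_mean _ _ _ in CH HE.
exists (`|y 0 k| * (`|h (shrink k 0 y)| + 1)).
near=> t.
have t0 : 0 < t by near: t; exact: nbhs_right_gt.
have t1 : t <= 1 by near: t; exact: nbhs_right_le.
rewrite HE; last by apply: bD => //; rewrite t1 ltW.
rewrite mxE eqxx expr1 !normrM (gtr0_norm t0) -mulrA [leRHS]mulrC.
apply: ler_wpM2l; first exact: ltW.
apply: ler_wpM2l => //; near: t; exact: bnd.
Unshelve. all: by end_near. Qed.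

(** The derivative of fs in direction k stays close to its value d at y0, so
    between -T and T, where T = 2 |fs y| / |d|, the restriction of fs to the line
    through y changes sign. *)
Lemma nearby_zero y0 k : chart_dom y0 -> fs y0 = 0 -> partial k fs y0 != 0 ->
  forall r : R, 0 < r -> \forall y \near y0, exists t,
    [/\ `|t| <= r, `|t| <= 2 / `|partial k fs y0| * `|fs y| & fs (t *: 'e_k + y) = 0].
Proof.
move=> Dy0 f0 d0; set d := partial k fs y0 in d0 *.
have dp : 0 < `|d| by rewrite normr_gt0.
have cd : {for y0, continuous (partial k fs)} by exact: Ck_cont (Ck_partial k Cfs) Dy0.
have [r1 r1p r1P] : exists2 r1 : R, 0 < r1 &
    forall z, `|z - y0| < r1 -> chart_dom z /\ `|partial k fs z - d| <= `|d| / 2.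
  have : \forall z \near y0, chart_dom z /\ `|partial k fs z - d| <= `|d| / 2.
    near=> z; split; first by near: z; exact: open_nbhs_nbhs.
    rewrite distrC; near: z; have /cvgrPdist_le := cd; apply; by rewrite divr_gt0.
  move=> /nbhs_ballP[r1 /= r1p r1P]; exists r1 => // z zr; apply: r1P.
  by rewrite -ball_normE /ball_/= distrC.
move=> r rp.
have nT : \forall y \near y0, 2 / `|d| * `|fs y| < Num.min r (r1 / 2).
  have rr : 0 < Num.min r (r1 / 2) by rewrite lt_min rp divr_gt0.
  have cf : {for y0, continuous fs} by exact: Ck_cont Cfs Dy0.
  have cn : `|fs z| @[z --> y0] --> `|fs y0| by exact: (cvg_norm cf).
  have : \forall y \near y0, `|fs y| < (2 / `|d|)^-1 * Num.min r (r1 / 2).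
    have := cvgr_lt _ cn; apply.
    by rewrite f0 normr0 mulr_gt0 // invr_gt0 divr_gt0.
  by apply: filterS => y; rewrite ltr_pdivlMl ?divr_gt0.
near=> y.
pose T := 2 / `|d| * `|fs y|.
have T0 : 0 <= T by rewrite /T mulr_ge0 // divr_ge0.
have yr : `|y - y0| < r1 / 2.
  rewrite distrC; near: y; apply/nbhs_ballP; exists (r1 / 2); first by rewrite /= divr_gt0.
  by move=> z; rewrite -ball_normE.
have Tr : T < Num.min r (r1 / 2) by rewrite /T; near: y.
move: Tr; rewrite lt_min => /andP[Tr Tr1].
have near0 t : `|t| <= T -> `|t *: 'e_k + y - y0| < r1.
  move=> tT; rewrite -addrA; apply: le_lt_trans (ler_normD _ _) _.
  rewrite [r1]splitr; apply: ltrD => //; apply: le_lt_trans Tr1.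
  rewrite normrZ; apply: le_trans tT.
  by rewrite ler_piMr // norm_delta.
have dfs t : `|t| <= T -> derivable fs (t *: 'e_k + y) 'e_k.
  by move=> /near0 /r1P[D1 _]; exact: Ck_der Cfs D1.
have mv t : `|t| <= T -> exists2 u, `|u - d| <= `|d| / 2 & fs (t *: 'e_k + y) = fs y + u * t.
  move=> tT; have [|s st E] := @MVT_line _ _ fs y 'e_k t.
    by move=> s st; apply: dfs; exact: le_trans tT.
  exists (partial k fs (s *: 'e_k + y)); last by rewrite /partial -E [RHS]addrC subrK.
  by have [] := r1P _ (near0 _ (le_trans st tT)).
have TE : `|d| / 2 * T = `|fs y| by rewrite /T; field; rewrite gt_eqF.
have NT : - T <= T by rewrite (le_trans _ T0) // oppr_le0.
pose phi (t : R) := fs (t *: 'e_k + y).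
have cphi : {within `[- T, T], continuous phi}.
  apply: derivable_within_continuous => t; rewrite in_itv /= -ler_norml => tT.
  by have [] := is_derive_line (dfs _ tT).
have TT : `|T| <= T by rewrite ger0_norm.
have NTT : `|- T| <= T by rewrite normrN.
have [u1 u1d E1] := mv T TT.
have [u2 u2d E2] := mv (- T) NTT.
have [|t tT t0] := @IVT _ phi (- T) T 0 NT cphi.
  rewrite /phi E1 E2 ge_min le_max mulrN.
  move: u1d u2d; rewrite !ler_norml => /andP[a1 b1] /andP[a2 b2].
  have fa := ler_norm (fs y); have fb := ler_norm (- fs y); rewrite normrN in fb.
  have [dpos|dneg] := ltP 0 d.
    move: a1 b1 a2 b2 TE; rewrite !(gtr0_norm dpos) => a1 b1 a2 b2 TE.
    have h1 : `|fs y| <= u1 * T by rewrite -TE; apply: ler_wpM2r => //; lra.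
    have h2 : `|fs y| <= u2 * T by rewrite -TE; apply: ler_wpM2r => //; lra.
    by apply/andP; split; apply/orP; [left|right]; lra.
  move: a1 b1 a2 b2 TE; rewrite !(ler0_norm dneg) => a1 b1 a2 b2 TE.
  have h1 : u1 * T <= - `|fs y| by rewrite -TE -mulNr; apply: ler_wpM2r => //; lra.
  have h2 : u2 * T <= - `|fs y| by rewrite -TE -mulNr; apply: ler_wpM2r => //; lra.
  by apply/andP; split; apply/orP; [right|left]; lra.
move: tT; rewrite in_itv /= -ler_norml => tT.
by exists t; split => //; apply: (le_trans tT); exact: ltW.
Unshelve. all: by end_near. Qed.

(** If fs does not vanish at y0 there is nothing to do. Otherwise some
    Euler coefficient of the chart is nonzero at y0; since fs(y0) = 0, this gives
    k with y0_k <> 0 and a nonzero derivative of fs in direction k. By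
    [nearby_zero] the segment from y in that direction meets fs = 0 at distance
    O(|fs y|). There f, hence g, hence Gt vanishes, and Gt is Lipschitz. *)
Lemma companion_quotient_bound Gt y0 : Ck chart_dom 1 Gt ->
  (forall y, chart_dom y -> g (chart y) = monom l_pos y * Gt y) ->
  (forall k, 0 <= y0 0 k) -> chart y0 = 0 ->
  exists2 C : R, 0 < C & \forall y \near y0, cube y -> `|Gt y| <= C * `|fs y|.
Proof.
move=> CGt GE y00 c0; have Dy0 := chart_dom_origin c0.
have cG : {for y0, continuous Gt} by exact: Ck_cont CGt Dy0.
have cf : {for y0, continuous fs} by exact: Ck_cont Cfs Dy0.
have [f0|f0] := eqVneq (fs y0) 0; last first.
  have fp : 0 < `|fs y0| by rewrite normr_gt0.
  exists ((`|Gt y0| + 1) / (`|fs y0| / 2)); first by rewrite !divr_gt0 // ltr_wpDl.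
  near=> y => _.
  have h1 : `|Gt y| <= `|Gt y0| + 1 by near: y; exact: near_bounded.
  have h2 : `|fs y0| / 2 <= `|fs y| by near: y; exact: near_away.
  apply: (le_trans h1); rewrite mulrAC ler_pdivlMr ?divr_gt0 //.
  by apply: ler_wpM2l => //; rewrite addr_ge0.
have [j [Vj0 _]] := ND y00 c0.
have [k Gk0] : exists k, chart_euler_coef l fs k y0 != 0.
  apply/existsP; apply: contra_neqT Vj0; rewrite negb_exists => /forallP H.
  by rewrite /euler_coef big1 // => k _; have := H k; rewrite negbK => /eqP ->; rewrite mulr0.
move: Gk0; rewrite /chart_euler_coef f0 mulr0 add0r mulf_eq0 negb_or => /andP[yk d0].
have ykp : 0 < y0 0 k by rewrite lt_neqAle eq_sym yk y00.
have cdG : {for y0, continuous (partial k Gt)} by exact: Ck_cont (Ck_partial k CGt) Dy0.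
have [r1 r1p r1P] : exists2 r1 : R, 0 < r1 & forall z, `|z - y0| < r1 ->
    chart_dom z /\ `|partial k Gt z| <= `|partial k Gt y0| + 1 /\ 0 < z 0 k.
  have : \forall z \near y0, chart_dom z /\ `|partial k Gt z| <= `|partial k Gt y0| + 1 /\
    0 < z 0 k.
    near=> z; split; first by near: z; exact: open_nbhs_nbhs.
    split; first by near: z; exact: near_bounded.
    near: z; have c := @coord_continuous R 1 n 0 k y0.
    by have := cvgr_gt _ c; apply.
  move=> /nbhs_ballP[r1 /= r1p r1P]; exists r1 => // z zr; apply: r1P.
  by rewrite -ball_normE /ball_/= distrC.
set C := `|partial k Gt y0| + 1 in r1P.
have Cp : 0 < C by rewrite ltr_wpDl.
set d := partial k fs y0 in d0.
exists (C * (2 / `|d|)); first by rewrite mulr_gt0 // divr_gt0 // normr_gt0.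
have NZ := @nearby_zero y0 k Dy0 f0 d0 (r1 / 4) (divr_gt0 r1p (ltr0n _ 4)).
near=> y => yc.
have yr : `|y - y0| < r1 / 2.
  rewrite distrC; near: y; apply/nbhs_ballP; exists (r1 / 2); first by rewrite /= divr_gt0.
  by move=> z; rewrite -ball_normE.
have [t [tr tf ft]] : exists t, [/\ `|t| <= r1 / 4, `|t| <= 2 / `|d| * `|fs y| &
    fs (t *: 'e_k + y) = 0] by near: y.
have near0 u : `|u| <= `|t| -> `|u *: 'e_k + y - y0| < r1.
  move=> ut; rewrite -addrA; apply: le_lt_trans (ler_normD _ _) _.
  have : `|u *: ('e_k : 'rV[R]_n)| <= r1 / 4.
    rewrite normrZ; apply: le_trans tr; apply: le_trans ut.
    by rewrite ler_piMr // norm_delta.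
  by lra.
have [Dz [_ zk]] := r1P _ (near0 t (lexx _)).
have Gz : Gt (t *: 'e_k + y) = 0.
  have : g (chart (t *: 'e_k + y)) = 0 by apply: fg0 => //; rewrite fE // ft mulr0.
  rewrite GE // => /eqP; rewrite mulf_eq0 => /orP[|/eqP //].
  move=> /eqP m0; have : monom l_pos (t *: 'e_k + y) != 0.
    apply: monom_neq0 => i; have [->|ik] := eqVneq i k; first by rewrite gt_eqF.
    by rewrite !mxE (negbTE ik) andbF mulr0 add0r cube_neq0.
  by rewrite m0 eqxx.
have [|u ut E] := @MVT_line _ _ Gt y 'e_k t.
  move=> u /near0 /r1P[D1 _]; exact: Ck_der CGt D1.
have -> : Gt y = - ('D_('e_k) Gt (u *: 'e_k + y) * t) by rewrite -E Gz sub0r opprK.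
rewrite normrN normrM -mulrA; apply: ler_pM => //.
by have [_ []] := r1P _ (near0 _ ut).
Unshelve. all: by end_near. Qed.

(** Each positive l_k is at most L and the coordinates are at most 1, so
    the L-th power of the product of the y_k with l_k > 0 is at most y^l; the
    factor |Gt|^L is O(|fs|) because 1 <= L. *)
Lemma comparison_ineq_local (L : nat) y0 : (0 < L)%N -> (forall k, (l k <= L)%N) ->
  (forall k, 0 <= y0 0 k) -> chart y0 = 0 ->
  exists2 c : R, 0 < c & \forall y \near y0, cube y ->
    c * `|g (chart y)| ^+ L <= `|f (chart y)|.
Proof.
move=> L0 lL y00 c0; have Dy0 := chart_dom_origin c0.
have [Gt [CGt GE]] := companion_quotient.
have [C Cp CH] := companion_quotient_bound CGt GE y00 c0.
have cf : {for y0, continuous fs} by exact: Ck_cont Cfs Dy0.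
set M := `|fs y0| + 1.
have Mp : 0 < M by rewrite ltr_wpDl.
exists (C ^+ L * M ^+ L.-1)^-1; first by rewrite invr_gt0 mulr_gt0 // exprn_gt0.
near=> y => yc.
have Dy : chart_dom y by near: y; exact: open_nbhs_nbhs.
have fM : `|fs y| <= M by near: y; exact: near_bounded.
have Gf : `|Gt y| <= C * `|fs y| by move: (yc); near: y.
rewrite GE // fE // !normrM (gtr0_norm (monom_gt0 l yc)) (gtr0_norm (monom_gt0 l_pos yc)).
rewrite ler_pdivrMl ?mulr_gt0 ?exprn_gt0 // exprMn.
have h1 : monom l_pos y ^+ L <= monom l y.
  rewrite monomX; apply: monom_le => // k; rewrite /l_pos.
  by case: (posnP (l k)) => [->|_] //; rewrite mul1n.
have h2 : `|Gt y| ^+ L <= C ^+ L * M ^+ L.-1 * `|fs y|.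
  apply: (@le_trans _ _ ((C * `|fs y|) ^+ L)).
    by rewrite lerXn2r ?nnegrE // mulr_ge0 // ltW.
  rewrite exprMn -mulrA; apply: ler_wpM2l; first by rewrite exprn_ge0 // ltW.
  rewrite -[in leLHS](prednK L0) exprSr; apply: ler_wpM2r => //.
  by rewrite lerXn2r ?nnegrE // ltW.
rewrite mulrCA; apply: ler_pM => //.
by rewrite exprn_ge0 // ltW // monom_gt0.
Unshelve. all: by end_near. Qed.


End companion.

(** The first two bounds give m^(N-1) = O(D). Inserting this in
    F^(N-1) = O(m^(N-1) D^(N-1)) gives F^(N-1) = O(D^N). *)
Lemma gradient_ineq_arith (N : nat) (S X m F D v C : R) : (0 < N)%N ->
  0 < X -> 0 < v -> 0 <= m -> 0 <= D -> 0 <= F -> 0 < C ->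
  X * m ^+ N.-1 <= S -> v * S <= X * D -> F <= C * m * D ->
  v / C ^+ N.-1 * F ^+ N.-1 <= D ^+ N.
Proof.
move=> N0 X0 v0 m0 D0 F0 C0 h1 h2 h3.
rewrite -[X in _ <= _ ^+ X](prednK N0); set p := N.-1 in h1 *.
have h4 : F ^+ p <= C ^+ p * m ^+ p * D ^+ p.
  by rewrite -!exprMn lerXn2r ?nnegrE // !mulr_ge0 // ltW.
have h5 : v * m ^+ p <= D.
  rewrite -(ler_pM2l X0) mulrCA; apply: le_trans h2.
  by rewrite ler_pM2l.
rewrite mulrAC ler_pdivrMr ?exprn_gt0 // exprS.
apply: (@le_trans _ _ (v * (C ^+ p * m ^+ p * D ^+ p))); first by rewrite ler_pM2l.
have -> : v * (C ^+ p * m ^+ p * D ^+ p) = (v * m ^+ p) * (D ^+ p * C ^+ p) by ring.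
rewrite -[leRHS]mulrA; apply: ler_wpM2r => //.
by rewrite mulr_ge0 ?exprn_ge0 // ltW.
Qed.

(** Let D be the norm of the gradient, S = y^l, X = |x_j| for the index j
    given by nondegeneracy, and m = y_k0 the least coordinate with l_k0 > 0. The
    three bounds of [gradient_ineq_arith] hold. First, X m^(N-1) <= S, because
    a^k_j <= l_k for the coordinates vanishing at y0 and at least one of these
    a^k_j is positive, x_j being 0 there. Second, S = O(X D), because
    [euler_coef j] does not vanish at y0. Third, |f| = O(m D): the Euler field
    of y_k0 involves only those x_j with a^k0_j > 0, which are at most m, and it
    equals S (l_k0 fs + m d_k0 fs). *)
Lemma gradient_ineq_local (N : nat) y0 : (\sum_k l k <= N)%N -> (exists k, (0 < l k)%N) ->
  (forall k, 0 <= y0 0 k) -> chart y0 = 0 ->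
  exists2 c : R, 0 < c & \forall y \near y0, cube y ->
    c * `|f (chart y)| ^+ N.-1 <= enorm (gradient f (chart y)) ^+ N.
Proof.
move=> lN [k1 lk1] y00 c0; have Dy0 := chart_dom_origin c0.
have N0 : (0 < N)%N by apply: leq_trans lN; rewrite (bigD1 k1) //= addn_gt0 lk1.
have [j [Vj0 Alj]] := ND y00 c0.
have cV : {for y0, continuous (euler_coef A l fs j)} by exact: (euler_coef_continuous Cfs).
have [i0 yi0 Ai0] := chart0_coord j c0.
set v := `|euler_coef A l fs j y0| / 2.
have v0 : 0 < v by rewrite divr_gt0 // normr_gt0.
set C1 := (\sum_k \sum_i A k i)%:R : R.
set C2 := \sum_k (`|partial k fs y0| + 1).
have C20 : 0 <= C2 by apply: sumr_ge0 => k _; rewrite addr_ge0.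
have C0 : 0 < C1 + C2 / v + 1 by rewrite ltr_wpDl // addr_ge0 ?ler0n // divr_ge0 // ltW.
exists (v / (C1 + C2 / v + 1) ^+ N.-1); first by rewrite divr_gt0 ?exprn_gt0.
have ndf k : \forall y \near y0, `|partial k fs y| <= `|partial k fs y0| + 1.
  by apply: near_bounded; exact: Ck_cont (Ck_partial k Cfs) Dy0.
near=> y => yc.
have Dy : chart_dom y by near: y; exact: open_nbhs_nbhs.
have Vy : v <= `|euler_coef A l fs j y| by near: y; exact: near_away.
have dfs k : `|partial k fs y| <= C2.
  apply: (@le_trans _ _ (`|partial k fs y0| + 1)).
    by move: k; near: y; exact: (filter_forall _ ndf).
  rewrite /C2 (bigD1 k) //= lerDl; apply: sumr_ge0 => i _; by rewrite addr_ge0.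
set x := chart y; set Dg := enorm (gradient f x).
have Dg0 : 0 <= Dg by exact: enorm_ge0.
have dD i : `|partial i f x| <= Dg.
  by have := coord_le_enorm (gradient f x) i; rewrite mxE.
have [k0 lk0 km] : exists2 k0, (0 < l k0)%N & forall k, (0 < l k)%N -> y 0 k0 <= y 0 k.
  by case: (@arg_minP _ _ _ k1 (fun k => 0 < l k)%N (fun k => y 0 k) lk1) => k0 h1 h2;
    exists k0.
set m := y 0 k0 in km.
have /andP[m0 m1] : 0 < m <= 1 := yc k0.
set S := monom l y; set X := monom (A^~ j) y.
have S0 : 0 < S by exact: monom_gt0.
have X0 : 0 < X by exact: monom_gt0.
have X1 : X <= 1 by apply: (le_trans (@monom_le_coord (A^~ j) i0 y yc Ai0)); have /andP[] := yc i0.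
have xX : `|x 0 j| = X by exact: normr_chart.
have hb : v * S <= X * Dg.
  have := euler_coefE oU bU Cf Cfs fE Aunit j Dy.
  move=> /(congr1 Num.norm); rewrite !normrM xX (gtr0_norm S0) => E.
  apply: (@le_trans _ _ (S * `|euler_coef A l fs j y|)); first by rewrite mulrC ler_pM2l.
  by rewrite -E ler_pM2l.
have ha : X * m ^+ N.-1 <= S.
  (* only the factors of x_j that vanish at y0 are kept: they divide y^l, and
     the quotient has degree at most N - 1 *)
  pose q k := if y0 0 k == 0 then A k j else 0%N.
  have ql k : (q k <= l k)%N by rewrite /q; case: eqP => // /Alj.
  have qA k : (q k <= A k j)%N by rewrite /q; case: eqP.
  have SE : S = monom q y * monom (fun k => (l k - q k)%N) y.
    by rewrite -monomD; apply: eq_bigr => k _; rewrite subnKC.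
  rewrite SE; apply: ler_pM => //; [exact: ltW|by rewrite exprn_ge0 // ltW|exact: monom_le|].
  apply: (@le_trans _ _ (m ^+ (\sum_k (l k - q k)))).
    apply: ler_wiXn2l => //; first exact: ltW.
    have hS : (\sum_k (l k - q k) + \sum_k q k = \sum_k l k)%N.
      by rewrite -big_split /=; apply: eq_bigr => k _; rewrite subnK.
    have hq : (0 < \sum_k q k)%N.
      by rewrite (bigD1 i0) //= addn_gt0 /q yi0 eqxx Ai0.
    rewrite -ltnS (prednK N0); apply: leq_trans lN; rewrite -hS.
    by rewrite -[X in (X < _)%N]addn0 ltn_add2l.
  apply: monom_ge_exp => //; first exact: ltW.
  by move=> k lqk; apply: km; apply: leq_trans lqk _; exact: leq_subr.
have hc : `|f x| <= m * (C1 * Dg + C2 * S).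
  have := chart_euler_coefE oU bU Cf Cfs fE k0 Dy => E.
  have h1 : `|\sum_i (A k0 i)%:R * (x 0 i * partial i f x)| <= C1 * m * Dg.
    apply: le_trans (ler_norm_sum _ _ _) _.
    apply: (@le_trans _ _ (\sum_i (A k0 i)%:R * (m * Dg))).
      apply: ler_sum => i _; rewrite normrM normr_nat.
      have [->|Ai] := posnP (A k0 i); first by rewrite !mul0r.
      apply: ler_wpM2l => //; rewrite normrM; apply: ler_pM => //.
      by rewrite normr_chart //; exact: (@monom_le_coord (A^~ i) k0 y yc Ai).
    rewrite -mulr_suml -mulrA; apply: ler_wpM2r; first by rewrite mulr_ge0 // ltW.
    rewrite -natr_sum ler_nat [leqRHS](bigD1 k0) //=; exact: leq_addr.
  have h2 : S * (`|fs y| - m * C2) <= `|monom l y * chart_euler_coef l fs k0 y|.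
    rewrite normrM (gtr0_norm S0) ler_pM2l // /chart_euler_coef -/m.
    have t1 : `|fs y| <= `|(l k0)%:R * fs y|.
      by rewrite normrM normr_nat ler_peMl // ler1n.
    have t2 : `|m * partial k0 fs y| <= m * C2.
      by rewrite normrM (gtr0_norm m0) ler_pM2l.
    have t3 := lerB_normD ((l k0)%:R * fs y) (m * partial k0 fs y).
    by apply: le_trans t3; apply: lerB.
  have h3 : S * (`|fs y| - m * C2) <= C1 * m * Dg by apply: (le_trans h2); rewrite -E.
  rewrite /x fE // normrM (gtr0_norm S0).
  have -> : m * (C1 * Dg + C2 * S) = C1 * m * Dg + S * (m * C2) by ring.
  by rewrite -lerBlDr -mulrBr.
have hF : `|f x| <= (C1 + C2 / v + 1) * m * Dg.
  apply: (le_trans hc); rewrite [_ * m]mulrC -mulrA; apply: ler_wpM2l; first exact: ltW.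
  rewrite !mulrDl mul1r -addrA lerD2l; apply: (@le_trans _ _ (C2 / v * Dg)); last by rewrite lerDl.
  rewrite -mulrA; apply: ler_wpM2l => //; rewrite ler_pdivlMl //.
  by apply: (le_trans hb); rewrite ler_piMl.
by apply: (@gradient_ineq_arith N S X m `|f x|) => //; exact: ltW.
Unshelve. all: by end_near. Qed.
End local_estimates.

(** * A Taylor formula over a box of exponents *)

Section taylor.
Context {R : realType} {n : nat}.
Implicit Types (f g h : 'rV[R]_n -> R) (x y w : 'rV[R]_n) (U : set 'rV[R]_n).
Implicit Types (i j k : 'I_n) (m M : nat) (s : seq 'I_n) (t : R) (al : 'rV[nat]_n).

Lemma partials_cat s1 s2 f : partials (s1 ++ s2) f = partials s1 (partials s2 f).
Proof. by rewrite /partials foldr_cat. Qed.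

Lemma partials_nseq m k f : partials (nseq m k) f = iter m (partial k) f.
Proof. by elim: m => //= m ->. Qed.

Lemma smooth_partials U s f : smooth_on U f -> smooth_on U (partials s f).
Proof. by move=> sf s' x Ux; have := sf (s' ++ s) x Ux; rewrite partials_cat. Qed.

Lemma is_derive_taylor_poly M (c : nat -> R) t :
  is_derive t 1 (fun u : R => \sum_(m < M.+1) c m * u ^+ m / m`!%:R)
    (\sum_(m < M) c m.+1 * t ^+ m / m`!%:R).
Proof.
(* the Taylor sum as a polynomial in t, whose formal derivative is known *)
pose p := \poly_(m < M.+1) (c m / m`!%:R).
have pE u : p.[u] = \sum_(m < M.+1) c m * u ^+ m / m`!%:R.
  by rewrite horner_poly; apply: eq_bigr => m _; rewrite mulrAC.
have -> : (fun u => \sum_(m < M.+1) c m * u ^+ m / m`!%:R) = horner p.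
  by apply/funext => u; rewrite pE.
have -> : \sum_(m < M) c m.+1 * t ^+ m / m`!%:R = p^`().[t]; last first.
  exact: is_derive_poly.
have sp : (size p^`() <= M)%N.
  have [->|p0] := eqVneq p 0; first by rewrite deriv0 size_poly0.
  by rewrite -ltnS (leq_trans (lt_size_deriv p0)) // size_poly.
rewrite (horner_coef_wide _ sp); apply: eq_bigr => m _.
rewrite coef_deriv coef_poly ltnS ltn_ord factS natrM mulrAC; congr (_ * _).
rewrite -mulr_natr invfM; field.
by rewrite nat1r !pnatr_eq0 -lt0n fact_gt0.
Qed.

(** The derivative in direction k of the remainder of order M + 1 of h is the
    remainder of order M of its k-th partial derivative; the mean value theorem
    along the k-th coordinate concludes by induction. *)
Lemma taylor_coord U h k M : open U -> U 0 -> Ck U M h ->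
  exists C d : R, [/\ 0 <= C, 0 < d & forall w, `|w| < d ->
    `|h w - \sum_(m < M) iter m (partial k) h (shrink k 0 w) * w 0 k ^+ m / m`!%:R|
      <= C * `|w 0 k| ^+ M].
Proof.
move=> oU U0; elim: M h => [|M IH] h Ch.
  have /nbhs_ballP[d /= d0 dP] := near_bounded (Ck_cont Ch U0).
  exists (`|h 0| + 1), d; split => //.
  move=> w wd; rewrite big_ord0 subr0 expr0 mulr1; apply: dP.
  by rewrite -ball_normE /ball_/= sub0r normrN.
have [C [d [C0 d0 dP]]] := IH _ (Ck_partial k Ch).
have /nbhs_ballP[d1 /= d10 d1P] : nbhs (0 : 'rV[R]_n) U by exact: open_nbhs_nbhs.
exists C, (Num.min d d1); split => //; first by rewrite lt_min d0.
move=> w; rewrite lt_min => /andP[wd wd1].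
pose z := shrink k 0 w.
have zk : z 0 k = 0 by rewrite mxE eqxx mul0r.
have wE : w 0 k *: 'e_k + z = w.
  apply/rowP => j; rewrite !mxE eqxx /=; have [->|jk] := eqVneq j k.
    by rewrite mulr1 mul0r addr0.
  by rewrite mulr0 add0r.
have small t : `|t| <= `|w 0 k| -> `|t *: 'e_k + z| <= `|w|.
  move=> tw; rewrite [leLHS]/Num.Def.normr/= mx_normrE; apply/bigmax_leP; split => //.
  case=> i j _ /=; rewrite (ord1 i) !mxE eqxx /=; have [->|jk] := eqVneq j k.
    by rewrite mulr1 mul0r addr0 (le_trans tw) // norm_coord.
  by rewrite mulr0 add0r norm_coord.
have shz t : shrink k 0 (t *: 'e_k + z) = z.
  apply/rowP => j; rewrite !mxE eqxx /=; have [->|jk] := eqVneq j k.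
    by rewrite !mul0r.
  by rewrite mulr0 add0r.
pose c m := iter m (partial k) h z.
pose phi (t : R) := h (t *: 'e_k + z) - \sum_(m < M.+1) c m * t ^+ m / m`!%:R.
have dphi t : `|t| <= `|w 0 k| -> is_derive t 1 phi
    (partial k h (t *: 'e_k + z) - \sum_(m < M) c m.+1 * t ^+ m / m`!%:R).
  move=> tw; have Ut : U (t *: 'e_k + z).
    apply: d1P; rewrite -ball_normE /ball_/= sub0r normrN.
    exact: le_lt_trans (small _ tw) wd1.
  have H1 := is_derive_line (Ck_der (j := k) Ch Ut).
  have H2 := is_derive_taylor_poly M c t.
  exact: is_deriveB.
have [|t tw E] := @MVT_line R R phi 0 1 (w 0 k).
  by move=> t tw; rewrite [t *: 1]mulr1 addr0; have [] := dphi _ tw.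
move: E; rewrite [_ *: 1]mulr1 !addr0 [t *: 1]mulr1.
have [_ ->] := dphi _ tw.
have phi0 : phi 0 = 0.
  rewrite /phi scale0r add0r big_ord_recl /= expr0 fact0 mulr1 divr1 big1 ?addr0 ?subrr //.
  by move=> m _; rewrite /= exprS mul0r mulr0 mul0r.
rewrite phi0 subr0 /phi wE => ->.
have := dP _ (le_lt_trans (small _ tw) wd).
rewrite shz; have -> : (t *: 'e_k + z) 0 k = t.
  by rewrite mxE zk !mxE !eqxx mulr1 addr0.
under eq_bigr => m _ do rewrite -iterSr.
move=> H; rewrite normrM exprSr mulrA; apply: ler_wpM2r => //.
by apply: (le_trans H); apply: ler_wpM2l => //; rewrite lerXn2r ?nnegrE.
Qed.

Definition set_exponent al k m : 'rV[nat]_n := \row_j (if j == k then m else al 0 j).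

Fixpoint box_exponents M s : seq 'rV[nat]_n :=
  if s is k :: s' then [seq set_exponent al k m | al <- box_exponents M s', m <- iota 0 M]
  else [:: const_mx 0%N].

Lemma mem_box_exponents M s al : uniq s ->
  (al \in box_exponents M s) = [forall j, if j \in s then (al 0%R j < M)%N else al 0 j == 0%N].
Proof.
elim: s al => [|k s IH] al /=.
  move=> _; rewrite inE; apply/eqP/forallP => [-> j|H]; first by rewrite mxE.
  by apply/rowP => j; rewrite mxE; have /eqP := H j.
move=> /andP[ks us]; apply/allpairsP/forallP => [[[be m] /= [bs mM ->]] j|H].
  rewrite inE mxE; have [//|jk] := eqVneq j k; first by move: mM; rewrite mem_iota.
  by move: bs; rewrite IH // => /forallP/(_ j).
exists (set_exponent al k 0, al 0 k); split => /=.
- rewrite IH //; apply/forallP => j; rewrite mxE; have [->|jk] := eqVneq j k.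
    by rewrite (negbTE ks).
  by have := H j; rewrite inE (negbTE jk).
- by rewrite mem_iota /= add0n; have := H k; rewrite inE eqxx.
- by apply/rowP => j; rewrite !mxE; have [->|] := eqVneq j k.
Qed.

Lemma box_exponents_uniq M s : uniq s -> uniq (box_exponents M s).
Proof.
elim: s => [|k s IH] //= /andP[ks us].
apply: allpairs_uniq; [exact: IH|exact: iota_uniq|].
move=> [a m] [b p] /allpairsP[[a' m'] /= [ha _ [-> ->]]] /allpairsP[[b' p'] /= [hb _ [-> ->]]].
move: ha hb; rewrite !mem_box_exponents // => /forallP/(_ k) + /forallP/(_ k).
rewrite (negbTE ks) => /eqP ak /eqP bk /rowP E.
have -> : m' = p' by have := E k; rewrite !mxE eqxx.
suff -> : a' = b' by [].
apply/rowP => j; have [->|jk] := eqVneq j k; first by rewrite ak bk.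
by have := E j; rewrite !mxE (negbTE jk).
Qed.

Context (U : set 'rV[R]_n) (oU : open U) (U0 : U 0).
Context (f : 'rV[R]_n -> R) (sf : smooth_on U f) (M : nat).

Definition partial_along s al : 'rV[R]_n -> R :=
  partials (flatten [seq nseq (al 0 j) j | j <- s]) f.

Definition zero_seq s x : 'rV[R]_n := \row_j (if j \in s then 0 else x 0 j).

Definition fact_prod al : R := \prod_j ((al 0 j)`!)%:R.

Lemma fact_prod_gt0 al : 0 < fact_prod al.
Proof. by apply: prodr_gt0 => j _; rewrite ltr0n fact_gt0. Qed.

Lemma fact_prod_ge1 al : 1 <= fact_prod al.
Proof.
have E : \prod_(j < n) (1 : R) = 1 by rewrite big1.
rewrite /fact_prod -[leLHS]E.
by apply: ler_prod => j _; rewrite ler01 ler1n fact_gt0.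
Qed.

Lemma norm_zero_seq s x : `|zero_seq s x| <= `|x|.
Proof.
rewrite [leLHS]/Num.Def.normr/= mx_normrE; apply/bigmax_leP; split => //.
case=> i j _ /=; rewrite (ord1 i) mxE; case: ifP => _; first by rewrite normr0.
exact: norm_coord.
Qed.

Lemma monomial_le1 al x : `|x| <= 1 -> `|monomial al x| <= 1.
Proof.
move=> x1; rewrite /monomial normr_prod.
have E : \prod_(j < n) (1 : R) = 1 by rewrite big1.
rewrite -[leRHS]E.
apply: ler_prod => j _; rewrite normr_ge0 /= normrX exprn_ile1 //.
exact: le_trans (norm_coord x j) x1.
Qed.

Lemma taylor_step s k (l : seq 'rV[nat]_n) : k \notin s ->
  (forall al, al \in l -> al 0 k = 0%N) ->
  exists C d : R, [/\ 0 <= C, 0 < d & forall x, `|x| < d ->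
   `|\sum_(al <- l) partial_along s al (zero_seq s x) / fact_prod al * monomial al x -
     \sum_(al <- l) \sum_(m <- iota 0 M)
       partial_along (k :: s) (set_exponent al k m) (zero_seq (k :: s) x)
        / fact_prod (set_exponent al k m) * monomial (set_exponent al k m) x| <= C * `|x 0 k| ^+ M].
Proof.
move=> ks; elim: l => [|al l IH] Hl.
  exists 0, 1; split => // x _; by rewrite !big_nil subrr normr0 mul0r.
have [|C [d [C0 d0 dP]]] := IH; first by move=> b bl; apply: Hl; rewrite inE bl orbT.
have ak : al 0 k = 0%N by apply: Hl; rewrite inE eqxx.
have Ch : Ck U M (partial_along s al) by apply: smooth_on_Ck; exact: smooth_partials.
have [C' [d' [C'0 d'0 d'P]]] := taylor_coord k oU U0 Ch.
exists (C + C'), (Num.min (Num.min d d') 1); split.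
- exact: addr_ge0.
- by rewrite !lt_min d0 d'0 ltr01.
move=> x; rewrite !lt_min => /andP[/andP[xd xd'] x1].
rewrite !big_cons opprD addrACA mulrDl addrC.
apply: le_trans (ler_normD _ _) _; apply: lerD; first exact: dP.
have := d'P (zero_seq s x) (le_lt_trans (norm_zero_seq s x) xd').
have zk : zero_seq s x 0 k = x 0 k by rewrite mxE (negbTE ks).
have shz : shrink k 0 (zero_seq s x) = zero_seq (k :: s) x.
  by apply/rowP => j; rewrite !mxE inE; case: eqP => //= _; rewrite mul0r.
rewrite zk shz => H.
have term m :
  partial_along (k :: s) (set_exponent al k m) (zero_seq (k :: s) x) / fact_prod (set_exponent al k m) *
    monomial (set_exponent al k m) x =
    iter m (partial k) (partial_along s al) (zero_seq (k :: s) x) * x 0 k ^+ m / m`!%:R *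
    (monomial al x / fact_prod al).
  have -> : partial_along (k :: s) (set_exponent al k m) = iter m (partial k) (partial_along s al).
    rewrite /partial_along /= mxE eqxx partials_cat partials_nseq;
      congr (iter _ _ (partials (flatten _) _)).
    apply/eq_in_map => j js; rewrite mxE; case: eqP => // jk.
    by move: ks; rewrite -jk js.
  have -> : fact_prod (set_exponent al k m) = m`!%:R * fact_prod al.
    rewrite /fact_prod (bigD1 k) //= [in RHS](bigD1 k) //= mxE eqxx ak fact0 mul1r.
    congr (_ * _); apply: eq_bigr => j /negbTE jk; by rewrite mxE jk.
  have -> : monomial (set_exponent al k m) x = x 0 k ^+ m * monomial al x.
    rewrite /monomial (bigD1 k) //= [in RHS](bigD1 k) //= mxE eqxx ak expr0 mul1r.
    congr (_ * _); apply: eq_bigr => j /negbTE jk; by rewrite mxE jk.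
  rewrite invfM; ring.
rewrite (eq_bigr _ (fun m _ => term m)) -mulr_suml.
have -> : iota 0 M = index_iota 0 M by rewrite /index_iota subn0.
rewrite big_mkord.
set a := partial_along s al (zero_seq s x) in H *; set B := \sum_(m < M) _ in H *.
have -> : a / fact_prod al * monomial al x - B * (monomial al x / fact_prod al) =
  (a - B) * (monomial al x / fact_prod al) by ring.
rewrite normrM; apply: le_trans H; rewrite ler_piMr //.
rewrite normrM normfV (gtr0_norm (fact_prod_gt0 al)) ler_pdivrMr ?fact_prod_gt0 // mul1r.
by apply: le_trans (fact_prod_ge1 al); apply: monomial_le1; exact: ltW.
Qed.

(** The variables are expanded one after the other, from the end of s to its
    head, so that the partial derivatives appear in exactly the order used by
    [multipartial]. *)
Lemma box_taylor s : uniq s ->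
  exists C d : R, [/\ 0 <= C, 0 < d & forall x, `|x| < d ->
   `|f x - \sum_(al <- box_exponents M s) partial_along s al (zero_seq s x) / fact_prod al
     * monomial al x|
     <= C * \sum_(j <- s) `|x 0 j| ^+ M].
Proof.
elim: s => [|k s IH] /=.
  move=> _; exists 0, 1; split => // x _.
  have -> : zero_seq [::] x = x by apply/rowP => j; rewrite mxE.
  rewrite big_seq1; have -> : fact_prod (const_mx 0%N) = 1.
    by rewrite /fact_prod big1 // => j _; rewrite mxE fact0.
  rewrite divr1 /monomial big1 => [|j _]; last by rewrite mxE expr0.
  by rewrite mulr1 subrr normr0 mul0r.
move=> /andP[ks us]; have [C [d [C0 d0 dP]]] := IH us.
have Hl al : al \in box_exponents M s -> al 0 k = 0%N.
  by rewrite mem_box_exponents // => /forallP/(_ k); rewrite (negbTE ks) => /eqP.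
have [C' [d' [C'0 d'0 d'P]]] := taylor_step ks Hl.
exists (C + C'), (Num.min d d'); split; [exact: addr_ge0|by rewrite lt_min d0|].
move=> x; rewrite lt_min => /andP[xd xd'].
have h1 := dP x xd; have h2 := d'P x xd'.
rewrite big_allpairs_dep /=; rewrite big_cons.
move: h1 h2; set b := \sum_(al <- box_exponents M s) _; set a := \sum_(al <- box_exponents M s) _.
set sx := \sum_(j <- s) _ => h1 h2.
have -> : f x - b = (f x - a) + (a - b) by ring.
apply: le_trans (ler_normD _ _) _; apply: le_trans (lerD h1 h2) _.
have sx0 : 0 <= sx by apply: sumr_ge0 => j _; rewrite exprn_ge0.
have xk0 : 0 <= `|x 0 k| ^+ M by rewrite exprn_ge0.
rewrite mulrDl !mulrDr; have := mulr_ge0 C0 xk0; have := mulr_ge0 C'0 sx0; lra.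
Qed.

Lemma taylor_bound :
  exists C d : R, [/\ 0 <= C, 0 < d & forall x, `|x| < d ->
   `|f x - \sum_(al <- box_exponents M (enum 'I_n)) taylor_coef f al * monomial al x|
     <= C * \sum_j `|x 0 j| ^+ M].
Proof.
have [C [d [C0 d0 dP]]] := box_taylor (enum_uniq 'I_n).
exists C, d; split => // x /dP.
have -> : zero_seq (enum 'I_n) x = 0 by apply/rowP => j; rewrite !mxE mem_enum.
by rewrite big_enum.
Qed.

End taylor.

(** * Minima of linear forms on the Newton polyhedron *)

Section newton_polyhedron.
Context {R : realType} {n : nat}.
Implicit Types (f : 'rV[R]_n -> R) (a x y : 'rV[R]_n) (al : 'rV[nat]_n) (m : R).

Lemma dotp_ge0 a y : nonneg a -> nonneg y -> 0 <= dotp a y.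
Proof. by move=> a0 y0; apply: sumr_ge0 => j _; rewrite mulr_ge0. Qed.

Lemma convex_setP (K : set 'rV[R]_n) :
  (forall x y (t : R), K x -> K y -> 0 < t < 1 -> K (t *: x + (1 - t) *: y)) ->
  convex_set (K : set (convex_lmodType 'rV[R]_n)).
Proof.
move=> H; apply/convex_setW => x y /set_mem Kx /set_mem Ky t t0 t1.
by apply/mem_set; apply: H => //; rewrite t0 t1.
Qed.

Lemma convex_set_conv (K : set 'rV[R]_n) x y (t : R) :
  convex_set (K : set (convex_lmodType 'rV[R]_n)) -> K x -> K y -> 0 <= t <= 1 ->
  K (t *: x + (1 - t) *: y).
Proof.
move=> cK Kx Ky /andP[t0 t1]; apply/set_mem.
have := cK x y (Itv01 t0 t1) (mem_set Kx) (mem_set Ky).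
by [].
Qed.

Definition supp f al := taylor_coef f al != 0.

Lemma newton_supp f al y : supp f al -> nonneg y -> newton f (embed al + y).
Proof.
move=> sal y0; apply: sub_gen_smallest; exists al => //.
by exists y.
Qed.

Lemma newton_embed f al : supp f al -> newton f (embed al).
Proof.
move=> sal; rewrite -[embed al]addr0; apply: newton_supp => // j.
by rewrite mxE.
Qed.

(** The induction principle of the convex hull: a convex set containing all
    the shifted orthants contains the polyhedron. *)
Lemma newton_min f (K : set 'rV[R]_n) :
  (forall x y (t : R), K x -> K y -> 0 < t < 1 -> K (t *: x + (1 - t) *: y)) ->
  (forall al y, supp f al -> nonneg y -> K (embed al + y)) ->
  newton f `<=` K.
Proof.
move=> cK HK; apply: smallest_sub; first exact: convex_setP.
by move=> _ [al sal [y y0 <-]]; exact: HK.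
Qed.

Lemma newton_halfspace f a m : nonneg a ->
  (forall al, supp f al -> m <= dotp a (embed al)) -> newton f `<=` halfspace a m.
Proof.
move=> a0 H; apply: newton_min.
  move=> x y t; rewrite /halfspace /= => mx my /andP[t0 t1].
  rewrite dotpD !dotpZ.
  have -> : m = t * m + (1 - t) * m by ring.
  by apply: lerD; apply: ler_wpM2l => //; [exact: ltW|rewrite subr_ge0 ltW].
move=> al y sal y0; rewrite /halfspace /= dotpD.
by apply: (le_trans (H _ sal)); rewrite lerDl dotp_ge0.
Qed.

Lemma supp_nonempty f : newton f !=set0 -> exists al, supp f al.
Proof.
move=> [x Nx]; apply: contrapT => /forallNP H.
have : newton f `<=` set0 by apply: newton_min => // al y /H.
by move=> /(_ x Nx).
Qed.

(** The coordinates al_j with a_j = 0 do not influence <a, al>, and the others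
    are bounded on a sublevel set; so the values below a given one are attained
    on a finite box of exponents. *)
Lemma supp_min f a : newton f !=set0 -> nonneg a ->
  exists2 al, supp f al & forall be, supp f be -> dotp a (embed al) <= dotp a (embed be).
Proof.
move=> /supp_nonempty[al0 sal0] a0.
pose m0 := dotp a (embed al0).
have [K KP] : exists K : nat, forall j, 0 < a 0 j -> m0 / a 0 j < K%:R.
  have H j : exists K : nat, 0 < a 0 j -> m0 / a 0 j < K%:R.
    exists (Num.bound `|m0 / a 0 j|) => _; apply: le_lt_trans (ler_norm _) _.
    by apply: archi_boundP.
  have [g Hg] := choice H.
  exists (\max_j g j)%N => j aj; apply: lt_le_trans (Hg j aj) _.
  by rewrite ler_nat; exact: (leq_bigmax j).
(* exponents truncated at the coordinates where a vanishes *)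
pose val (phi : {ffun 'I_n -> 'I_K.+1}) : R := \sum_j a 0 j * (phi j : nat)%:R.
pose good (phi : {ffun 'I_n -> 'I_K.+1}) : bool :=
  `[< exists2 be, supp f be & dotp a (embed be) = val phi >].
have trunc be : supp f be -> dotp a (embed be) <= m0 ->
    exists2 phi, good phi & val phi = dotp a (embed be).
  move=> sbe be0.
  pose phi : {ffun 'I_n -> 'I_K.+1} := [ffun j => if 0 < a 0 j then inord (be 0 j) else ord0].
  have E : val phi = dotp a (embed be).
    apply: eq_bigr => j _; rewrite !mxE ffunE; case: ifPn => [aj|].
      rewrite inordK // ltnS -(ler_nat R); apply: ltW; apply: le_lt_trans (KP j aj).
      rewrite ler_pdivlMr // mulrC; apply: le_trans be0.
      rewrite /dotp (bigD1 j) //= !mxE lerDl; apply: sumr_ge0 => i _.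
      by rewrite mulr_ge0 // mxE.
    rewrite -leNgt => aj; have aj0 : a 0 j = 0 by apply/le_anti; rewrite aj a0.
    by rewrite aj0 !mul0r.
  by exists phi => //; apply/asboolP; exists be.
have [phi0 g0 _] := trunc al0 sal0 (lexx _).
case: (@arg_minP _ _ _ phi0 good val g0) => phi /asboolP[al sal alE] min.
exists al => // be sbe.
have [bm|/ltW mb] := leP (dotp a (embed be)) m0.
  by have [psi gp <-] := trunc be sbe bm; rewrite alE; exact: min.
have [psi gp pE] := trunc al0 sal0 (lexx _).
by rewrite alE; apply: le_trans (min _ gp) _; rewrite pE.
Qed.

Lemma minimum_eq (S : set R) m : S m -> lbound S m -> minimum S = m.
Proof.
move=> Sm lm; rewrite /minimum.
have [m' [Sm' lm']] : exists m', [set m | S m /\ lbound S m] m' by exists m.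
case: xgetP => [u _ [Su lu]|]; last by move=> /(_ m); case.
by apply/le_anti; rewrite lu //= lm.
Qed.

Lemma maximum_eq (S : set R) m : S m -> ubound S m -> maximum S = m.
Proof.
move=> Sm um; rewrite /maximum.
case: xgetP => [u _ [Su uu]|]; last by move=> /(_ m); case.
by apply/le_anti; rewrite uu //= um.
Qed.

Lemma lmin_supp f a al : nonneg a -> supp f al ->
  (forall be, supp f be -> dotp a (embed al) <= dotp a (embed be)) ->
  lmin f a = dotp a (embed al).
Proof.
move=> a0 sal H; apply: minimum_eq; first by exists (embed al) => //; exact: newton_embed.
by move=> _ [x Nx <-]; exact: (newton_halfspace a0 H).
Qed.

(** Every a' in the class of a0 has the same face as a0, so an exponent of
    the support minimizing <a0, .> minimizes <a', .> as well; this is a closed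
    condition on a'. *)
Lemma Sigma0_vertex f tau : newton f !=set0 -> Sigma0 f tau ->
  exists2 al, supp f al & forall a, tau a ->
    forall be, supp f be -> dotp a (embed al) <= dotp a (embed be).
Proof.
move=> N0 [a0 a0p <-]; have [al sal alm] := supp_min N0 a0p.
exists al => // a ca be sbe.
have gal : gface f a0 (embed al).
  by split; [exact: newton_embed|rewrite (lmin_supp a0p sal alm)].
have cl : closed [set x : 'rV[R]_n | dotp x (embed al) <= dotp x (embed be)].
  have -> : [set x : 'rV[R]_n | dotp x (embed al) <= dotp x (embed be)] =
     dotpr (embed al - embed be) @^-1` [set t | t <= 0].
    apply/seteqP; split => x /=;
      rewrite /dotpr dotpD -[- embed be]scaleN1r dotpZ mulN1r subr_le0 //.
  apply: closed_comp; last exact: closed_le.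
  by move=> x _; exact: dotpr_continuous.
suff sub : gface_class f a0 `<=` [set x | dotp x (embed al) <= dotp x (embed be)].
  have := closure_subset sub ca; by rewrite -((closure_id _).1 cl).
move=> x [x0 xg]; have [ga gs gm] := supp_min N0 x0.
have [_ /= E] : gface f x (embed al) by rewrite xg.
by rewrite /= E (lmin_supp x0 gs gm); exact: gm.
Qed.

End newton_polyhedron.

(** * Compact faces and their polynomials *)

Section faces.
Context {R : realType} {n : nat}.
Implicit Types (x y : 'rV[R]_n) (a al be : 'rV[nat]_n) (t : R).

Definition ndot a al : nat := (\sum_j a 0%R j * al 0%R j)%N.

Lemma dotp_embed a al : dotp (embed a) (embed al) = (ndot a al)%:R :> R.
Proof. by rewrite /dotp /ndot natr_sum; apply: eq_bigr => j _; rewrite !mxE natrM. Qed.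

Lemma embed_nonneg a : nonneg (embed a : 'rV[R]_n).
Proof. by move=> j; rewrite mxE. Qed.

(** The weights need not sum to one; scaling the combination by their
    sum lets the induction go through, including when they all vanish. *)
Lemma convex_comb (K : set 'rV[R]_n) (I : Type) (r : seq I) (c : I -> R)
    (p : I -> 'rV[R]_n) (p0 : 'rV[R]_n) :
  (forall x y t, K x -> K y -> 0 < t < 1 -> K (t *: x + (1 - t) *: y)) ->
  K p0 -> (forall i, 0 <= c i) -> (forall i, K (p i)) ->
  exists2 q, K q & \sum_(i <- r) c i *: p i = (\sum_(i <- r) c i) *: q.
Proof.
move=> cK K0 c0 Kp; elim: r => [|i r [q Kq E]].
  by exists p0 => //; rewrite !big_nil scale0r.
rewrite !big_cons E; set s := \sum_(i <- r) c i.
have s0 : 0 <= s by exact: sumr_ge0.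
have [ci|ci] := eqVneq (c i) 0; first by exists q => //; rewrite ci scale0r !add0r.
have [sz|sz] := eqVneq s 0; first by exists (p i) => //; rewrite sz scale0r !addr0.
have cip : 0 < c i by rewrite lt_neqAle eq_sym ci c0.
have sp : 0 < s by rewrite lt_neqAle eq_sym sz s0.
have csp : 0 < c i + s by exact: addr_gt0.
exists ((c i / (c i + s)) *: p i + (1 - c i / (c i + s)) *: q).
  apply: cK => //; rewrite divr_gt0 //= ltr_pdivrMr // mul1r ltrDl //.
rewrite scalerDr !scalerA; congr (_ *: _ + _ *: _); field; exact: lt0r_neq0.
Qed.

Context (f : 'rV[R]_n -> R) (U : set 'rV[R]_n) (oU : open U) (U0 : U 0).
Context (sf : smooth_on U f).
Context (a : 'rV[nat]_n) (al0 : 'rV[nat]_n) (sal0 : supp f al0).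
Hypothesis al0_min : forall be, supp f be -> (ndot a al0 <= ndot a be)%N.
Let la := ndot a al0.
Definition newton_face : set 'rV[R]_n := newton f `&` hyperplane (embed a) (ndot a al0)%:R.

Lemma newton_face_defined : defines_face f (embed a) la%:R newton_face.
Proof.
split=> //.
- apply: newton_halfspace; first exact: embed_nonneg.
  by move=> be /al0_min; rewrite dotp_embed ler_nat.
- by exists (embed al0); split; [exact: newton_embed|rewrite /hyperplane /= dotp_embed].
Qed.

Lemma newton_face_face : face f newton_face.
Proof. by exists (embed a), la%:R; exact: newton_face_defined. Qed.

Definition bounded_order x := exists C : R, \forall t \near (0 : R)^'+,
  `|f (\row_j (t ^+ a 0 j * x 0 j))| <= C * t ^+ la.

Lemma KN_bounded : KN_condition f -> \forall x \near (0 : 'rV[R]_n), bounded_order x.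
Proof.
move=> /(_ _ _ _ newton_face_face newton_face_defined); apply: filterS => x /cvg_ex[/= c cx].
exists (`|c| + 1).
have nb : \forall t \near (0 : R)^'+,
    `|f (\row_j (t `^ (embed a : 'rV[R]_n) 0 j * x 0 j)) / t `^ la%:R| < `|c| + 1.
  by have := cvgr_lt _ (cvg_norm cx); apply; rewrite ltrDl.
near=> t.
have t0 : 0 < t by near: t; exact: nbhs_right_gt.
have : `|f (\row_j (t `^ (embed a : 'rV[R]_n) 0 j * x 0 j)) / t `^ la%:R| < `|c| + 1.
  by near: t.
have -> : \row_j (t `^ (embed a : 'rV[R]_n) 0 j * x 0 j) = \row_j (t ^+ a 0 j * x 0 j).
  by apply/rowP => j; rewrite !mxE powR_mulrn // ltW.
rewrite powR_mulrn ?(ltW t0) // normrM normfV (gtr0_norm (exprn_gt0 _ t0)).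
by rewrite ltr_pdivrMr ?exprn_gt0 // => /ltW.
Unshelve. all: by end_near. Qed.

Hypothesis a_pos : forall j, (0 < a 0%R j)%N.

Let r := [seq al <- box_exponents la.+1 (enum 'I_n) | ndot a al == la].

Lemma mem_face_exponents al : (al \in r) = (ndot a al == la).
Proof.
rewrite mem_filter; case: eqP => //= E.
rewrite mem_box_exponents ?enum_uniq //; apply/forallP => j; rewrite mem_enum /= ltnS -E.
rewrite /ndot (bigD1 j) //=; apply: leq_trans (leq_addr _ _).
by rewrite leq_pmull.
Qed.

Lemma newton_face_supp al : supp f al -> newton_face (embed al) <-> ndot a al = la.
Proof.
move=> sal; split=> [[_]|E].
  by rewrite /hyperplane /= dotp_embed => /eqP; rewrite eqr_nat => /eqP.
by split; [exact: newton_embed|rewrite /hyperplane /= dotp_embed E].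
Qed.

Lemma face_partE x :
  face_part f newton_face x = \sum_(al <- r) taylor_coef f al * monomial al x.
Proof.
rewrite /face_part (fsbig_fwiden r) //.
- move=> al /= [_]; rewrite /hyperplane /= dotp_embed => /eqP.
  by rewrite eqr_nat mem_face_exponents.
- by rewrite filter_uniq // box_exponents_uniq // enum_uniq.
- move=> al /= [alr nal]; rewrite mem_face_exponents in alr.
  have [->|sal] := eqVneq (taylor_coef f al) 0; first by rewrite mul0r.
  by case: nal; apply/newton_face_supp => //; exact/eqP.
Qed.

Lemma Ck_face_part m : Ck setT m (face_part f newton_face).
Proof.
have oT : open [set: 'rV[R]_n] by exact: openT.
apply: (Ck_ext oT (f := fun x => \sum_(al <- r) taylor_coef f al * monomial al x)).
  by move=> x _; rewrite face_partE.
apply: (Ck_sum oT) => al _; apply: (Ck_mul oT); first exact: Ck_cst.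
exact: (Ck_monom m (fun j => al 0 j) oT).
Qed.

(** By Euler's relation only the monomials containing x_j contribute to the
    derivative at a point with nonzero coordinates. *)
Lemma partial_face_part j x : (forall i, x 0 i != 0) ->
  partial j (face_part f newton_face) x != 0 ->
  exists al, [/\ supp f al, ndot a al = la & (0 < al 0%R j)%N].
Proof.
move=> x0 H.
have oT : open [set: 'rV[R]_n] by exact: openT.
have claim (s : seq 'rV[nat]_n) :
    partial j (fun x => \sum_(al <- s) taylor_coef f al * monomial al x) x != 0 ->
    exists2 al, al \in s & supp f al && (0 < al 0%R j)%N.
  elim: s => [|be s IH].
    rewrite (partial_ext oT j (g := fun=> 0)) //; last by move=> z _; rewrite big_nil.
    by rewrite /partial derive_cst eqxx.
  rewrite (partial_ext oT j (g := fun z => taylor_coef f be * monomial be z +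
      \sum_(al <- s) taylor_coef f al * monomial al z)) //; last first.
    by move=> z _; rewrite big_cons.
  have Cm al : Ck setT 1 (fun z => taylor_coef f al * monomial al z).
    by apply: (Ck_mul oT); [exact: Ck_cst|exact: (Ck_monom 1 (fun j => al 0 j) oT)].
  have Cs : Ck setT 1 (fun z => \sum_(al <- s) taylor_coef f al * monomial al z).
    by apply: (Ck_sum oT) => al _; exact: Cm.
  have Dm := Ck_der (j := j) (Cm be) (I : setT x).
  have Ds := Ck_der (j := j) Cs (I : setT x).
  have -> : partial j (fun z => taylor_coef f be * monomial be z +
      \sum_(al <- s) taylor_coef f al * monomial al z) x =
    partial j (fun z => taylor_coef f be * monomial be z) x +
    partial j (fun z => \sum_(al <- s) taylor_coef f al * monomial al z) x.
    exact: (deriveD Dm Ds).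
  have [h _|h] := boolP (supp f be && (0 < be 0%R j)%N).
    by exists be => //; rewrite inE eqxx.
  have -> : partial j (fun z => taylor_coef f be * monomial be z) x = 0.
    rewrite partialM; last 2 first.
    - exact: Ck_der (Ck_cst oT 1 _) _.
    - exact: Ck_der (Ck_monom 1 (fun j => be 0 j) oT) _.
    rewrite {2}/partial derive_cst mulr0 addr0.
    move: h; rewrite negb_and negbK => /orP[/eqP ->|]; first by rewrite mul0r.
    rewrite -eqn0Ngt => /eqP bj.
    have := monom_euler (fun j => be 0 j) j x; rewrite bj mul0r => /eqP.
    by rewrite mulf_eq0 (negbTE (x0 j)) /= => /eqP E; rewrite E mulr0.
  rewrite add0r => /IH[al als ha]; exists al => //; by rewrite inE als orbT.
have [|al alr /andP[sal aj]] := claim r.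
  rewrite -(partial_ext oT j (f := face_part f newton_face)) // => z _; exact: face_partE.
by exists al; split => //; move: alr; rewrite mem_face_exponents => /eqP.
Qed.

(** Along t^a x the monomial of exponent al has order <a, al>, which is at
    least la on the support with equality on the face, while the Taylor
    remainder over the box of side la + 1 has order at least la + 1 since every
    a_j is positive. *)
Lemma face_limit x :
  f (\row_j (t ^+ a 0 j * x 0 j)) / t ^+ la @[t --> (0 : R)^'+] -->
  face_part f newton_face x.
Proof.
have [C [d [C0 d0 dP]]] := taylor_bound oU U0 sf la.+1.
set l0 := box_exponents la.+1 (enum 'I_n) in dP.
pose xi t : 'rV[R]_n := \row_j (t ^+ a 0 j * x 0 j).
have monxi al t : monomial al (xi t) = t ^+ ndot a al * monomial al x.
  rewrite /monomial /ndot -prodrXr -big_split /=; apply: eq_bigr => j _.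
  by rewrite mxE exprMn exprM.
pose P t := \sum_(al <- l0) taylor_coef f al * (t ^+ ndot a al / t ^+ la * monomial al x).
have cP : P t @[t --> (0 : R)^'+] --> face_part f newton_face x.
  rewrite face_partE big_filter big_mkcond /=.
  apply: cvg_sumr => al _.
  have [sal|sal] := eqVneq (taylor_coef f al) 0.
    rewrite sal mul0r if_same; under eq_cvg do rewrite mul0r; exact: cvg_cst.
  have lal : (la <= ndot a al)%N by exact: al0_min.
  have -> : (if ndot a al == la then taylor_coef f al * monomial al x else 0) =
    taylor_coef f al * ((0 : R) ^+ (ndot a al - la) * monomial al x).
    case: eqP => [->|/eqP ne]; first by rewrite subnn expr0 mul1r.
    by rewrite expr0n subn_eq0 leqNgt ltn_neqAle eq_sym ne lal /= mul0r mulr0.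
  apply: cvgMl_tmp; apply: cvgMr_tmp.
  have c1 : t ^+ (ndot a al - la) @[t --> (0 : R)^'+] --> (0 : R) ^+ (ndot a al - la).
    by apply: cvg_at_right_filter; exact: exprn_continuous.
  apply: cvg_trans c1; apply: near_eq_cvg; near=> t.
  have t0 : t != 0 by rewrite gt_eqF //; near: t; exact: nbhs_right_gt.
  by rewrite -{2}(subnK lal) exprD mulfK // expf_neq0.
pose K := C * \sum_j `|x 0 j| ^+ la.+1.
have cxi : xi t @[t --> (0 : R)^'+] --> (0 : 'rV[R]_n).
  apply: cvg_rV => j; rewrite mxE; under eq_cvg do rewrite mxE.
  have E : (0 : R) ^+ a 0 j * x 0 j = 0 by rewrite expr0n gtn_eqF ?a_pos // mul0r.
  have c1 : t ^+ a 0 j * x 0 j @[t --> (0 : R)^'+] --> (0 : R) ^+ a 0 j * x 0 j.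
    by apply: cvgMr_tmp; apply: cvg_at_right_filter; exact: exprn_continuous.
  by move: c1; rewrite E.
have nxi : \forall t \near (0 : R)^'+, `|xi t| < d.
  by have := cvgr_lt _ (cvg_norm cxi); apply; rewrite normr0.
have cE : f (xi t) / t ^+ la - P t @[t --> (0 : R)^'+] --> (0 : R).
  apply: norm_cvg0; apply: (@squeeze_cvgr _ _ _ _ (fun=> 0) (fun t => K * t)).
  - near=> t; rewrite normr_ge0 /=.
    have t0 : 0 < t by near: t; exact: nbhs_right_gt.
    have t1 : t <= 1 by near: t; exact: nbhs_right_le.
    have td : `|xi t| < d by near: t.
    have -> : P t = (\sum_(al <- l0) taylor_coef f al * monomial al (xi t)) / t ^+ la.
      rewrite mulr_suml; apply: eq_bigr => al _; rewrite monxi; ring.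
    rewrite -mulrBl normrM normfV (gtr0_norm (exprn_gt0 _ t0)) ler_pdivrMr ?exprn_gt0 //.
    apply: le_trans (dP _ td) _; rewrite /K -!mulrA; apply: ler_wpM2l => //.
    rewrite mulr_suml; apply: ler_sum => j _.
    rewrite mxE normrM exprMn mulrC; apply: ler_wpM2l; first by rewrite exprn_ge0.
    rewrite -exprS lerXn2r ?nnegrE ?(ltW t0) // normrX (gtr0_norm t0).
    by rewrite -[leRHS]expr1 ler_wiXn2l // ltW.
  - exact: cvg_cst.
  - have c1 : K * t @[t --> (0 : R)^'+] --> K * 0.
      by apply: cvgMl_tmp; apply: cvg_at_right_filter => B nB.
    by move: c1; rewrite mulr0.
have := cvgD cE cP; rewrite add0r => H.
have EE : (fun t => f (xi t) / t ^+ la) = ((fun t => f (xi t) / t ^+ la - P t) + P)%R.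
  by apply/funext => t /=; rewrite subrK.
move: H; rewrite -EE; exact.
Unshelve. all: by end_near. Qed.

Lemma newton_face_convex x y t : newton_face x -> newton_face y -> 0 < t < 1 ->
  newton_face (t *: x + (1 - t) *: y).
Proof.
move=> [Nx hx] [Ny hy] /andP[t0 t1]; split.
  move=> K [cK GK]; apply: convex_set_conv cK (Nx K (conj cK GK)) (Ny K (conj cK GK)) _.
  by rewrite !ltW.
move: hx hy; rewrite /hyperplane /= dotpD !dotpZ => -> ->; ring.
Qed.

(** The face is the convex hull of the finitely many exponents of the support
    on it, hence the image of a simplex under a linear map. For the nontrivial
    inclusion, the points on or above the supporting hyperplane that belong to
    this hull if they are on the hyperplane form a convex set W; it contains
    all al + y, because a has positive coordinates and <a, y> = 0 forces y = 0. *)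
Lemma newton_face_compact : compact newton_face.
Proof.
pose r1 := [seq al <- r | supp f al]; pose N := size r1.
have r1P i : (i < N)%N -> supp f (nth al0 r1 i) /\ ndot a (nth al0 r1 i) = la.
  move=> iN; have := mem_nth al0 iN; rewrite mem_filter mem_face_exponents => /andP[? /eqP ?].
  by split.
pose p (i : 'I_N) : 'rV[R]_n := embed (nth al0 r1 i).
have np i : newton_face (p i).
  by have [s1 s2] := r1P i (ltn_ord i); apply/newton_face_supp.
pose Lam (c : 'rV[R]_N) : 'rV[R]_n := \sum_i c 0 i *: p i.
pose Delta := [set c : 'rV[R]_N | (forall i, 0 <= c 0 i) /\ \sum_i c 0 i = 1].
have faceE : newton_face = Lam @` Delta.
  apply/seteqP; split; last first.
    move=> _ [c [c0 c1] <-]; have n0 : newton_face (embed al0) by apply/newton_face_supp.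
    have [q nq] := convex_comb (index_enum _) newton_face_convex n0 c0 np.
    by rewrite /Lam => ->; rewrite c1 scale1r.
  pose W := [set x | la%:R <= dotp (embed a) x /\
                     (dotp (embed a) x = la%:R -> (Lam @` Delta) x)].
  have NW : newton f `<=` W.
    apply: newton_min => [x y t [x1 x2] [y1 y2] /andP[t0 t1]|al y sal y0].
      have s0 : 0 < 1 - t by rewrite subr_gt0.
      split; rewrite dotpD !dotpZ.
        have -> : la%:R = t * la%:R + (1 - t) * la%:R :> R by ring.
        by apply: lerD; rewrite ler_pM2l.
      move=> E.
      have u1 : 0 <= t * (dotp (embed a) x - la%:R) by rewrite mulr_ge0 ?subr_ge0 // ltW.
      have u2 : 0 <= (1 - t) * (dotp (embed a) y - la%:R) by rewrite mulr_ge0 ?subr_ge0 // ltW.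
      have u3 : t * (dotp (embed a) x - la%:R) + (1 - t) * (dotp (embed a) y - la%:R) = 0.
        by rewrite !mulrBr addrACA E; ring.
      have /eqP := u3; rewrite paddr_eq0 // !mulf_eq0 !subr_eq0 (gt_eqF t0) /=.
      have -> : (1 == t) = false by rewrite gt_eqF.
      move=> /andP[/eqP ex /eqP ey].
      have [c [c0 c1] <-] := x2 ex; have [c' [c'0 c'1] <-] := y2 ey.
      exists (t *: c + (1 - t) *: c'); first split.
      - by move=> i; rewrite !mxE addr_ge0 // mulr_ge0 // ltW.
      - under eq_bigr do rewrite !mxE.
        by rewrite big_split /= -!mulr_sumr c1 c'1 !mulr1 addrC subrK.
      - rewrite /Lam !scaler_sumr -big_split /=; apply: eq_bigr => i _.
        by rewrite !scalerA -scalerDl; congr (_ *: _); rewrite !mxE.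
    have ya : 0 <= dotp (embed a) y by apply: dotp_ge0 => //; exact: embed_nonneg.
    have sa := al0_min sal.
    split; rewrite dotpD dotp_embed.
      by apply: (@le_trans _ _ (ndot a al)%:R); [rewrite ler_nat|rewrite lerDl].
    move=> E; have E1 : ndot a al = la.
      apply/eqP; rewrite eqn_leq sa andbT -(ler_nat R) -E lerDl //.
    have y00 : y = 0.
      have /eqP : dotp (embed a) y = 0 by move: E; rewrite E1 => /(canRL (addKr _)) ->;
        rewrite addNr.
      rewrite psumr_eq0; last by move=> j _; rewrite mulr_ge0 // mxE.
      move=> /allP H; apply/rowP => j; have := H j (mem_index_enum _).
      by rewrite !mxE mulf_eq0 pnatr_eq0 gtn_eqF ?a_pos //= => /eqP.
    have alr : al \in r1 by rewrite mem_filter sal mem_face_exponents E1 eqxx.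
    have iN : (index al r1 < N)%N by rewrite index_mem.
    exists ('e_(Ordinal iN)); first split.
    - by move=> i; rewrite mxE; case: (_ && _).
    - rewrite (bigD1 (Ordinal iN)) //= mxE !eqxx big1 ?addr0 // => i /negbTE ni.
      by rewrite mxE ni andbF.
    - rewrite /Lam (bigD1 (Ordinal iN)) //= mxE !eqxx scale1r big1 => [|i /negbTE ni].
        by rewrite addr0 y00 addr0 /p /= nth_index.
      by rewrite mxE ni andbF scale0r.
  move=> x [/NW[_ h] hx]; exact: h.
rewrite faceE; apply: continuous_compact.
  apply: continuous_subspaceT => c; apply: (@cvg_rV _ _ _ (nbhs c)) => j.
  have E z : Lam z 0 j = \sum_i z 0 i * p i 0 j.
    by rewrite /Lam summxE; apply: eq_bigr => i _; rewrite mxE.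
  rewrite E; under eq_cvg do rewrite E.
  by apply: (@cvg_sumr _ _ (nbhs c)) => i _; apply: cvgMr_tmp; exact: coord_continuous.
apply: bounded_closed_compact.
  exists 1; split => // M M1 c [c0 c1] /=.
  rewrite [leLHS]/Num.Def.normr/= mx_normrE; apply/bigmax_leP; split.
    by apply: ltW; apply: lt_trans M1.
  case=> i j _ /=; rewrite (ord1 i) ger0_norm //; apply: ltW; apply: le_lt_trans M1.
  by rewrite -c1 (bigD1 j) //= lerDl sumr_ge0.
have -> : Delta = \bigcap_(i in [set: 'I_N]) [set c : 'rV[R]_N | 0 <= c 0 i] `&`
   [set c : 'rV[R]_N | \sum_i c 0 i = 1].
  by apply/seteqP; split => c /= [h1 h2]; split => // i; [move=> _|]; exact: h1.
apply: closedI.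
  apply: closed_bigI => i _.
  apply: (@closed_comp _ _ (fun c : 'rV[R]_N => c 0 i) [set u | 0 <= u]).
    by move=> c _; exact: coord_continuous.
  exact: closed_ge.
apply: (@closed_comp _ _ (fun c : 'rV[R]_N => \sum_i c 0 i) [set u | u = 1]).
  move=> c _; apply: (@cvg_sumr _ _ (nbhs c)) => i _; exact: coord_continuous.
exact: closed_eq.
Qed.

End faces.

(** * Estimates over one simplex of the fan *)

Section simplex_estimates.
Context {R : realType} {n : nat}.
Implicit Types (x y : 'rV[R]_n) (i j k : 'I_n) (t c : R).

Lemma nbhs0_box (Q : set 'rV[R]_n) : (\forall x \near (0 : 'rV[R]_n), Q x) ->
  exists2 e : R, 0 < e & box e `<=` Q.
Proof.
move=> /nbhs_ballP[e /= e0 eQ]; exists e => // x xe; apply: eQ.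
by rewrite -ball_normE /ball_/= sub0r normrN; apply/norm_ltP.
Qed.

Lemma unit_cube_compact : compact [set y : 'rV[R]_n | forall k, 0 <= y 0 k <= 1].
Proof.
have -> : [set y : 'rV[R]_n | forall k, 0 <= y 0 k <= 1] =
  [set y : 'rV[R]_n | forall i, `[(0 : R), 1]%classic (y 0 i)].
  by apply/seteqP; split => y /= H k; have := H k; rewrite in_itv.
exact: (@rV_compact R n (fun=> `[(0 : R), 1]%classic) (fun=> @segment_compact R 0 1)).
Qed.

Definition neg_log x : 'rV[R]_n := \row_j - ln `|x 0 j|.

Context (A : 'M[nat]_n).

(** Near a point of the unit cube that is not over the origin, the image
    stays out of a small box and there is nothing to prove; compactness of the
    cube gives one constant for all points. The same c bounds the box and the
    ratio, which avoids keeping track of two constants. *)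
Lemma local_to_uniform (sg : 'I_n -> R) (lhs rhs : 'rV[R]_n -> R) :
  (forall y, 0 <= lhs y) ->
  (forall y0, (forall k, 0 <= y0 0 k) -> chart A sg y0 = 0 ->
     exists2 c, 0 < c & \forall y \near y0, cube y -> c * lhs y <= rhs y) ->
  \forall c \near (0 : R)^'+, forall y, cube y -> box c (chart A sg y) ->
     c * lhs y <= rhs y.
Proof.
move=> lhs0 loc.
pose P c y := cube y -> box c (chart A sg y) -> c * lhs y <= rhs y.
have /compact_near_coveringP := unit_cube_compact.
move=> /(_ R (0 : R)^'+ P _) nc.
have : \forall c \near (0 : R)^'+,
    [set y : 'rV[R]_n | forall k, 0 <= y 0 k <= 1] `<=` P c.
  apply: nc => y0 /= y0K.
  have y00 k : 0 <= y0 0 k by have /andP[] := y0K k.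
  have [c0|c0] := eqVneq (chart A sg y0) 0.
    have [c cp cP] := loc y0 y00 c0.
    exists ([set y | cube y -> c * lhs y <= rhs y], [set d : R | d <= c]).
      by split => //=; exact: nbhs_right_le.
    move=> [y d] /= [h1 h2] yc _; apply: le_trans (h1 yc).
    by apply: ler_wpM2r.
  have [j cj] : exists j, chart A sg y0 0 j != 0.
    apply: contrapT => /forallNP H; move/eqP: c0; apply; apply/rowP => j.
    by rewrite [RHS]mxE; have := H j; case: eqP.
  have ccj : {for y0, continuous (fun y => chart A sg y 0 j)}.
    exact: (Ck_cont (Ck_chart A sg 0 j openT)).
  have na := near_away ccj cj.
  exists ([set y | `|chart A sg y0 0 j| / 2 <= `|chart A sg y 0 j|],
          [set d : R | d <= `|chart A sg y0 0 j| / 2]).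
    by split => //=; apply: nbhs_right_le; rewrite divr_gt0 // normr_gt0.
  move=> [y d] /= [h1 h2] yc /(_ j); rewrite ltNge => /negP[].
  exact: le_trans h2 h1.
apply: filterS => c H y yc; apply: H => // k /=; have /andP[y0 y1] := yc k.
by rewrite ltW.
Qed.

(** Take y_k = exp(- c_k), where c is the coordinate vector of - ln |x| in
    the cone. *)
Lemma chart_cover x : (forall j, x 0 j != 0) -> cone A (neg_log x) ->
  exists2 y, cube y & chart A (fun j => Num.sg (x 0 j)) y = x.
Proof.
move=> x0 [c c0 cE]; exists (\row_k expR (- c 0 k)).
  by move=> k; rewrite mxE expR_gt0 expR_le1 oppr_le0 c0.
apply/rowP => j; rewrite mxE [RHS]numEsg; congr (_ * _).
have -> : `|x 0 j| = expR (- neg_log x 0 j).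
  by rewrite mxE opprK lnK // posrE normr_gt0.
rewrite -cE mxE -sumrN expR_sum; apply: eq_bigr => k _.
by rewrite !mxE -expRM_natr mulNr.
Qed.

Context (f : 'rV[R]_n -> R) (U : set 'rV[R]_n) (oU : open U) (U0 : U 0).
Context (sf : smooth_on U f).
Context (fnd : newton_nondegenerate f) (fKN : KN_condition f).
Context (Afree : row_free (embed A : 'M[R]_n)).
Context (al0 : 'rV[nat]_n) (sal0 : supp f al0).
Hypothesis al0_min : forall k be, supp f be -> (ndot (row k A) al0 <= ndot (row k A) be)%N.

Let l k : nat := ndot (row k A) al0.

Let Aunit : (embed A : 'M[R]_n) \in unitmx.
Proof. by rewrite -row_free_unit. Qed.

Lemma ndot_sum (I : {set 'I_n}) be :
  ndot (\row_j (\sum_(k in I) A k j)%N) be = (\sum_(k in I) ndot (row k A) be)%N.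
Proof.
rewrite /ndot exchange_big /=; apply: eq_bigr => j _; rewrite mxE big_distrl /=.
by apply: eq_bigr => k _; rewrite mxE.
Qed.

Lemma strict_transform_exists (sg : 'I_n -> R) e : 0 < e ->
  (forall j, `|sg j| = 1) -> box e `<=` U ->
  (forall k x, box e x -> bounded_order f (row k A) al0 x) ->
  exists fs, Ck (chart_dom A sg e) 1 fs /\
    forall y, chart_dom A sg e y -> f (chart A sg y) = monom l y * fs y.
Proof.
move=> e0 sg1 bU bo.
apply: (@chart_division _ _ A sg e U f 1 l oU bU (fun m => smooth_on_Ck m sf)).
move=> y Dy yn0 k; have [C HC] := bo k _ Dy.
exists C; apply: filterS HC => t.
have -> : \row_j (t ^+ (row k A) 0 j * chart A sg y 0 j) = chart A sg (shrink k t y).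
  by apply/rowP => j; rewrite chart_shrink !mxE.
by [].
Qed.

(** The sum a of the generators indexed by the vanishing coordinates of y0
    has positive entries, so it defines a compact face, and nondegeneracy gives
    j such that the derivative of the face polynomial in x_j is nonzero. Then
    some exponent al of the face contains x_j; as <a^k, al> >= l_k for each k,
    with equality after summation over I, one has l_k = <a^k, al> >= a^k_j. *)
Lemma chart_nondegenerate (sg : 'I_n -> R) e fs : 0 < e -> (forall j, `|sg j| = 1) ->
  Ck (chart_dom A sg e) 1 fs ->
  (forall y, chart_dom A sg e y -> f (chart A sg y) = monom l y * fs y) ->
  forall y0, (forall k, 0 <= y0 0 k) -> chart A sg y0 = 0 ->
  exists j, euler_coef A l fs j y0 != 0 /\ forall k, y0 0 k = 0 -> (A k j <= l k)%N.
Proof.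
move=> e0 sg1 Cfs fE y0 y00 c0.
pose I : {set 'I_n} := finset (fun k => y0 0 k == 0); pose a : 'rV[nat]_n :=
  \row_j (\sum_(k in I) A k j)%N.
have amin be : supp f be -> (ndot a al0 <= ndot a be)%N.
  by move=> sbe; rewrite /a !ndot_sum; apply: leq_sum => k _; exact: al0_min.
have Icov j : exists2 k, k \in I & (0 < A k j)%N.
  by have [k yk Ak] := chart0_coord sg1 j c0; exists k => //; rewrite inE yk.
have apos j : (0 < a 0%R j)%N.
  by have [k kI Ak] := Icov j; rewrite mxE (bigD1 k) //= addn_gt0 Ak.
pose gam := newton_face f a al0.
have gc : compact gam by exact: newton_face_compact.
have gf : face f gam by exact: newton_face_face.
have Cfg m : Ck setT m (face_part f gam) by exact: Ck_face_part.
have lim x : f (\row_j (t ^+ (\sum_(k in I) A k j) * x 0 j)) / t ^+ (\sum_(k in I) l k)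
     @[t --> (0 : R)^'+] --> face_part f gam x.
  have := face_limit oU U0 sf amin apos (x := x).
  rewrite {2}/a ndot_sum.
  have -> // : (fun t => f (\row_j (t ^+ a 0 j * x 0 j)) /
    t ^+ (\sum_(k in I) ndot (row k A) al0)) =
    (fun t => f (\row_j (t ^+ (\sum_(k in I) A k j) * x 0 j)) / t ^+ (\sum_(k in I) l k)).
  apply/funext => t; congr (f _ / _).
  by apply/rowP => j; rewrite !mxE.
have yI k : k \in I -> y0 0 k = 0 by rewrite inE => /eqP.
have yN k : k \notin I -> y0 0 k != 0 by rewrite inE.
have [x0 x0n H] := face_euler_coef_neq0 sg1 e0 Cfs fE Aunit Icov Cfg lim yI yN.
have [j Hj] : exists j, partial j (face_part f gam) x0 != 0.
  apply: contrapT => /forallNP nj; apply: (fnd gf gc); exists x0; split => // j.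
  by have := nj j; case: eqP.
exists j; split; first exact: H.
have [al [sal E alj]] := partial_face_part apos x0n Hj.
move=> k yk; have kI : k \in I by rewrite inE yk.
move: E; rewrite /a !ndot_sum => E.
have Ek : ndot (row k A) al = l k.
  apply/eqP; rewrite eq_sym.
  have := leqif_sum (fun i (_ : i \in I) =>
    conj (al0_min i sal) (erefl (ndot (row i A) al0 == ndot (row i A) al))).
  by move=> [_ /esym]; rewrite E eqxx => /forall_inP/(_ k kI).
rewrite -Ek /ndot (bigD1 j) //= mxE; apply: leq_trans (leq_addr _ _).
by rewrite leq_pmulr.
Qed.

Let signs (b : {ffun 'I_n -> bool}) j : R := (-1) ^+ b j.

Lemma norm_signs b j : `|signs b j| = 1.
Proof. by rewrite /signs normr_sign. Qed.

Lemma uniform_cone (lhs rhs : 'rV[R]_n -> R) : (forall x, 0 <= lhs x) ->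
  (forall sg : 'I_n -> R, (forall j, `|sg j| = 1) ->
    forall y0, (forall k, 0 <= y0 0 k) -> chart A sg y0 = 0 ->
     exists2 c, 0 < c & \forall y \near y0, cube y ->
       c * lhs (chart A sg y) <= rhs (chart A sg y)) ->
  \forall c \near (0 : R)^'+, forall x, (forall j, x 0 j != 0) ->
    cone A (neg_log x) -> box c x -> c * lhs x <= rhs x.
Proof.
move=> lhs0 loc.
have : \forall c \near (0 : R)^'+, forall b, forall y, cube y ->
    box c (chart A (signs b) y) ->
     c * lhs (chart A (signs b) y) <= rhs (chart A (signs b) y).
  apply: filter_forall => b.
  apply: (@local_to_uniform (signs b) (fun y => lhs (chart A (signs b) y))
     (fun y => rhs (chart A (signs b) y))) => //.
  exact: loc (norm_signs b).
apply: filterS => c H x x0 cx bx.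
have [y yc yE] := chart_cover x0 cx.
pose b : {ffun 'I_n -> bool} := [ffun j => x 0 j < 0].
have E : chart A (signs b) y = x.
  rewrite -[RHS]yE; apply/rowP => j; rewrite !mxE /signs ffunE; congr (_ * _).
  have [xn|xp] := ltP (x 0 j) 0; first by rewrite expr1 ltr0_sg.
  by rewrite expr0 gtr0_sg // lt_neqAle eq_sym x0.
by have := H b y yc; rewrite E; apply.
Qed.

Lemma chart_setup (Q : set 'rV[R]_n) : (\forall x \near (0 : 'rV[R]_n), Q x) ->
  exists e : R, [/\ 0 < e, box e `<=` U, box e `<=` Q &
     forall k x, box e x -> bounded_order f (row k A) al0 x].
Proof.
move=> nQ.
have nb k : \forall x \near (0 : 'rV[R]_n), bounded_order f (row k A) al0 x.
  by apply: KN_bounded => //; exact: al0_min.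
have nU : \forall x \near (0 : 'rV[R]_n), U x by exact: open_nbhs_nbhs.
have [e e0 eP] := nbhs0_box (filterI nU (filterI nQ (filter_forall _ nb))).
by exists e; split => // [x /eP[]|x /eP[_ []]|k x /eP[_ [_]]].
Qed.

Lemma comparison_ineq_cone (V : set 'rV[R]_n) (g : 'rV[R]_n -> R) (L : nat) :
  open V -> V 0 -> smooth_on V g ->
  (\forall x \near (0 : 'rV[R]_n), f x = 0 -> g x = 0) ->
  (0 < L)%N -> (forall k, (l k <= L)%N) ->
  \forall c \near (0 : R)^'+, forall x, (forall j, x 0 j != 0) ->
    cone A (neg_log x) -> box c x -> c * `|g x| ^+ L <= `|f x|.
Proof.
move=> oV V0 sg fg0 L0 lL.
apply: uniform_cone => [x|s s1 y0 y00 c0]; first by rewrite exprn_ge0.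
have nV : \forall x \near (0 : 'rV[R]_n), V x by exact: open_nbhs_nbhs.
have [e [e0 eU eQ eb]] := chart_setup (filterI nV fg0).
have [fs [Cfs fE]] := strict_transform_exists e0 s1 eU eb.
pose W := U `&` V.
have oW : open W by exact: openI.
have bW : box e `<=` W by move=> x bx; split; [exact: eU|have [] := eQ x bx].
have CfW m : Ck W m f by apply: Ck_sub (smooth_on_Ck m sf) => x [].
have CgW m : Ck W m g by apply: Ck_sub (smooth_on_Ck m sg) => x [].
have fg x : box e x -> f x = 0 -> g x = 0 by move=> /eQ[_]; exact.
exact: (comparison_ineq_local e0 oW bW Cfs fE (chart_nondegenerate e0 s1 Cfs fE) CgW fg L0
  lL y00 c0).
Qed.

Lemma gradient_ineq_cone (N : nat) : (\sum_k l k <= N)%N -> (exists k, (0 < l k)%N) ->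
  \forall c \near (0 : R)^'+, forall x, (forall j, x 0 j != 0) ->
    cone A (neg_log x) -> box c x -> c * `|f x| ^+ N.-1 <= enorm (gradient f x) ^+ N.
Proof.
move=> lN lk.
apply: (uniform_cone (lhs := fun x => `|f x| ^+ N.-1)
   (rhs := fun x => enorm (gradient f x) ^+ N)) => [x|s s1 y0 y00 c0].
  by rewrite exprn_ge0.
have [e [e0 eU _ eb]] := chart_setup filterT.
have [fs [Cfs fE]] := strict_transform_exists e0 s1 eU eb.
have Cf m : Ck U m f by exact: smooth_on_Ck.
exact: (gradient_ineq_local s1 e0 oU eU Cf Cfs fE Aunit (chart_nondegenerate e0 s1 Cfs fE)
  lN lk y00 c0).
Qed.

End simplex_estimates.

(** * Density of the union of the top-dimensional cones *)

Section fan_cover.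
Context {R : realType} {n : nat}.
Implicit Types (x y w u : 'rV[R]_n) (i j k : 'I_n) (t c : R) (sig tau : set 'rV[R]_n).

Lemma finite_argmax (T : choiceType) (X : set T) (F : T -> R) :
  finite_set X -> X !=set0 -> exists2 a, X a & forall b, X b -> F b <= F a.
Proof.
move=> /finite_fsetP[s ->] [z /= zs].
have claim (r : seq T) : r != [::] -> exists2 a, a \in r & forall b, b \in r -> F b <= F a.
  elim: r => // a r IH _; have [->|r0] := eqVneq r [::].
    by exists a => [|z']; rewrite !inE ?eqxx // => /eqP ->.
  have [b br bm] := IH r0; have [ab|ba] := leP (F a) (F b).
    exists b => [|z']; first by rewrite inE br orbT.
    by rewrite inE => /orP[/eqP ->|/bm].
  exists a => [|z']; first by rewrite inE eqxx.
  rewrite inE => /orP[/eqP -> //|/bm h]; exact: le_trans h (ltW ba).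
have [|a as_ H] := claim (enum_fset s); last by exists a.
by apply/eqP => E; move: zs; rewrite -[_ \in s]/(z \in enum_fset s) E.
Qed.

Lemma maximum_finite (T : choiceType) (X : set T) (F : T -> R) :
  finite_set X -> X !=set0 ->
  exists a, [/\ X a, maximum [set F z | z in X] = F a & forall b, X b -> F b <= F a].
Proof.
move=> fX X0; have [a Xa H] := finite_argmax F fX X0.
exists a; split => //; apply: maximum_eq; first by exists a.
by move=> _ [z Xz <-]; exact: H.
Qed.

Lemma near_finite (T : choiceType) (X : set T) (P : T -> R -> Prop) (F : set_system R) :
  Filter F -> finite_set X -> (forall a, X a -> \forall c \near F, P a c) ->
  \forall c \near F, forall a, X a -> P a c.
Proof.
move=> FF /finite_fsetP[s ->] H.
have := @filter_bigI R T s (fun a => [set c | P a c]) F FF.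
move=> /(_ (fun a h => H a h)); apply: filterS => c Hc a /= sa.
exact: Hc.
Qed.

(** Each nonzero linear form is nonzero on an open dense set; the forms are
    treated one by one inside a shrinking neighbourhood. *)
Lemma generic_near (us : seq 'rV[R]_n) w (Q : set 'rV[R]_n) :
  (forall u, u \in us -> u != 0) -> nbhs w Q ->
  exists2 w', Q w' & forall u, u \in us -> dotp u w' != 0.
Proof.
elim: us w Q => [|u us IH] w Q un0 nQ; first by exists w => //; exact: nbhs_singleton.
have u0 : u != 0 by apply: un0; rewrite inE eqxx.
have [w1 [w1Q w1u]] : exists w1, nbhs w1 Q /\ dotp u w1 != 0.
  have [wu|wu] := eqVneq (dotp u w) 0; last by exists w.
  have uu : dotp u u != 0.
    apply/eqP => /eqP; rewrite psumr_eq0; last by move=> j _; rewrite -expr2 sqr_ge0.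
    move=> /allP H; move/eqP: u0; apply; apply/rowP => j.
    by have := H j (mem_index_enum _); rewrite -expr2 sqrf_eq0 mxE => /eqP.
  have n2 : \forall t \near (0 : R)^'+, nbhs (t *: u + w) Q.
    exact: (@cvg_shift_right _ _ w u _ (nbhs_interior nQ)).
  have n3 : \forall t \near (0 : R)^'+, 0 < t by exact: nbhs_right_gt.
  have [t [tQ t0]] := filter_ex (filterI n2 n3).
  by exists (t *: u + w); split => //; rewrite dotpD dotpZ wu addr0 mulf_neq0 // (gt_eqF t0).
have nu : \forall z \near w1, dotp u z != 0.
  have cu : {for w1, continuous (dotpr u)} by exact: dotpr_continuous.
  have w1u' : dotpr u w1 != 0 by rewrite /dotpr dotpC.
  apply: filterS (near_away cu w1u') => z /= h; rewrite dotpC -normr_gt0.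
  by apply: lt_le_trans h; rewrite divr_gt0 // normr_gt0.
have [|w2 [Q2 u2] H2] := IH w1 _ _ (filterI w1Q nu).
  by move=> v vus; apply: un0; rewrite inE vus orbT.
by exists w2 => // v; rewrite inE => /orP[/eqP ->|/H2].
Qed.

Lemma low_cone_hyperplane s (A : 'M[nat]_(s, n)) : (s < n)%N ->
  exists2 u, u != 0 & forall w, cone A w -> dotp u w = 0.
Proof.
move=> sn; pose B : 'M[R]_(n, s) := (embed A)^T.
have : kermx B != 0.
  rewrite -mxrank_eq0 mxrank_ker -lt0n subn_gt0.
  by apply: leq_ltn_trans (rank_leq_col B) sn.
move=> /rowV0Pn[u /sub_kermxP uB u0]; exists u => // w [c c0 <-].
have : (u *m (c *m embed A)^T) 0 0 = 0 by rewrite trmx_mul mulmxA uB mul0mx mxE.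
move=> E; rewrite -[RHS]E [RHS]mxE; apply: eq_bigr => j _.
by rewrite [(_ ^T) _ _]mxE.
Qed.

Context (Sig : set (set 'rV[R]_n)) (finS : finite_set Sig).
Hypothesis simpS : forall sig, Sig sig ->
  exists s (A : 'M[nat]_(s, n)), unimodular_simplex sig A.

(** Points whose logarithm vector avoids the lower-dimensional cones: the
    numbers L and N only see the n-simplices. *)
Definition generic x := (forall j, x 0 j != 0) /\
  forall sig, Sig sig -> sig (neg_log x) -> top_simplices Sig sig.

Lemma nontop_hyperplane sig : Sig sig -> ~ top_simplices Sig sig ->
  exists2 u, u != 0 & forall w, sig w -> dotp u w = 0.
Proof.
move=> Ss nt; have [s [A [sA uA sE]]] := simpS Ss.
have [le_sn _] := uA.
move: (le_sn); rewrite leq_eqVlt => /orP[/eqP E|sn]; last first.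
  by rewrite sE; exact: low_cone_hyperplane.
by case: nt; split => //; subst s; exists A.
Qed.

(** First make all coordinates nonzero, then perturb - ln |x| off the finitely
    many hyperplanes containing the lower-dimensional cones. *)
Lemma generic_dense x (Q : set 'rV[R]_n) : nbhs x Q -> exists2 x', Q x' & generic x'.
Proof.
move=> nQ.
have n2 : \forall t \near (0 : R)^'+, nbhs (t *: const_mx 1 + x) Q.
  exact: (@cvg_shift_right _ _ x (const_mx 1) _ (nbhs_interior nQ)).
have [t [tQ t0]] := filter_ex (filterI n2 (near_shift_neq0 x)).
set x1 := t *: const_mx 1 + x in tQ t0.
(* the inverse of - ln |.| on the orthant of x1 *)
pose E w : 'rV[R]_n := \row_j (Num.sg (x1 0 j) * expR (- w 0 j)).
have Elog : E (neg_log x1) = x1.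
  apply/rowP => j; rewrite [LHS]mxE [neg_log x1 0 j]mxE opprK lnK ?posrE ?normr_gt0 ?t0 //.
  by rewrite -numEsg.
have cE : E z @[z --> neg_log x1] --> E (neg_log x1).
  apply: (@cvg_rV _ _ _ (nbhs (neg_log x1))) => j; rewrite mxE; under eq_cvg do rewrite mxE.
  apply: cvgMl_tmp.
  have c1 : - (z : 'rV[R]_n) 0 j @[z --> neg_log x1] --> - (neg_log x1) 0 j.
    exact: (cvgN (@coord_continuous R 1 n 0 j (neg_log x1))).
  exact: (cvg_comp _ _ c1 (@continuous_expR R _)).
have nE : nbhs (neg_log x1) (E @^-1` Q) by apply: cE; rewrite Elog.
have [us usP] : exists us : seq 'rV[R]_n, (forall u, u \in us -> u != 0) /\
    forall sig, Sig sig -> ~ top_simplices Sig sig ->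
      exists2 u, u \in us & forall w, sig w -> dotp u w = 0.
  have ch sig : exists u, Sig sig -> ~ top_simplices Sig sig ->
      u != 0 /\ forall w, sig w -> dotp u w = 0.
    have [h|h] := pselect (Sig sig /\ ~ top_simplices Sig sig).
      by have [u u0 uw] := nontop_hyperplane h.1 h.2; exists u.
    by exists 0 => h1 h2; case: h.
  have [g gP] := choice ch.
  have /finite_fsetP[F FE] := finS.
  exists [seq g sig | sig <- enum_fset F & `[< ~ top_simplices Sig sig >]]; split.
    move=> u /mapP[sig]; rewrite mem_filter => /andP[/asboolP nt sF] ->.
    by have [] := gP sig _ nt; rewrite ?FE.
  move=> sig Ss nt; exists (g sig); last by have [] := gP sig Ss nt.
  apply: map_f; rewrite mem_filter; apply/andP; split; first exact/asboolP.
  by move: Ss; rewrite FE.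
have [w' w'Q w'u] := generic_near usP.1 nE.
exists (E w') => //.
have Ej j : E w' 0 j != 0.
  by rewrite mxE mulf_neq0 ?sgr_eq0 // gt_eqF ?expR_gt0.
have logE : neg_log (E w') = w'.
  apply/rowP => j; rewrite mxE [E w' 0 j]mxE normrM normr_sg t0 mul1r.
  by rewrite ger0_norm ?expR_ge0 // expRK opprK.
split => // sig Ss; rewrite logE => sw; apply: contrapT => nt.
have [u uus uw] := usP.2 sig Ss nt.
by have := w'u u uus; rewrite uw // eqxx.
Qed.

Lemma generic_extend (D : set 'rV[R]_n) (lhs rhs : 'rV[R]_n -> R) : open D ->
  (forall x, D x -> {for x, continuous lhs}) ->
  (forall x, D x -> {for x, continuous rhs}) ->
  (forall x, D x -> generic x -> lhs x <= rhs x) ->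
  forall x, D x -> lhs x <= rhs x.
Proof.
move=> oD cl cr H x Dx; rewrite leNgt; apply/negP => lt.
have cd : {for x, continuous (fun z => lhs z - rhs z)}.
  by apply: continuousB; [exact: cl|exact: cr].
have nz : lhs x - rhs x != 0 by rewrite gt_eqF // subr_gt0.
have n1 : \forall z \near x, 0 < lhs z - rhs z.
  by have := cvgr_gt _ cd; apply; rewrite subr_gt0.
have n2 : \forall z \near x, D z by exact: open_nbhs_nbhs.
have [x' [Dx' p'] gx'] := generic_dense (filterI n2 n1).
by move: p'; rewrite subr_gt0 ltNge H.
Qed.

End fan_cover.

(** * Comparison and gradient inequalities near the origin *)

Section global_estimates.
Context (R : realType) (n : nat) (U : set 'rV[R]_n) (f : 'rV[R]_n -> R)
    (Sig : set (set 'rV[R]_n))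
    (U0 : open_nbhs (0 : 'rV[R]_n) U)
    (sf : smooth_on U f)
    (f0 : f 0 = 0)
    (N0 : newton f !=set0)
    (fnd : newton_nondegenerate f)
    (fKN : KN_condition f)
    (Sigsub : unimodular_subdivision f Sig).
Implicit Types (x : 'rV[R]_n) (sig : set 'rV[R]_n) (k : 'I_n) (c : R).

Let finS : finite_set Sig. Proof. by have [[]] := Sigsub. Qed.
Let simpS sig : Sig sig -> exists s (A : 'M[nat]_(s, n)), unimodular_simplex sig A.
Proof. by have [_ + _ _] := Sigsub; apply. Qed.
Let oU : open U. Proof. by case: U0. Qed.
Let zU : U 0. Proof. by case: U0. Qed.

Lemma nonneg_cover w : nonneg w -> exists2 sig, Sig sig & sig w.
Proof.
move=> w0; have [_ _ cov _] := Sigsub.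
suff : (\bigcup_(sig in Sig) sig) w by move=> [sig Ss sw]; exists sig.
rewrite cov; exists (closure (gface_class f w)); first by exists w.
by apply: subset_closure.
Qed.

Lemma neg_log_nonneg x : (forall j, x 0 j != 0) -> box 1 x -> nonneg (neg_log x).
Proof.
move=> x0 x1 j; rewrite mxE oppr_ge0 ln_le0 //.
by apply: ltW.
Qed.

Lemma generic_top x : generic Sig x -> box 1 x ->
  exists2 sig, top_simplices Sig sig & sig (neg_log x).
Proof.
move=> [x0 gx] x1; have [sig Ss sw] := nonneg_cover (neg_log_nonneg x0 x1).
by exists sig => //; exact: gx.
Qed.

Lemma top_nonempty : top_simplices Sig !=set0.
Proof.
have nb : nbhs (0 : 'rV[R]_n) (box 1).
  by apply: open_nbhs_nbhs; split; [exact: box_open|move=> j; rewrite mxE normr0].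
have [x bx gx] := generic_dense finS simpS nb.
by have [sig ts _] := generic_top gx bx; exists sig.
Qed.

Lemma top_finite : finite_set (top_simplices Sig).
Proof. by apply: sub_finite_set finS => sig []. Qed.

(** The generators of a simplex of the subdivision lie in one cone of the
    fan of the Newton polyhedron, so their minima are attained at one exponent. *)
Lemma top_vertex sig : top_simplices Sig sig ->
  [/\ sig = cone (generators sig), row_free (embed (generators sig) : 'M[R]_n) &
   exists al, [/\ supp f al,
     forall k be, supp f be ->
       (ndot (row k (generators sig)) al <= ndot (row k (generators sig)) be)%N &
     forall k, lmin f (generator sig k) = (ndot (row k (generators sig)) al)%:R]].
Proof.
move=> [Ss [A0 A0s]].
have [sA uA sE] : unimodular_simplex sig (generators sig).
  by rewrite /generators; apply:
    (@xgetPex _ (const_mx 0%N) [set A | unimodular_simplex sig A]); exists A0.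
split => //; have [_ _ _ sub] := Sigsub.
have [tau Stau st] := sub _ Ss.
have [al sal alm] := Sigma0_vertex N0 Stau.
have row_in k : tau (embed (row k (generators sig))).
  apply: st; rewrite {1}sE; exists 'e_k.
    by move=> i; rewrite /= mxE; case: (_ && _).
  by rewrite -rowE; apply/rowP => j; rewrite !mxE.
exists al; split => // [k be sbe|k].
  by have := alm _ (row_in k) be sbe; rewrite !dotp_embed ler_nat.
rewrite (lmin_supp (embed_nonneg _) sal) ?dotp_embed //.
by move=> be sbe; have := alm _ (row_in k) be sbe; rewrite dotp_embed.
Qed.

Lemma supp_neq0 al : supp f al -> exists j, (0 < al 0%R j)%N.
Proof.
move=> sal; apply: contrapT => /forallNP H.
have al0 : al = 0 by apply/rowP => j; rewrite mxE; apply/eqP; have := H j; case: posnP.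
move: sal; rewrite /supp /taylor_coef /multipartial al0.
have -> : flatten [seq nseq ((0%R : 'rV[nat]_n) 0%R j) j | j <- enum 'I_n] = [::].
  by elim: (enum 'I_n) => //= j s ->; rewrite mxE.
by rewrite /= f0 mul0r eqxx.
Qed.

Lemma free_column (A : 'M[nat]_n) j : row_free (embed A : 'M[R]_n) ->
  exists k, (0 < A k j)%N.
Proof.
rewrite row_free_unit => Au; apply: contrapT => /forallNP H.
have : (invmx (embed A) *m (embed A : 'M[R]_n)) j j = 1 by rewrite mulVmx // mxE eqxx.
rewrite mxE big1 => [/eqP|k _]; first by rewrite eq_sym oner_eq0.
by rewrite !mxE; have := H k; case: posnP => // ->; rewrite mulr0.
Qed.

Lemma some_positive sig : top_simplices Sig sig ->
  exists k, 1 <= lmin f (generator sig k).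
Proof.
move=> ts; have [_ fr [al [sal alm lE]]] := top_vertex ts.
have [j alj] := supp_neq0 sal; have [k Ak] := free_column j fr.
exists k; rewrite lE ler1n /ndot (bigD1 j) //= addn_gt0.
by rewrite muln_gt0 mxE Ak alj.
Qed.

(** The maximum is attained and the minima of the integral forms a^i on the
    polyhedron are integers, so the real power in the inequality reduces to an
    ordinary one. *)
Lemma Lnum_nat : exists L : nat, [/\ Lnum f Sig = L%:R, (0 < L)%N &
  forall sig k, top_simplices Sig sig -> lmin f (generator sig k) <= L%:R].
Proof.
have lE sig : top_simplices Sig sig -> exists k, l_simplex f sig = lmin f (generator sig k) /\
    forall i, lmin f (generator sig i) <= lmin f (generator sig k).
  move=> ts; have [k _] := some_positive ts.
  have [|k0 [_ Ek H]] := maximum_finite (fun i =>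
    lmin f (generator sig i)) (finite_finset : finite_set [set: 'I_n]).
    by exists k.
  by exists k0; split => [|i]; [exact: Ek|exact: H].
have [sig [ts E H]] := maximum_finite (l_simplex f) top_finite top_nonempty.
have [k [E1 H1]] := lE sig ts.
have [_ _ [al [sal alm lal]]] := top_vertex ts.
exists (ndot (row k (generators sig)) al).
have LE : Lnum f Sig = (ndot (row k (generators sig)) al)%:R by rewrite /Lnum E E1 lal.
have bnd sig' i : top_simplices Sig sig' ->
  lmin f (generator sig' i) <= (ndot (row k (generators sig)) al)%:R.
  move=> ts'; rewrite -LE /Lnum E; apply: le_trans (H _ ts').
  by have [k' [-> H']] := lE _ ts'.
split => //; have [k1 h1] := some_positive ts.
by rewrite -(ltr_nat R); apply: lt_le_trans (le_trans h1 (bnd _ _ ts)).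
Qed.

Lemma Nnum_nat : exists N : nat, [/\ Nnum f Sig = N%:R, (0 < N)%N &
  forall sig, top_simplices Sig sig -> \sum_k lmin f (generator sig k) <= N%:R].
Proof.
have [sig [ts E H]] := maximum_finite (N_simplex f) top_finite top_nonempty.
have [_ _ [al [sal alm lal]]] := top_vertex ts.
exists (\sum_k ndot (row k (generators sig)) al)%N.
have NE : Nnum f Sig = (\sum_k ndot (row k (generators sig)) al)%:R.
  by rewrite /Nnum E /N_simplex natr_sum; apply: eq_bigr => k _; rewrite lal.
have bnd sig' : top_simplices Sig sig' -> \sum_k lmin f (generator sig' k) <=
    (\sum_k ndot (row k (generators sig)) al)%:R.
  by move=> ts'; rewrite -NE /Nnum E; exact: (H _ ts').
split => //; have [k1] := some_positive ts; rewrite lal ler1n => h1.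
by rewrite (bigD1 k1) //= addn_gt0 h1.
Qed.

Lemma globalize (lhs rhs : 'rV[R]_n -> R) (D : set 'rV[R]_n) :
  open D -> D 0 ->
  (forall x, D x -> {for x, continuous lhs}) ->
  (forall x, D x -> {for x, continuous rhs}) ->
  (forall sig, top_simplices Sig sig -> \forall c \near (0 : R)^'+,
     forall x, (forall j, x 0 j != 0) -> cone (generators sig) (neg_log x) ->
       box c x -> c * lhs x <= rhs x) ->
  exists2 c : R, 0 < c & box c `<=` D /\ forall x, box c x -> c * lhs x <= rhs x.
Proof.
move=> oD D0 cl cr H.
have [e e0 eD] : exists2 e : R, 0 < e & box e `<=` D.
  by apply: nbhs0_box; exact: open_nbhs_nbhs.
have nS : \forall c \near (0 : R)^'+, forall sig, top_simplices Sig sig ->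
    forall x, (forall j, x 0 j != 0) -> cone (generators sig) (neg_log x) ->
      box c x -> c * lhs x <= rhs x.
  exact: near_finite top_finite H.
have n1 : \forall c \near (0 : R)^'+, 0 < c by exact: nbhs_right_gt.
have n2 : \forall c \near (0 : R)^'+, c <= Num.min e 1.
  by apply: nbhs_right_le; rewrite lt_min e0 ltr01.
have : exists c, (0 < c /\ c <= Num.min e 1) /\ forall sig, top_simplices Sig sig ->
    forall x, (forall j, x 0 j != 0) -> cone (generators sig) (neg_log x) ->
      box c x -> c * lhs x <= rhs x.
  apply: (@filter_ex R (0 : R)^'+).
  by apply: filterI nS; exact: filterI n1 n2.
move=> [c [[c0 ce] cS]].
move: ce; rewrite le_min => /andP[ce c1].
have bD : box c `<=` D by move=> x bx; apply: eD => j; exact: lt_le_trans (bx j) ce.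
exists c => //; split => //.
apply: (@generic_extend _ _ Sig finS simpS (box c) (fun x => c * lhs x) rhs (box_open (e := c))).
- move=> x bx; apply: continuousM; first exact: cst_continuous.
  exact: (cl _ (bD _ bx)).
- by move=> x bx; exact: (cr _ (bD _ bx)).
move=> x bx gx; have b1 : box 1 x by move=> j; exact: lt_le_trans (bx j) c1.
have [sig ts sx] := generic_top gx b1.
by apply: (cS sig ts) => //; [have [] := gx|have [<- _ _] := top_vertex ts].
Qed.

Lemma norm_exp_continuous (h : 'rV[R]_n -> R) p x : {for x, continuous h} ->
  {for x, continuous (fun z => `|h z| ^+ p)}.
Proof.
move=> ch; have cn : `|h z| @[z --> x] --> `|h x| by exact: (cvg_norm ch).
exact: (cvg_comp _ _ cn (@exprn_continuous R p `|h x|)).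
Qed.

Lemma comparison_ineq (V : set 'rV[R]_n) (g : 'rV[R]_n -> R) (L : nat) :
  open_nbhs (0 : 'rV[R]_n) V -> smooth_on V g ->
  (\forall x \near (0 : 'rV[R]_n), f x = 0 -> g x = 0) ->
  (0 < L)%N ->
  (forall sig k, top_simplices Sig sig -> lmin f (generator sig k) <= L%:R) ->
  exists2 c : R, 0 < c & forall x, box c x -> c * `|g x| ^+ L <= `|f x|.
Proof.
move=> [oV V0] sg fg0 L0 lL.
have [|||||c c0 [_ cP]] := @globalize (fun x => `|g x| ^+ L) (fun x => `|f x|) (U `&` V).
- exact: openI.
- by [].
- by move=> x [Ux Vx]; apply: norm_exp_continuous; have [] := sg [::] x Vx.
- by move=> x [Ux Vx]; have [c1 _] := @sf [::] x Ux; exact: (cvg_norm c1).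
- move=> sig ts; have [_ fr [al [sal alm lal]]] := top_vertex ts.
  apply: (comparison_ineq_cone oU zU sf fnd fKN fr sal alm oV V0 sg fg0 L0) => k.
  by rewrite -(ler_nat R) -lal; exact: lL.
- by exists c.
Qed.

Lemma enorm_gradient_continuous x : U x -> {for x, continuous (fun z => enorm (gradient f z))}.
Proof.
move=> Ux; rewrite /enorm.
have cd : dotp (gradient f z) (gradient f z) @[z --> x] --> dotp (gradient f x) (gradient f x).
  apply: (@cvg_sumr _ _ (nbhs x)) => j _; rewrite !mxE; under eq_cvg do rewrite !mxE.
  by have [c1 _] := @sf [:: j] x Ux; apply: cvgM; exact: c1.
exact: (cvg_comp _ _ cd (@sqrt_continuous R _)).
Qed.

Lemma gradient_ineq (N : nat) : (0 < N)%N ->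
  (forall sig, top_simplices Sig sig -> \sum_k lmin f (generator sig k) <= N%:R) ->
  exists2 c : R, 0 < c & box c `<=` U /\
    forall x, box c x -> c * `|f x| ^+ N.-1 <= enorm (gradient f x) ^+ N.
Proof.
move=> Np lN.
apply: (@globalize (fun x => `|f x| ^+ N.-1) (fun x => enorm (gradient f x) ^+ N) U) => //.
- by move=> x Ux; apply: norm_exp_continuous; have [] := @sf [::] x Ux.
- move=> x Ux; have ce := enorm_gradient_continuous Ux.
  exact: (cvg_comp _ _ ce (@exprn_continuous R N _)).
move=> sig ts; have [_ fr [al [sal alm lal]]] := top_vertex ts.
apply: (gradient_ineq_cone oU zU sf fnd fKN fr sal alm).
  rewrite -(ler_nat R) natr_sum; apply: le_trans (lN _ ts).
  by apply: ler_sum => k _; rewrite lal.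
have [k] := some_positive ts; rewrite lal ler1n => h; by exists k.
Qed.

End global_estimates.

(** * From the gradient inequality to the distance inequality *)

Section descent.
Context {R : realType} {n : nat}.
Implicit Types (x y z : 'rV[R]_n) (t a b : R).

Definition nth_root (N : nat) a : R := a `^ (N%:R^-1).

Lemma nth_rootK N a : (0 < N)%N -> 0 <= a -> nth_root N a ^+ N = a.
Proof.
move=> N0 a0; rewrite /nth_root -powR_mulrn ?powR_ge0 // -powRrM mulVf ?powRr1 //.
by rewrite pnatr_eq0 -lt0n.
Qed.

Lemma nth_root_ge0 N a : 0 <= nth_root N a. Proof. exact: powR_ge0. Qed.

Lemma nth_root_le N a b : (0 < N)%N -> 0 <= a -> 0 <= b -> (nth_root N a <= b) = (a <= b ^+ N).
Proof.
by move=> N0 a0 b0; rewrite -{2}(nth_rootK N0 a0) ler_pXn2r // nnegrE nth_root_ge0.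
Qed.

Lemma nth_root_lt N a b : (0 < N)%N -> 0 <= a -> 0 <= b -> (nth_root N a < b) = (a < b ^+ N).
Proof.
by move=> N0 a0 b0; rewrite -{2}(nth_rootK N0 a0) ltr_pXn2r // nnegrE nth_root_ge0.
Qed.

Lemma nth_root_gt N a b : (0 < N)%N -> 0 <= a -> 0 <= b -> (b < nth_root N a) = (b ^+ N < a).
Proof. by move=> N0 a0 b0; rewrite !ltNge nth_root_le. Qed.

Lemma nth_root_norm_continuous N (h : 'rV[R]_n -> R) x : (0 < N)%N ->
  {for x, continuous h} -> {for x, continuous (fun z => nth_root N `|h z|)}.
Proof.
move=> N0 ch; have cn : `|h z| @[z --> x] --> `|h x| by exact: (cvg_norm ch).
apply/(@cvgrPdist_lt _ _ _ (nbhs x)) => e e0.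
set r := nth_root N `|h x|; have r0 : 0 <= r by exact: nth_root_ge0.
have n1 : \forall z \near x, `|h z| < (r + e) ^+ N.
  have := cvgr_lt _ cn; apply; rewrite -nth_root_lt ?addr_ge0 ?(ltW e0) //.
  by rewrite ltrDl.
have n2 : \forall z \near x, r - e < nth_root N `|h z|.
  have [re|re] := ltP (r - e) 0.
    by near=> z; exact: lt_le_trans re (nth_root_ge0 _ _).
  have : \forall z \near x, (r - e) ^+ N < `|h z|.
    by have := cvgr_gt _ cn; apply; rewrite -nth_root_gt // ltrBlDr ltrDl.
  by apply: filterS => z; rewrite -nth_root_gt.
near=> z; rewrite ltr_distlC; apply/andP; split; first by near: z.
rewrite nth_root_lt // ?addr_ge0 ?(ltW e0) //; by near: z.
Unshelve. all: by end_near. Qed.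

(** Bernoulli's inequality for (1 - h / r)^N, multiplied by r^N. *)
Lemma bernoulli N (r h : R) : 0 <= h <= r ->
  r ^+ N - N%:R * r ^+ N.-1 * h <= (r - h) ^+ N.
Proof.
move=> /andP[h0 hr]; have r0 : 0 <= r by exact: le_trans hr.
elim: N => [|[|N] IH]; first by rewrite !expr0 !mul0r subr0.
  by rewrite !expr1 /= expr0 !mul1r.
rewrite [leRHS]exprS; have rh : 0 <= r - h by rewrite subr_ge0.
apply: le_trans (ler_wpM2l rh IH); rewrite /= -subr_ge0.
have -> : (r - h) * (r ^+ N.+1 - N.+1%:R * r ^+ N * h) -
   (r ^+ N.+2 - N.+2%:R * r ^+ N.+1 * h) = N.+1%:R * r ^+ N * h ^+ 2.
  by rewrite !exprS -!natr1; ring.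
by rewrite !mulr_ge0 // ?exprn_ge0.
Qed.

Lemma gradient_descent (U : set 'rV[R]_n) (f : 'rV[R]_n -> R) z :
  open U -> Ck U 1 f -> U z -> f z != 0 -> 0 < enorm (gradient f z) ->
  exists2 v : 'rV[R]_n, enorm v = 1 & \forall t \near (0 : R)^'+,
    `|f (t *: v + z)| <= `|f z| - t * (enorm (gradient f z) / 2).
Proof.
move=> oU Cf Uz fz0 Dp; set D := enorm (gradient f z) in Dp *.
have [df dE] := Ck_diff oU Cf Uz.
pose s := Num.sg (f z).
have s2 : s * s = 1 by rewrite -expr2 sqr_sg fz0.
pose v := (- s / D) *: gradient f z.
have sN : `|s| = 1 by rewrite normr_sg fz0.
exists v.
  by rewrite enormZ -/D normrM normrN sN mul1r normfV (gtr0_norm Dp) mulVf ?gt_eqF.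
have Dv : 'D_v f z = - s * D.
  rewrite (deriveE _ df) dE /dotpr dotpC dotpZ -enorm_sqr -/D expr2.
  by field; rewrite gt_eqF.
have dv : derivable f z v by exact: diff_derivable.
have cq : t^-1 *: (f (t *: v + z) - f z) @[t --> (0 : R)^'+] --> - s * D.
  rewrite -Dv; apply: cvg_dnbhs_at_right; exact: dv.
have nq : \forall t \near (0 : R)^'+,
    `|- s * D - t^-1 *: (f (t *: v + z) - f z)| <= D / 2.
  by have /cvgrPdist_le := cq; apply; rewrite divr_gt0.
near=> t.
have t0 : 0 < t by near: t; exact: nbhs_right_gt.
have tf : t <= `|f z| / (2 * D).
  near: t; apply: nbhs_right_le; rewrite divr_gt0 ?normr_gt0 // mulr_gt0 //.
have : `|- s * D - t^-1 *: (f (t *: v + z) - f z)| <= D / 2 by near: t.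
set q := t^-1 *: _; have fE : f (t *: v + z) = f z + t * q.
  by rewrite /q -[t^-1 *: _]/(t^-1 * _) mulrA mulfV ?gt_eqF // mul1r [RHS]addrC subrK.
have sq : `|- s * D - q| = `|- D - s * q|.
  have -> : - s * D - q = s * (- D - s * q) + (s * s - 1) * q by ring.
  by rewrite s2 subrr mul0r addr0 normrM sN mul1r.
rewrite sq ler_norml => /andP[q1 q2].
have -> : `|f (t *: v + z)| = `| `|f z| + t * (s * q)|.
  rewrite fE -[in LHS](mul1r (f z + _)) -s2 -mulrA normrM sN mul1r mulrDr.
  by rewrite -normrEsg; congr (`| _ + _ |); ring.
move: tf; rewrite ler_pdivlMr ?mulr_gt0 // => tf.
have h1 : t * (s * q) <= - (t * (D / 2)).
  rewrite -mulrN; apply: ler_wpM2l; [exact: ltW|lra].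
have h2 : - (t * (2 * D)) <= t * (s * q).
  rewrite -mulrN; apply: ler_wpM2l; [exact: ltW|lra].
rewrite ger0_norm; lra.
Unshelve. all: by end_near. Qed.

Lemma enorm_box x c : enorm x < c -> box c x.
Proof. by move=> xc j; exact: le_lt_trans (coord_le_enorm x j) xc. Qed.

Lemma edist_le x (Z : set 'rV[R]_n) y : Z y -> edist_to x Z <= enorm (x - y).
Proof.
move=> Zy; apply: ge_inf; last by exists y.
by exists 0 => _ [w _ <-]; exact: enorm_ge0.
Qed.

Lemma edist_ge0 x (Z : set 'rV[R]_n) y : Z y -> 0 <= edist_to x Z.
Proof.
move=> Zy; apply: lb_le_inf; first by exists (enorm (x - y)), y.
by move=> _ [w _ <-]; exact: enorm_ge0.
Qed.

(** Suppose that |f x0| < (k d)^N with d the distance from x0 to the zero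
    set, and minimize |f|^(1/N) + k |x - x0| over the ball of radius d about x0.
    The value at x0 is below k d, so the minimum is attained at an interior
    point z, where f does not vanish. At z the gradient inequality bounds the
    slope of |f|^(1/N) below by a constant k1 > k, so a small step against the
    gradient decreases the sum: a contradiction. *)
Lemma distance_of_gradient (U : set 'rV[R]_n) (f : 'rV[R]_n -> R) (N : nat) (c : R) :
  open U -> Ck U 1 f -> f 0 = 0 -> (0 < N)%N -> 0 < c -> box c `<=` U ->
  (forall x, box c x -> c * `|f x| ^+ N.-1 <= enorm (gradient f x) ^+ N) ->
  exists2 k : R, 0 < k & forall x, enorm x < c / 2 ->
    k * edist_to x [set y | U y /\ f y = 0] ^+ N <= `|f x|.
Proof.
move=> oU Cf f0 N0 c0 bU H.
(* c1 <= 1 makes c1^N <= c, so that the gradient inequality implies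
   c1 |f|^((N-1)/N) <= |grad f| *)
pose c1 := Num.min c 1.
have c1p : 0 < c1 by rewrite lt_min c0 ltr01.
have c1c : c1 ^+ N <= c.
  apply: (@le_trans _ _ c1); last by rewrite ge_min lexx.
  by rewrite -[leRHS]expr1 ler_wiXn2l // ?(ltW c1p) // ge_min lexx orbT.
(* k1 is the slope of |f|^(1/N) along the descent direction: half of the
   gradient bound, divided by the exponent N of Bernoulli's inequality *)
pose k1 := c1 / (2 * N%:R).
have Np : 0 < N%:R :> R by rewrite ltr0n.
have k1p : 0 < k1 by rewrite divr_gt0 // mulr_gt0.
pose k := k1 / 2.
have kp : 0 < k by rewrite divr_gt0.
exists (k ^+ N); first by rewrite exprn_gt0.
move=> x0 x0c; set Z := [set y | U y /\ f y = 0]; set d := edist_to x0 Z.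
have Z0 : Z 0 by split => //; apply: bU => j; rewrite mxE normr0.
have d0 : 0 <= d by exact: edist_ge0 Z0.
have dx : d <= enorm x0 by have := edist_le x0 Z0; rewrite subr0.
rewrite -exprMn leNgt; apply/negP => lt.
have dp : 0 < d.
  rewrite lt_neqAle d0 andbT eq_sym; apply/eqP => dz; move: lt.
  by rewrite dz mulr0 expr0n gtn_eqF // ltNge normr_ge0.
pose B := [set x : 'rV[R]_n | enorm (x - x0) <= d].
have BU x : B x -> box c x.
  move=> Bx; apply: enorm_box; rewrite -[x](subrK x0).
  by apply: le_lt_trans (enorm_triangle _ _) _; move: Bx; rewrite /B /=; lra.
pose psi x := nth_root N `|f x| + k * enorm (x - x0).
have cpsi x : B x -> {for x, continuous psi}.
  move=> Bx; apply: continuousD.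
    by apply: nth_root_norm_continuous => //; exact: Ck_cont Cf (bU _ (BU _ Bx)).
  apply: continuousM; first exact: cst_continuous.
  have cs : z - x0 @[z --> x] --> x - x0.
    by apply: (@cvgB _ _ _ (nbhs x) _ id (fun=> x0)) => //; exact: cvg_cst.
  exact: (cvg_comp _ _ cs (@enorm_continuous _ _ _)).
have Bx0 : B x0 by rewrite /B /= subrr enorm0.
have [z Bz zmin] : exists2 z, z \in B & forall x, x \in B -> psi z <= psi x.
  apply: EVT_min_rV; [by exists x0|exact: eball_compact|].
  by apply: continuous_in_subspaceT => x /set_mem; exact: cpsi.
have {}Bz := set_mem Bz.
have zd : enorm (z - x0) < d.
  rewrite -(ltr_pM2l kp); apply: (@le_lt_trans _ _ (psi z)); first by rewrite lerDr nth_root_ge0.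
  apply: le_lt_trans (zmin _ (mem_set Bx0)) _.
  by rewrite /psi subrr enorm0 mulr0 addr0 nth_root_lt // mulr_ge0 // ltW.
have Uz : U z by exact: bU (BU _ Bz).
have fz : f z != 0.
  apply/eqP => fz; have := @edist_le x0 Z z (conj Uz fz).
  by rewrite -/d -enormN opprB leNgt zd.
set r := nth_root N `|f z|.
have rp : 0 < r by rewrite nth_root_gt // expr0n gtn_eqF // normr_gt0.
have rN : r ^+ N = `|f z| by exact: nth_rootK.
set D := enorm (gradient f z).
have DD : c1 * r ^+ N.-1 <= D.
  rewrite -(@ler_pXn2r _ N) ?nnegrE ?enorm_ge0 //; last by rewrite mulr_ge0 ?exprn_ge0 // ltW.
  apply: le_trans (H _ (BU _ Bz)); rewrite exprMn -exprM mulnC exprM rN.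
  by apply: ler_wpM2r => //; rewrite exprn_ge0.
have Dp : 0 < D by apply: lt_le_trans DD; rewrite mulr_gt0 // exprn_gt0.
have [v v1 nv] := gradient_descent oU Cf Uz fz Dp.
have : exists t, [/\ 0 < t, t <= d - enorm (z - x0), t * k1 <= r &
    `|f (t *: v + z)| <= `|f z| - t * (D / 2)].
  apply: (@filter_ex R (0 : R)^'+); near=> t; split.
  - by near: t; exact: nbhs_right_gt.
  - by near: t; apply: nbhs_right_le; rewrite subr_gt0.
  - by rewrite -ler_pdivlMr //; near: t; apply: nbhs_right_le; rewrite divr_gt0.
  - by near: t.
move=> [t [t0 td tr tf]].
have tv : enorm (t *: v + z - x0) <= enorm (z - x0) + t.
  rewrite -addrA addrC; apply: le_trans (enorm_triangle _ _) _.
  by rewrite enormZ v1 mulr1 gtr0_norm.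
have Bt : B (t *: v + z) by rewrite /B /=; lra.
have := zmin _ (mem_set Bt); rewrite leNgt => /negP; apply.
have rt : nth_root N `|f (t *: v + z)| <= r - t * k1.
  rewrite nth_root_le ?subr_ge0 //; apply: (le_trans tf).
  have tk : 0 <= t * k1 <= r by rewrite tr mulr_ge0 // ltW.
  apply: le_trans (bernoulli N tk); rewrite rN lerD2l lerN2.
  have -> : N%:R * r ^+ N.-1 * (t * k1) = t * (c1 * r ^+ N.-1 / 2).
    by rewrite /k1; field; rewrite gt_eqF.
  by rewrite ler_pM2l // ler_pM2r // invr_gt0.
rewrite /psi -/r; apply: (@le_lt_trans _ _ ((r - t * k1) + k * (enorm (z - x0) + t))).
  by apply: lerD => //; rewrite ler_pM2l.
have -> : t * k1 = 2 * (k * t) by rewrite /k; field.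
by have := mulr_gt0 kp t0; rewrite mulrDr; lra.
Unshelve. all: by end_near. Qed.

End descent.

Theorem theorem3p1 (R : realType) (n : nat)
    (U : set 'rV[R]_n) (f : 'rV[R]_n -> R) (Sig : set (set 'rV[R]_n))
    (U0 : open_nbhs (0 : 'rV[R]_n) U)
    (fsmooth : smooth_on U f)
    (f0 : f 0 = 0)
    (gradf0 : gradient f 0 = 0)
    (newton_neq0 : newton f !=set0)
    (fnondeg : newton_nondegenerate f)
    (fKN : KN_condition f)
    (Sigsub : unimodular_subdivision f Sig) :
  [/\ forall (V : set 'rV[R]_n) (g : 'rV[R]_n -> R),
        open_nbhs (0 : 'rV[R]_n) V -> smooth_on V g ->
        (\forall x \near (0 : 'rV[R]_n), f x = 0 -> g x = 0) ->
        exists c eps : R, [/\ 0 < c, 0 < eps &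
          forall x : 'rV[R]_n, enorm x < eps ->
            `|f x| >= c * `|g x| `^ Lnum f Sig],
      exists c eps : R, [/\ 0 < c, 0 < eps &
        forall x : 'rV[R]_n, enorm x < eps ->
          enorm (gradient f x) >= c * `|f x| `^ (1 - 1 / Nnum f Sig)]
    & exists c eps : R, [/\ 0 < c, 0 < eps &
        forall x : 'rV[R]_n, enorm x < eps ->
          `|f x| >= c * edist_to x [set y | U y /\ f y = 0] `^ Nnum f Sig]].
Proof.
have [oU zU] := U0.
have [L [LE L0 HL]] := Lnum_nat f0 newton_neq0 Sigsub.
have [N [NE N0 HN]] := Nnum_nat f0 newton_neq0 Sigsub.
have [c c0 [cU cP]] := gradient_ineq U0 fsmooth f0 newton_neq0 fnondeg fKN Sigsub N0 HN.
split.
- move=> V g V0 gs fg0.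
  have [c' c'0 H] := comparison_ineq U0 fsmooth newton_neq0 fnondeg fKN Sigsub V0 gs fg0 L0 HL.
  exists c', c'; split => // x xc.
  by rewrite LE powR_mulrn //; apply: H; exact: enorm_box.
- exists (nth_root N c), c; split => //; first by rewrite powR_gt0.
  move=> x xc; rewrite NE -(@ler_pXn2r _ N) ?nnegrE ?enorm_ge0 //; last first.
    by rewrite mulr_ge0 ?powR_ge0.
  apply: le_trans (cP x (enorm_box xc)); rewrite exprMn nth_rootK ?(ltW c0) //.
  rewrite -[X in _ * X <= _]powR_mulrn ?powR_ge0 // -powRrM.
  have -> : (1 - 1 / N%:R) * N%:R = N.-1%:R :> R.
    rewrite -[in X in _ * X](prednK N0) -natr1 -{1}(prednK N0) -natr1; field.
    by rewrite natr1 pnatr_eq0.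
  by rewrite powR_mulrn.
have [k k0 H] := distance_of_gradient oU (smooth_on_Ck 1 fsmooth) f0 N0 c0 cU cP.
exists k, (c / 2); split => //; first by rewrite divr_gt0.
move=> x xc; have Z0 : [set y | U y /\ f y = 0] 0 by [].
by rewrite NE powR_mulrn ?(edist_ge0 _ Z0) //; exact: H.
Qed.
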